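(* Let $\mathfrak g$ be an affine Lie algebra of type $X^{(r)}_N$ (any type in the list in the context). For $1\le a\le n$ and $j\in\mathbb Z_{\ge0}$ let $$Q^{(a)}_j=\sum_{\lambda\in\overline P^+}d_\lambda\,\mathrm{ch}\,V(\lambda)$$ be linear combinations of irreducible $\overset{\circ}{\mathfrak g}$-characters (the coefficients $d_\lambda$ depending on $(a,j)$) with the following properties. (A) $d_\lambda\in\mathbb C$, $d_{j\overline{\Lambda}_a}=1$, and $d_\lambda=0$ unless $\lambda\in j\overline{\Lambda}_a-\sum_{b=1}^n\mathbb Z_{\ge0}\,\alpha_b/\epsilon_b$. (B) $\{Q^{(a)}_j\}$ satisfies the $Q$-system: for all $1\le a\le n$, $j\ge1$, $$(Q^{(a)}_j)^2=Q^{(a)}_{j+1}Q^{(a)}_{j-1}+(Q^{(a)}_j)^2\prod_{b=1}^n\prod_{k\ge1}\bigl(Q^{(b)}_k\bigr)^{-(\tilde\alpha_a|\tilde\alpha_b)B_{aj,bk}/t^\vee_b}.$$ (C) $\displaystyle\lim_{j\to\infty}\frac{Q^{(a)}_j}{Q^{(a)}_{j+1}}=e^{-\overline{\Lambda}_a}$ in the domain $|e^{\alpha_1}|>1,\dots,|e^{\alpha_n}|>1$, for each $1\le a\le n$. Then for any non-negative integers $\nu^{(a)}_j$ ($1\le a\le n$, $j\ge1$), all but finitely many zero, $$\prod_{a=1}^n\prod_{j\ge1}\bigl(Q^{(a)}_j\bigr)^{\nu^{(a)}_j}=\sum_\lambda\tilde M_\infty(W,\lambda,1)\,\mathrm{ch}\,V(\lambda),$$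 where $W=\bigotimes_{a=1}^n\bigotimes_{j\ge1}(W^{(a)}_j)^{\otimes\nu^{(a)}_j}$ and $\lambda$ runs over $\bigl(\sum_{a=1}^n\sum_{i\ge1}i\nu^{(a)}_i\overline{\Lambda}_a-\sum_{b=1}^n\mathbb Z_{\ge0}\,\alpha_b/\epsilon_b\bigr)\cap\overline P^+$.
   Context: **Affine data.** $\mathfrak g=X^{(r)}_N$ is one of $A^{(1)}_n\,(n\ge1)$, $B^{(1)}_n\,(n\ge3)$, $C^{(1)}_n\,(n\ge2)$, $D^{(1)}_n\,(n\ge4)$, $E^{(1)}_{6,7,8}$, $F^{(1)}_4$, $G^{(1)}_2$, $A^{(2)}_{2n}\,(n\ge1)$, $A^{(2)}_{2n-1}\,(n\ge2)$, $D^{(2)}_{n+1}\,(n\ge2)$, $E^{(2)}_6$, $D^{(3)}_4$; $n$ is its rank (nodes $0,\dots,n$). $\overset{\circ}{\mathfrak g}$ is obtained by deleting node $0$: it is $X_N$ for $r=1$, and $C_n,C_n,B_n,F_4,G_2$ for $A^{(2)}_{2n},A^{(2)}_{2n-1},D^{(2)}_{n+1},E^{(2)}_6,D^{(3)}_4$. $\mathfrak g_{\overline0}$ equals $\overset{\circ}{\mathfrak g}$ except that $\mathfrak g_{\overline0}=B_n$ for $A^{(2)}_{2n}$ ($B_1=A_1$ when $n=1$). Numbering of nodes $1,\dots,n$: $A_n$: chain; $B_n$: chain, $\alpha_n$ short; $C_n$: chain, $\alpha_n$ long; $D_n$: chain $1,\dots,n-2$ with $n-2$ joined to $n-1$ and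 $n$; $E_6$: chain $1,\dots,5$, node $6$ joined to $3$; $E_7$: chain $1,\dots,6$, node $7$ joined to $3$; $E_8$: chain $1,\dots,7$, node $8$ joined to $5$; $F_4$: chain $1,2,3,4$ with $\alpha_1,\alpha_2$ long for $F^{(1)}_4$ and $\alpha_1,\alpha_2$ short for $E^{(2)}_6$; $G_2$: $\alpha_1$ long, $\alpha_2$ short for $G^{(1)}_2$, and $\alpha_1$ short, $\alpha_2$ long for $D^{(3)}_4$. Integers $t_a$ ($1\le a\le n$): $t_n=2$ for $B^{(1)}_n$; $t_a=2$ for $a<n$ for $C^{(1)}_n$; $t_3=t_4=2$ for $F^{(1)}_4$; $t_2=3$ for $G^{(1)}_2$; all other $t_a=1$. Integers $t^\vee_a$: $t^\vee_a=2$ for all $a$ for $A^{(2)}_{2n}$; $t^\vee_n=2$ for $A^{(2)}_{2n-1}$; $t^\vee_a=2$ for $a<n$ for $D^{(2)}_{n+1}$; $t^\vee_3=t^\vee_4=2$ for $E^{(2)}_6$; $t^\vee_2=3$ for $D^{(3)}_4$; all other $t^\vee_a=1$. $\epsilon_a=2$ if $\mathfrak g=A^{(2)}_{2n}$ and $a=n$; $\epsilon_a=1$ otherwise. $\alpha_a,\overline{\Lambda}_a$ are simple roots and fundamental weights of $\overset{\circ}{\mathfrak g}$; $\overline P=\bigoplus\mathbb Z\overline{\Lambda}_a$, $\overline P^+=\bigoplus\mathbb Z_{\ge0}\overline{\Lambda}_a$. $\tilde\alpha_a,\tilde\Lambda_a$ are those of $\mathfrak g_{\overline0}$ (same numbering),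 with invariant form $(\cdot|\cdot)$ normalized so that long roots have square length $2r$ (for $A^{(2)}_2$: $(\tilde\alpha_1|\tilde\alpha_1)=2$); equivalently $\frac{\epsilon_at_a}{t^\vee_a}(\tilde\alpha_a|\tilde\alpha_b)$ is the Cartan matrix $2(\tilde\alpha_a|\tilde\alpha_b)/(\tilde\alpha_a|\tilde\alpha_a)$ of $\mathfrak g_{\overline0}$. $\iota$ is the linear map with $\iota(\overline{\Lambda}_a)=\epsilon_a\tilde\Lambda_a$; then $\iota(\alpha_a)=\epsilon_a\tilde\alpha_a$. **Characters and $Q$-system.** $\mathrm{ch}\,V(\lambda)$ is the irreducible $\overset{\circ}{\mathfrak g}$-character of highest weight $\lambda$, in $\mathbb Z[x_1^{\pm1},\dots,x_n^{\pm1}]$ with $x_a=e^{\overline{\Lambda}_a}$ complex variables. $Q^{(a)}_0=1$, and $B_{aj,bk}=2\min(t_bj,t_ak)-\min(t_bj,t_a(k+1))-\min(t_bj,t_a(k-1))$. The second term on the right of the $Q$-system contains only finitely many factors, with non-negative powers. **The quantity $\tilde M_\infty$.** The symbols $W^{(a)}_j$ serve only to record the data $\nu^{(a)}_j$. For $\lambda\in\overline P$, $$\tilde M_\infty(W,\lambda,q)=\sum_{\{m\}}q^{c(\{m\})}\prod_{a=1}^n\prod_{i\ge1}\left[\begin{array}{c}p^{(a)}_i+m^{(a)}_i\\ m^{(a)}_i\end{array}\right]_{q^{t^\vee_a}},$$ $$c(\{m\})=\tfrac12\sum_{a,b=1}^n\sum_{j,k\ge1}(\tilde\alpha_a|\tilde\alpha_b)\min(t_bj,t_ak)m^{(a)}_jm^{(b)}_k-\sum_{a=1}^nt^\vee_a\sum_{j,k\ge1}\min(j,k)\nu^{(a)}_jm^{(a)}_k,$$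 $$p^{(a)}_i=\sum_{j\ge1}\nu^{(a)}_j\min(i,j)-\frac1{t^\vee_a}\sum_{b=1}^n\sum_{k\ge1}(\tilde\alpha_a|\tilde\alpha_b)\min(t_bi,t_ak)m^{(b)}_k,$$ summed over all $m^{(a)}_i\in\mathbb Z_{\ge0}$ with $\sum_{a,i}i\,m^{(a)}_i\tilde\alpha_a=\iota\bigl(\sum_{a,i}i\nu^{(a)}_i\overline{\Lambda}_a-\lambda\bigr)$ (no positivity condition on the $p^{(a)}_i$). Here, for $m\in\mathbb Z_{\ge0}$, $p\in\mathbb Z$, $\left[\begin{array}{c}p+m\\ m\end{array}\right]_q=\prod_{i=1}^m\frac{1-q^{p+i}}{1-q^i}$; at $q=1$ it equals $\frac{(p+1)(p+2)\cdots(p+m)}{m!}$. *)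

(* Defs.v *)
From HB Require Import structures.
From mathcomp Require Import all_boot all_order all_algebra finmap.
From mathcomp Require Import all_classical all_reals all_analysis.
From mathcomp Require Export complex.

Set Implicit Arguments.
Unset Strict Implicit.
Unset Printing Implicit Defensive.
Import Order.TTheory GRing.Theory Num.Theory.
Import numFieldNormedType.Exports.
Local Open Scope classical_set_scope.
Local Open Scope ring_scope.

(** * Finite and affine types

    Nodes are numbered 1, ..., n in the tables below; the node with label
    [a.+1] is the ordinal [a : 'I_n]. *)

(** F_4 and G_2 come with a choice of numbering: the boolean tells whether
    the first nodes (1, 2 for F_4; 1 for G_2) are the long ones. *)
Inductive fin_type : Type :=
| FinA of nat | FinB of nat | FinC of nat | FinD of nat
| FinE6 | FinE7 | FinE8 | FinF4 of bool | FinG2 of bool.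

Definition fin_edge (F : fin_type) (i j : nat) : bool :=
  match F with
  | FinD n => ((j == i.+1) && (j < n)) || ((i.+2 == n) && (j == n))
  | FinE6 => ((j == i.+1) && (j < 6)) || ((i == 3) && (j == 6))
  | FinE7 => ((j == i.+1) && (j < 7)) || ((i == 3) && (j == 7))
  | FinE8 => ((j == i.+1) && (j < 8)) || ((i == 5) && (j == 8))
  | _ => j == i.+1
  end%N.

(** Square lengths of the simple roots, short roots having length 1. *)
Definition fin_len (F : fin_type) (i : nat) : nat :=
  match F with
  | FinB n => if (i < n)%N then 2 else 1
  | FinC n => if (i < n)%N then 1 else 2
  | FinF4 b => if (i <= 2)%N == b then 2 else 1
  | FinG2 b => if (i <= 1)%N == b then 3 else 1
  | _ => 1
  end%N.

Definition fin_long (F : fin_type) : nat :=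
  match F with
  | FinB _ | FinC _ | FinF4 _ => 2
  | FinG2 _ => 3
  | _ => 1
  end%N.

(** The entry in row [a] and column [b] is 2(alpha_a|alpha_b)/(alpha_a|alpha_a),
    that is <h_a, alpha_b>. *)
Definition cartan (F : fin_type) (n : nat) : 'M[int]_n :=
  \matrix_(a, b)
    if a == b then 2
    else if fin_edge F a.+1 b.+1 || fin_edge F b.+1 a.+1
    then - (maxn 1 (fin_len F b.+1 %/ fin_len F a.+1))%:Z
    else 0.

Inductive affine_type : Type :=
| AffA1 of nat      (* A^(1)_n,      n >= 1 *)
| AffB1 of nat      (* B^(1)_n,      n >= 3 *)
| AffC1 of nat      (* C^(1)_n,      n >= 2 *)
| AffD1 of nat      (* D^(1)_n,      n >= 4 *)
| AffE61 | AffE71 | AffE81 | AffF41 | AffG21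
| AffA2even of nat  (* A^(2)_{2n},   n >= 1 *)
| AffA2odd of nat   (* A^(2)_{2n-1}, n >= 2 *)
| AffD2 of nat      (* D^(2)_{n+1},  n >= 2 *)
| AffE62 | AffD43.

Definition affine_wf (X : affine_type) : bool :=
  match X with
  | AffA1 n | AffA2even n => 1 <= n
  | AffB1 n => 3 <= n
  | AffC1 n | AffA2odd n | AffD2 n => 2 <= n
  | AffD1 n => 4 <= n
  | _ => true
  end%N.

Definition rank (X : affine_type) : nat :=
  match X with
  | AffA1 n | AffB1 n | AffC1 n | AffD1 n
  | AffA2even n | AffA2odd n | AffD2 n => n
  | AffE61 => 6
  | AffE71 => 7
  | AffE81 => 8
  | AffF41 | AffE62 => 4
  | AffG21 | AffD43 => 2
  end.

(** The superscript r. *)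
Definition twist (X : affine_type) : nat :=
  match X with
  | AffA2even _ | AffA2odd _ | AffD2 _ | AffE62 => 2
  | AffD43 => 3
  | _ => 1
  end.

(** The subalgebra obtained by deleting node 0. *)
Definition circ_type (X : affine_type) : fin_type :=
  match X with
  | AffA1 n => FinA n
  | AffB1 n => FinB n
  | AffC1 n => FinC n
  | AffD1 n => FinD n
  | AffE61 => FinE6
  | AffE71 => FinE7
  | AffE81 => FinE8
  | AffF41 => FinF4 true
  | AffG21 => FinG2 true
  | AffA2even n => FinC n
  | AffA2odd n => FinC n
  | AffD2 n => FinB n
  | AffE62 => FinF4 false
  | AffD43 => FinG2 false
  end.

(** The type of g_{\bar 0}. *)
Definition zero_type (X : affine_type) : fin_type :=
  if X is AffA2even n then FinB n else circ_type X.

Definition circ_cartan (X : affine_type) : 'M[int]_(rank X) :=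
  cartan (circ_type X) (rank X).

Definition zero_cartan (X : affine_type) : 'M[int]_(rank X) :=
  cartan (zero_type X) (rank X).

Definition tnode (X : affine_type) (a : 'I_(rank X)) : nat :=
  match X with
  | AffB1 n => if a.+1 == n then 2 else 1
  | AffC1 n => if a.+1 < n then 2 else 1
  | AffF41 => if 3 <= a.+1 then 2 else 1
  | AffG21 => if a.+1 == 2 then 3 else 1
  | _ => 1
  end%N.

Definition tvee (X : affine_type) (a : 'I_(rank X)) : nat :=
  match X with
  | AffA2even _ => 2
  | AffA2odd n => if a.+1 == n then 2 else 1
  | AffD2 n => if a.+1 < n then 2 else 1
  | AffE62 => if 3 <= a.+1 then 2 else 1
  | AffD43 => if a.+1 == 2 then 3 else 1
  | _ => 1
  end%N.

Definition eps (X : affine_type) (a : 'I_(rank X)) : nat :=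
  if X is AffA2even n then (if a.+1 == n then 2 else 1)%N else 1%N.

(** (~alpha_a | ~alpha_a), with long roots of square length 2r.  The unique
    root of B_1 counts as short, which gives 2 for A^(2)_2. *)
Definition sqlen (X : affine_type) (a : 'I_(rank X)) : rat :=
  (2 * twist X * fin_len (zero_type X) a.+1)%:R / (fin_long (zero_type X))%:R.

(** (~alpha_a | ~alpha_b) *)
Definition root_form (X : affine_type) (a b : 'I_(rank X)) : rat :=
  sqlen a * (zero_cartan X a b)%:~R / 2.

(** * Weights

    A weight is the row vector of its coordinates in the basis of fundamental
    weights. *)

Definition dominant (n : nat) : set 'rV[int]_n :=
  [set lam | forall a, 0 <= lam 0 a].

Definition fund_weight (n : nat) (a : 'I_n) : 'rV[int]_n := delta_mx 0 a.

Definition simple_root (n : nat) (A : 'M[int]_n) (b : 'I_n) : 'rV[int]_n :=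
  \row_a A a b.

(** [below X mu] is the set of weights in mu - \sum_b Z_{>=0} alpha_b/eps_b. *)
Definition below (X : affine_type) (mu : 'rV[int]_(rank X)) :
    set 'rV[int]_(rank X) :=
  [set lam | exists k : 'I_(rank X) -> nat, forall c,
     (lam 0 c)%:~R = (mu 0 c)%:~R
       - \sum_b (k b)%:R * (simple_root (circ_cartan X) b 0 c)%:~R
                 / (eps b)%:R :> rat].

(** e^mu at the point with coordinates x_a = e^{Lambda_a}. *)
Definition wexp (C : fieldType) (n : nat) (x : 'I_n -> C) (mu : 'rV[int]_n) : C :=
  \prod_a x a ^ mu 0 a.

(** * Modules over the semisimple Lie algebra with Cartan matrix A

    The Lie algebra is given by its Chevalley-Serre presentation, so that a
    finite-dimensional module is a vector space with operators e_a, f_a, h_a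
    satisfying the relations of the presentation. *)

Definition lie_bracket (C : fieldType) (V : vectType C) (u v : 'End(V)) : 'End(V) :=
  (u \o v)%VF - (v \o u)%VF.

Record chevalley_module (C : fieldType) (n : nat) (A : 'M[int]_n) := ChevalleyModule {
  mod_space :> vectType C;
  mod_e : 'I_n -> 'End(mod_space);
  mod_f : 'I_n -> 'End(mod_space);
  mod_h : 'I_n -> 'End(mod_space);
  mod_hh : forall a b, lie_bracket (mod_h a) (mod_h b) = 0;
  mod_ef : forall a b,
    lie_bracket (mod_e a) (mod_f b) = if a == b then mod_h a else 0;
  mod_he : forall a b,
    lie_bracket (mod_h a) (mod_e b) = (A a b)%:~R *: mod_e b;
  mod_hf : forall a b,
    lie_bracket (mod_h a) (mod_f b) = - ((A a b)%:~R *: mod_f b);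
  mod_serre_e : forall a b, a != b ->
    iter `|1 - A a b|%N (lie_bracket (mod_e a)) (mod_e b) = 0;
  mod_serre_f : forall a b, a != b ->
    iter `|1 - A a b|%N (lie_bracket (mod_f a)) (mod_f b) = 0
}.

Definition mod_irreducible (C : fieldType) (n : nat) (A : 'M[int]_n)
    (V : chevalley_module C A) : Prop :=
  (fullv : {vspace V}) != 0%VS /\
  forall U : {vspace V},
    (forall a, (mod_e V a @: U <= U)%VS /\ (mod_f V a @: U <= U)%VS
               /\ (mod_h V a @: U <= U)%VS) ->
    U = 0%VS \/ U = fullv.

Definition has_highest_weight (C : fieldType) (n : nat) (A : 'M[int]_n)
    (V : chevalley_module C A) (lam : 'rV[int]_n) : Prop :=
  exists2 v : V, v != 0 &
    forall a, mod_e V a v = 0 /\ mod_h V a v = (lam 0 a)%:~R *: v.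

Definition weight_space (C : fieldType) (n : nat) (A : 'M[int]_n)
    (V : chevalley_module C A) (mu : 'rV[int]_n) : {vspace V} :=
  (\bigcap_a lker (mod_h V a - (mu 0 a)%:~R *: \1%VF))%VS.

(** The character of V, as a function of x. *)
Definition character (C : fieldType) (n : nat) (A : 'M[int]_n)
    (V : chevalley_module C A) (x : 'I_n -> C) : C :=
  \sum_(mu \in [set: 'rV[int]_n]) (\dim (weight_space V mu))%:R * wexp x mu.

(** * The Q-system *)

Definition Bmat (X : affine_type) (a : 'I_(rank X)) (j : nat)
    (b : 'I_(rank X)) (k : nat) : int :=
  2 * (minn (tnode b * j) (tnode a * k))%:Z
  - (minn (tnode b * j) (tnode a * k.+1))%:Z
  - (minn (tnode b * j) (tnode a * k.-1))%:Z.

(** Total exponent of Q^(b)_k in the second term on the right-hand side of the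
    Q-system, the prefactor (Q^(a)_j)^2 being included.  The rational number is
    always a non-negative integer, so that [Num.truncn] only changes its type;
    the prefactor cancels the only negative powers. *)
Definition Qexponent (X : affine_type) (a : 'I_(rank X)) (j : nat)
    (b : 'I_(rank X)) (k : nat) : nat :=
  Num.truncn ((if (a == b) && (j == k) then 2 else 0)
              - root_form a b * (Bmat a j b k)%:~R / (tvee b)%:R : rat).

Definition pos_nat : set nat := [set k | (0 < k)%N].

(** * The quantity M~_infinity

    Finitely supported families indexed by a and i; only the entries with
    i >= 1 are meaningful. *)

Definition mult_family (n : nat) : Type := {fsfun 'I_n * nat -> nat with 0%N}.

(** \sum_{a, i} i nu^(a)_i Lambda_a *)
Definition total_weight (n : nat) (nu : mult_family n) : 'rV[int]_n :=
  \sum_a \sum_(i \in pos_nat) (fund_weight a *+ (i * nu (a, i))).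

(** The constraint is an equality in the weight lattice of g_{\bar 0}, written
    in coordinates with respect to the ~Lambda_b. *)
Definition admissible (X : affine_type) (nu : mult_family (rank X))
    (lam : 'rV[int]_(rank X)) : set (mult_family (rank X)) :=
  [set m : mult_family (rank X) | (forall a, m (a, 0%N) = 0%N) /\
    forall b,
      \sum_a \sum_(i \in pos_nat)
         simple_root (zero_cartan X) a 0 b *+ (i * m (a, i))
      = (total_weight nu - lam) 0 b *+ eps b].

Definition charge (X : affine_type) (nu m : mult_family (rank X)) : rat :=
  1 / 2 * (\sum_a \sum_b \sum_(j \in pos_nat) \sum_(k \in pos_nat)
     root_form a b * (minn (tnode b * j) (tnode a * k) * m (a, j) * m (b, k))%:R)
  - \sum_a (tvee a)%:R * (\sum_(j \in pos_nat) \sum_(k \in pos_nat)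
     ((minn j k * nu (a, j) * m (a, k))%:R : rat)).

Definition vacancy (X : affine_type) (nu m : mult_family (rank X))
    (a : 'I_(rank X)) (i : nat) : rat :=
  \sum_(j \in pos_nat) ((nu (a, j) * minn i j)%:R : rat)
  - (tvee a)%:R^-1 * (\sum_b \sum_(k \in pos_nat)
     root_form a b * (minn (tnode b * i) (tnode a * k) * m (b, k))%:R).

(** The q-binomial coefficient [p+m, m]_q, for q = 1 or q not a root of unity. *)
Definition qbinomial (C : fieldType) (p : int) (m : nat) (q : C) : C :=
  if q == 1 then (\prod_(1 <= i < m.+1) (p + i%:Z)%:~R) / (m`!)%:R
  else \prod_(1 <= i < m.+1) ((1 - q ^ (p + i%:Z)) / (1 - q ^+ i)).

(** [charge] and [vacancy] take integer values; [Num.floor] only changes their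
    type. *)
Definition Mtilde (C : fieldType) (X : affine_type) (nu : mult_family (rank X))
    (lam : 'rV[int]_(rank X)) (q : C) : C :=
  \sum_(m \in admissible nu lam)
    q ^ Num.floor (charge nu m) *
    \prod_a \big[*%R/1]_(i \in pos_nat)
      qbinomial (Num.floor (vacancy nu m a i)) (m (a, i)) (q ^+ tvee a).

(* Main.v *)
(** Divided by its leading exponential, a combination of characters becomes a
    polynomial in the [e^(- alpha_b / eps_b)], hence a formal power series.
    Moving a point to infinity in the domain of (C), the Q-system controls the
    ratios of consecutive [Q^(a)_j] so well that the series [c^(a)_j] of
    [Q^(a)_j] agrees with the next one up to degree [j].  For such a stable
    solution Pascal's rule shows that the generating series of the products of
    binomials is [F prod (c^(a)_j)^(nu^(a)_j)] with [F] independent of [nu].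
    Choosing vacancies that make all but one term vanish determines the residues
    of [F], and these are the residues of the Jacobian of the [Q^(a)_1] with
    respect to the [Lambda_a]; so [F] is this Jacobian.

    The Jacobian of Weyl-invariant functions is antisymmetric, with leading term
    [e^rho], so it is the Weyl denominator; Freudenthal's formula then gives that
    the denominator times [ch V(lam)] has the coefficient 1 at [lam + rho] and 0
    at the other regular dominant weights.  The difference of the two sides of
    the theorem, multiplied by the denominator, is therefore antisymmetric and
    vanishes at all regular dominant weights, so it is zero. *)

Require Import Defs.
From HB Require Import structures.
From mathcomp Require Import all_boot all_order all_algebra finmap.
From mathcomp Require Import all_classical all_reals all_analysis.
From mathcomp Require Import perm complex ring lra zify.

Set Implicit Arguments.
Unset Strict Implicit.
Unset Printing Implicit Defensive.
Import Order.TTheory GRing.Theory Num.Theory.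
Import numFieldNormedType.Exports.
Local Open Scope classical_set_scope.
Local Open Scope ring_scope.

(** * Formal power series in several variables *)

(** Neither the Weyl group nor an abstract root system is constructed. Only simple reflections
    occur, and arguments over the group become arguments about a weight of maximal height. The roots
    are read off, with multiplicity, from the operators of one module at a time. The denominator
    therefore depends a priori on the module; uniqueness of antisymmetric series identifies it with
    the Jacobian, which is the same for all modules.

    Hypothesis (C) is a pointwise limit, whereas stability concerns coefficients. At the points xi_a
    N^(ht Lambda_a) each normalized [Q a j] is a polynomial in 1/N, so an estimate in powers of 1/N
    kills its low coefficients for every xi.

    The Q^(a)_j are infinite in number. Keeping only the levels j <= L costs nothing below degree L
    + 1, so a finite Lagrange inversion is applied modulo that degree, and L is chosen after the
    coefficient under study.

    Freudenthal's recursion is used as an identity of series, in which a shift by a root is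
    multiplication by a monomial. Multiplied by the denominator, it says that the numerator is an
    eigenvector of the Laplacian. *)

Notation mindex n := {ffun 'I_n -> nat}.

Lemma mindexD (I : finType) (k l : {ffun I -> nat}) i : (k + l) i = (k i + l i)%N.
Proof. by rewrite ffunE. Qed.

Lemma mindex0 (I : finType) i : (0 : {ffun I -> nat}) i = 0%N.
Proof. by rewrite ffunE. Qed.

Lemma mindex_sum (I J : finType) (F : J -> {ffun I -> nat}) i :
  (\sum_j F j) i = (\sum_j F j i)%N.
Proof. by rewrite sum_ffunE. Qed.

Lemma mindexMn (I : finType) (k : {ffun I -> nat}) m i : (k *+ m) i = (k i * m)%N.
Proof.
by elim: m => [|m IH]; rewrite ?mulr0n ?mindex0 ?muln0 // mulrS mindexD IH mulnS.
Qed.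

Definition mindex_box (I : finType) d : seq {ffun I -> nat} :=
  [seq [ffun i => val ((l : {ffun I -> 'I_d.+1}) i)] | l <- enum {ffun I -> 'I_d.+1}].

Lemma mem_mindex_box (I : finType) d (k : {ffun I -> nat}) :
  (k \in mindex_box I d) = [forall i, k i <= d]%N.
Proof.
apply/mapP/forallP => [[l _ ->] i|h]; first by rewrite ffunE -ltnS ltn_ord.
exists [ffun i => inord (k i)]; first by rewrite mem_enum.
by apply/ffunP => i; rewrite !ffunE /= inordK // ltnS h.
Qed.

Lemma mindex_box_uniq (I : finType) d : uniq (mindex_box I d).
Proof.
rewrite map_inj_uniq ?enum_uniq // => k l /ffunP h; apply/ffunP => i.
by apply: val_inj; have := h i; rewrite !ffunE.
Qed.

Lemma mindex_addI (I : finType) (k : {ffun I -> nat}) : injective (+%R k).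
Proof.
move=> l m /ffunP h; apply/ffunP => i; have := h i.
by rewrite !mindexD => /addnI.
Qed.

(** The weights [M] will be the values on the alpha_b / eps_b of a height that is integral on the
    whole weight lattice; such a height cannot in general take the value 1 on all of them. *)
Definition wdeg n (M : 'I_n -> nat) (k : mindex n) : nat := (\sum_i M i * k i)%N.
Notation mdeg := (wdeg (fun=> 1%N)).

Lemma wdegD n M (k l : mindex n) : wdeg M (k + l) = (wdeg M k + wdeg M l)%N.
Proof. by rewrite -big_split; apply: eq_bigr => i _; rewrite mindexD mulnDr. Qed.

Lemma wdeg0 n M : wdeg M (0 : mindex n) = 0%N.
Proof. by rewrite /wdeg big1 // => i _; rewrite mindex0 muln0. Qed.

Lemma leq_wdeg n M (k : mindex n) i : (0 < M i)%N -> (k i <= wdeg M k)%N.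
Proof.
by move=> h; rewrite /wdeg (bigD1 i) //= (leq_trans _ (leq_addr _ _)) // leq_pmull.
Qed.

Lemma wdeg_eq0 n M (k : mindex n) : (forall i, 0 < M i)%N -> wdeg M k = 0%N -> k = 0.
Proof.
move=> h k0; apply/ffunP => i; rewrite mindex0; apply/eqP.
by rewrite -leqn0 -k0 leq_wdeg.
Qed.

Lemma mem_box_wdeg n M (k : mindex n) d :
  (forall i, 0 < M i)%N -> (wdeg M k <= d)%N -> k \in mindex_box 'I_n d.
Proof.
move=> hM h; rewrite mem_mindex_box; apply/forallP => i.
exact: leq_trans (leq_wdeg _ (hM i)) h.
Qed.

Definition splits n (k : mindex n) : seq (mindex n * mindex n) :=
  [seq p <- [seq (l, r) | l <- mindex_box 'I_n (mdeg k), r <- mindex_box 'I_n (mdeg k)]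
     | p.1 + p.2 == k].

Lemma mem_splits n (k : mindex n) p : (p \in splits k) = (p.1 + p.2 == k).
Proof.
rewrite mem_filter andb_idr // => /eqP <-; case: p => l r /=.
rewrite allpairs_f //; apply: (@mem_box_wdeg _ (fun=> 1%N)) => //; rewrite wdegD.
  exact: leq_addr.
exact: leq_addl.
Qed.

Lemma splits_uniq n (k : mindex n) : uniq (splits k).
Proof.
apply: filter_uniq; apply: allpairs_uniq; rewrite ?mindex_box_uniq //.
by case=> [? ?] [? ?].
Qed.

Definition pseries (n : nat) (K : fieldType) : Type := mindex n -> K.

Section PowerSeries.
Variables (n : nat) (K : fieldType).
Local Notation S := (pseries n K).
Implicit Types (f g h : S) (k l : mindex n).

HB.instance Definition _ := gen_eqMixin S.
HB.instance Definition _ := gen_choiceMixin S.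

Let ps0 : S := fun=> 0.
Let psD f g : S := fun k => f k + g k.
Let psN f : S := fun k => - f k.

Fact psDA : associative psD.
Proof. by move=> f g h; apply/funext => k; rewrite /psD addrA. Qed.
Fact psDC : commutative psD.
Proof. by move=> f g; apply/funext => k; rewrite /psD addrC. Qed.
Fact ps0D : left_id ps0 psD.
Proof. by move=> f; apply/funext => k; rewrite /psD add0r. Qed.
Fact psND : left_inverse ps0 psN psD.
Proof. by move=> f; apply/funext => k; rewrite /psD addNr. Qed.

HB.instance Definition _ := GRing.isZmodule.Build S psDA psDC ps0D psND.

Definition ps_mul f g : S := fun k => \sum_(p <- splits k) f p.1 * g p.2.
Definition ps_one : S := fun k => (k == 0)%:R.

Fact ps_mulC : commutative ps_mul.
Proof.
move=> f g; apply/funext => k; rewrite /ps_mul.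
rewrite [RHS](perm_big [seq (p.2, p.1) | p <- splits k]) /=; last first.
  apply: uniq_perm; rewrite ?splits_uniq //.
    by rewrite map_inj_uniq ?splits_uniq // => -[? ?] [? ?] [-> ->].
  move=> [l r]; rewrite mem_splits /=; apply/eqP/mapP => [e|[[l' r']]].
    by exists (r, l); rewrite ?mem_splits //= addrC e.
  by rewrite mem_splits /= => /eqP <- [-> ->]; rewrite addrC.
by rewrite big_map; apply: eq_bigr => p _; rewrite mulrC.
Qed.

Fact ps_mulA : associative ps_mul.
Proof.
move=> f g h; apply/funext => k; rewrite /ps_mul.
pose Tl := [seq (p.1, (q.1, q.2)) | p <- splits k, q <- splits p.2].
pose Tr := [seq (q.1, (q.2, p.2)) | p <- splits k, q <- splits p.1].
transitivity (\sum_(t <- Tl) f t.1 * (g t.2.1 * h t.2.2)).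
  rewrite big_allpairs_dep; apply: eq_bigr => p _.
  by rewrite mulr_sumr; apply: eq_bigr.
transitivity (\sum_(t <- Tr) f t.1 * (g t.2.1 * h t.2.2)); last first.
  rewrite big_allpairs_dep; apply: eq_bigr => p _.
  by rewrite mulr_suml; apply: eq_bigr => q _; rewrite mulrA.
apply: perm_big; apply: uniq_perm.
- apply: allpairs_uniq_dep => [|p _|]; rewrite ?splits_uniq //.
  move=> x y /allpairsPdep[[p1 p2] [[q1 q2] [_ hq ->]]].
  move=> /allpairsPdep[[p1' p2'] [[q1' q2'] [_ hq' ->]]] /=.
  by move: hq hq'; rewrite !mem_splits => /eqP/= <- /eqP/= <- [-> -> ->].
- apply: allpairs_uniq_dep => [|p _|]; rewrite ?splits_uniq //.
  move=> x y /allpairsPdep[[p1 p2] [[q1 q2] [_ hq ->]]].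
  move=> /allpairsPdep[[p1' p2'] [[q1' q2'] [_ hq' ->]]] /=.
  by move: hq hq'; rewrite !mem_splits => /eqP/= <- /eqP/= <- [-> -> ->].
- move=> [a [b c]]; apply/allpairsPdep/allpairsPdep.
    move=> [[p1 p2]] [[q1 q2]] []; rewrite !mem_splits /= => /eqP <- /eqP <- [-> -> ->].
    by exists (p1 + q1, q2), (p1, q1); rewrite !mem_splits /= addrA !eqxx.
  move=> [[p1 p2]] [[q1 q2]] []; rewrite !mem_splits /= => /eqP <- /eqP <- [-> -> ->].
  by exists (q1, q2 + p2), (q2, p2); rewrite !mem_splits /= addrA !eqxx.
Qed.

Fact ps_mul1 : left_id ps_one ps_mul.
Proof.
move=> f; apply/funext => k; rewrite /ps_mul (bigD1_seq (0, k)) ?splits_uniq //=; last first.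
  by rewrite mem_splits add0r.
rewrite /ps_one eqxx mul1r big_seq_cond big1 ?addr0 // => -[l r] /=.
rewrite mem_splits /= => /andP[/eqP <-].
by case: (l =P 0) => [->|_ _]; rewrite ?mul0r // add0r eqxx.
Qed.

Fact ps_mulDl : left_distributive ps_mul +%R.
Proof.
move=> f g h; apply/funext => k; rewrite /ps_mul.
by under eq_bigr do rewrite mulrDl; rewrite big_split.
Qed.

Fact ps_one_neq0 : ps_one != 0.
Proof. by apply/eqP => /(congr1 (@^~ 0))/eqP; rewrite /ps_one eqxx oner_eq0. Qed.

HB.instance Definition _ :=
  GRing.Zmodule_isComNzRing.Build S ps_mulA ps_mulC ps_mul1 ps_mulDl ps_one_neq0.

Lemma ps0E k : (0 : S) k = 0. Proof. by []. Qed.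
Lemma psDE f g k : (f + g) k = f k + g k. Proof. by []. Qed.
Lemma psNE f k : (- f) k = - f k. Proof. by []. Qed.
Lemma ps1E k : (1 : S) k = (k == 0)%:R. Proof. by []. Qed.
Lemma psME f g k : (f * g) k = \sum_(p <- splits k) f p.1 * g p.2. Proof. by []. Qed.

Lemma ps_sumE (I : Type) (r : seq I) (P : pred I) (F : I -> S) k :
  (\sum_(i <- r | P i) F i) k = \sum_(i <- r | P i) F i k.
Proof. by elim/big_rec2: _ => // i y x _ <-. Qed.

Lemma splits0 : splits (0 : mindex n) = [:: (0, 0)].
Proof.
apply: perm_small_eq => //; apply: uniq_perm; rewrite ?splits_uniq //.
move=> [l r]; rewrite mem_splits inE; apply/eqP/eqP => [/= e|[-> ->]]; last by rewrite addr0.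
by congr pair; apply/ffunP => i; move/ffunP/(_ i): e; rewrite mindexD !mindex0 => /eqP;
  rewrite addn_eq0 => /andP[/eqP h1 /eqP h2].
Qed.

Lemma ps_mul_coef0 f g : (f * g) 0 = f 0 * g 0.
Proof. by rewrite psME splits0 big_seq1. Qed.

Lemma ps_prod_coef0 (I : Type) (r : seq I) (P : pred I) (F : I -> S) :
  (\prod_(i <- r | P i) F i) 0 = \prod_(i <- r | P i) F i 0.
Proof. by elim/big_rec2: _ => [|i y x _ <-]; rewrite ?ps1E ?eqxx // ps_mul_coef0. Qed.

Lemma ps_exp_coef0 f m : (f ^+ m) 0 = f 0 ^+ m.
Proof. by elim: m => [|m IH]; rewrite ?expr0 ?ps1E ?eqxx // !exprS ps_mul_coef0 IH. Qed.

Definition ps_const (c : K) : S := fun k => if k == 0 then c else 0.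

Lemma ps_constM c f k : (ps_const c * f) k = c * f k.
Proof.
rewrite psME (bigD1_seq (0, k)) ?splits_uniq //=; last by rewrite mem_splits add0r.
rewrite /ps_const eqxx big_seq_cond big1 ?addr0 // => -[l r] /=.
rewrite mem_splits /= => /andP[/eqP e]; rewrite -e.
by case: (l =P 0) => [->|_ _]; rewrite ?mul0r // add0r eqxx.
Qed.

Definition ps_mono (m : mindex n) : S := fun k => (k == m)%:R.

Lemma ps_monoM_add m f k : (ps_mono m * f) (m + k) = f k.
Proof.
rewrite psME (bigD1_seq (m, k)) ?splits_uniq //=; last by rewrite mem_splits.
rewrite /ps_mono eqxx mul1r big_seq_cond big1 ?addr0 // => -[l r] /=.
rewrite mem_splits /= => /andP[/eqP e].
case: (l =P m) e => [-> /mindex_addI ->|_ _ _]; rewrite ?mul0r // eqxx //.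
Qed.

Lemma ps_monoM_eq0 m f k : (forall l, m + l != k) -> (ps_mono m * f) k = 0.
Proof.
move=> h; rewrite psME big_seq big1 // => -[l r] /=; rewrite mem_splits /= => /eqP e.
by rewrite /ps_mono; case: (l =P m) e (h r) => [-> ->|_ _ _]; rewrite ?eqxx ?mul0r.
Qed.

Lemma ps_mono0 : ps_mono 0 = 1. Proof. by []. Qed.

Lemma ps_monoD l m : ps_mono (l + m) = ps_mono l * ps_mono m.
Proof.
apply/funext => k; case: (pselect (exists r, l + r = k)) => [[r <-]|h].
  by rewrite ps_monoM_add /ps_mono (inj_eq (@mindex_addI _ l)).
rewrite ps_monoM_eq0; last by move=> r; apply/eqP => e; apply: h; exists r.
by rewrite /ps_mono; case: eqP => // e; case: h; exists m.
Qed.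

(** Congruence modulo the ideal of series of weighted degree at least [d]. By [eqtr_mul0] these
    ideals multiply, so a factor without constant term gains one degree when all weights are
    positive. *)
Definition eqtr (M : 'I_n -> nat) (d : nat) f g :=
  forall k, (wdeg M k < d)%N -> f k = g k.

Section Truncation.
Variable M : 'I_n -> nat.
Local Notation "f =[ d ] g" := (eqtr M d f g) (at level 70, d at level 0).

Lemma eqtr_refl d f : f =[d] f. Proof. by []. Qed.
Lemma eqtr_sym d f g : f =[d] g -> g =[d] f. Proof. by move=> h k /h. Qed.
Lemma eqtr_trans d f g h : f =[d] g -> g =[d] h -> f =[d] h.
Proof. by move=> e1 e2 k hk; rewrite e1 ?e2. Qed.

Lemma eqtr_le d e f g : (d <= e)%N -> f =[e] g -> f =[d] g.
Proof. by move=> de h k hk; apply: h; apply: leq_trans de. Qed.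

Lemma eqtrD d f f' g g' : f =[d] f' -> g =[d] g' -> f + g =[d] f' + g'.
Proof. by move=> e1 e2 k hk; rewrite !psDE e1 ?e2. Qed.

Lemma eqtrN d f f' : f =[d] f' -> - f =[d] - f'.
Proof. by move=> e1 k hk; rewrite !psNE e1. Qed.

Lemma eqtrB d f f' g g' : f =[d] f' -> g =[d] g' -> f - g =[d] f' - g'.
Proof. by move=> e1 e2; apply/eqtrD/eqtrN. Qed.

Lemma eqtr_mul0 d e f g : f =[d] 0 -> g =[e] 0 -> f * g =[(d + e)%N] 0.
Proof.
move=> hf hg k hk; rewrite psME big_seq big1 // => -[l r] /=; rewrite mem_splits /= => /eqP e1.
move: hk; rewrite -e1 wdegD; case: (ltnP (wdeg M l) d) => [/hf -> _|h1]; first by rewrite mul0r.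
case: (ltnP (wdeg M r) e) => [/hg -> _|h2]; first by rewrite mulr0.
by rewrite ltnNge leq_add.
Qed.

Lemma eqtr_sub0 d f g : f =[d] g <-> f - g =[d] 0.
Proof.
split=> h k hk; first by rewrite psDE psNE h // subrr.
by apply/eqP; rewrite -subr_eq0; apply/eqP; apply: h.
Qed.

Lemma eqtrM d f f' g g' : f =[d] f' -> g =[d] g' -> f * g =[d] f' * g'.
Proof.
move=> /eqtr_sub0 h1 /eqtr_sub0 h2; apply/eqtr_sub0.
have -> : f * g - f' * g' = (f - f') * g + f' * (g - g') by ring.
rewrite -[0]addr0; apply: eqtrD.
  by have := @eqtr_mul0 d 0 (f - f') g h1; rewrite addn0; apply.
by have := @eqtr_mul0 0 d f' (g - g'); apply.
Qed.

Lemma eqtr_prod d (I : Type) (r : seq I) (P : pred I) (F G : I -> S) :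
  (forall i, P i -> F i =[d] G i) ->
  \prod_(i <- r | P i) F i =[d] \prod_(i <- r | P i) G i.
Proof.
move=> h; elim/big_rec2: _ => [|i x y Pi e]; first exact: eqtr_refl.
by apply: eqtrM => //; apply: h.
Qed.

Lemma eqtr_exp d f g m : f =[d] g -> f ^+ m =[d] g ^+ m.
Proof. by move=> h; elim: m => [//|m IH]; rewrite !exprS; apply: eqtrM. Qed.

Lemma eqtr_all f g : (forall d, f =[d] g) -> f = g.
Proof. by move=> h; apply/funext => k; apply: (h (wdeg M k).+1). Qed.

End Truncation.

(** The inverse is the geometric series, whose coefficient of index [k] only
    involves finitely many terms. *)
Definition ps_geom f m : S := \sum_(i < m) (1 - ps_const (f 0)^-1 * f) ^+ i.

(** The unit ring structure requires the inverse to be the identity on non-units, hence the first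
    branch. *)
Definition ps_inv f : S :=
  if f 0 == 0 then f else fun k => (f 0)^-1 * ps_geom f (mdeg k).+1 k.

Lemma ps_geom_trunc f d m : f 0 != 0 -> (d <= m)%N ->
  eqtr (fun=> 1%N) d (ps_geom f m) (ps_geom f d).
Proof.
move=> f0 dm; rewrite /ps_geom -(subnKC dm) big_split_ord /=.
rewrite -[X in eqtr _ _ _ X]addr0; apply: eqtrD => // k hk.
rewrite ps_sumE big1 ?ps0E // => i _ /=.
have g0 : eqtr (fun=> 1%N) 1 (1 - ps_const (f 0)^-1 * f) 0.
  move=> l; rewrite ltnS leqn0 => /eqP /wdeg_eq0 -> //.
  by rewrite psDE psNE ps1E eqxx ps_constM mulVf ?subrr.
have: eqtr (fun=> 1%N) (d + i) ((1 - ps_const (f 0)^-1 * f) ^+ (d + i)) 0.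
  by elim: (d + i)%N => [|e IH] //; rewrite exprS -add1n; apply: (eqtr_mul0 g0 IH).
by apply; apply: leq_trans hk (leq_addr _ _).
Qed.

Lemma ps_mulVf f : f 0 != 0 -> ps_inv f * f = 1.
Proof.
move=> f0; apply: (@eqtr_all (fun=> 1%N)) => d.
apply: (@eqtr_trans _ d _ (ps_const (f 0)^-1 * ps_geom f d * f)).
  apply: eqtrM => // k hk; rewrite ps_constM /ps_inv (negPf f0); congr (_ * _).
  by rewrite (@ps_geom_trunc f (mdeg k).+1 d).
set g := 1 - ps_const (f 0)^-1 * f.
have -> : ps_const (f 0)^-1 * ps_geom f d * f = (1 - g) * ps_geom f d.
  by rewrite /g; ring.
rewrite /ps_geom -/g -opprB mulNr -subrX1 opprB -[X in eqtr _ _ _ X]subr0.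
have g0 : eqtr (fun=> 1%N) 1 g 0.
  move=> l; rewrite ltnS leqn0 => /eqP /wdeg_eq0 -> //.
  by rewrite /g psDE psNE ps1E eqxx ps_constM mulVf ?subrr.
apply: eqtrB => //; elim: d => [//|d IH]; rewrite exprS -add1n.
exact: (eqtr_mul0 g0 IH).
Qed.

Definition ps_unit : {pred S} := [pred f : S | f 0 != 0].

Fact ps_mulVr : {in ps_unit, left_inverse 1 ps_inv *%R}.
Proof. by move=> f; apply: ps_mulVf. Qed.

Fact ps_unitP f g : g * f = 1 -> f \in ps_unit.
Proof.
move=> /(congr1 (@^~ 0)); rewrite ps_mul_coef0 ps1E eqxx inE => e.
by apply/eqP => f0; move/eqP: e; rewrite f0 mulr0 eq_sym oner_eq0.
Qed.

Fact ps_inv_out : {in [predC ps_unit], ps_inv =1 id}.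
Proof. by move=> f; rewrite !inE negbK /ps_inv => ->. Qed.

HB.instance Definition _ :=
  GRing.ComNzRing_hasMulInverse.Build S ps_mulVr ps_unitP ps_inv_out.

Lemma ps_unitE f : (f \is a GRing.unit) = (f 0 != 0). Proof. by []. Qed.

Lemma eqtrV M d f g : f \is a GRing.unit -> g \is a GRing.unit ->
  eqtr M d f g -> eqtr M d f^-1 g^-1.
Proof.
move=> uf ug h; have -> : f^-1 = g^-1 * (g * f^-1) by rewrite mulrA mulVr ?mul1r.
rewrite -[X in eqtr _ _ _ X]mulr1; apply: eqtrM => //.
by rewrite -(mulrV uf); apply: eqtrM => //; apply: eqtr_sym.
Qed.

Lemma eqtr_exprz M d f g (z : int) : f \is a GRing.unit -> g \is a GRing.unit ->
  eqtr M d f g -> eqtr M d (f ^ z) (g ^ z).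
Proof.
case: z => m uf ug h; first by rewrite -!exprnP; apply: eqtr_exp.
by rewrite !NegzE -!exprnN; apply: eqtrV; rewrite ?unitrX //; apply: eqtr_exp.
Qed.

End PowerSeries.

(** * Multivariate Lagrange inversion *)

Section GeneralizedBinomial.
Variable K : numFieldType.

(** The binomial coefficient with upper entry p + m. It vanishes exactly for -m <= p <= -1; the case
    p = -1 isolates a single term in [lagF_residue]. *)
Definition gbin (p : int) (m : nat) : K :=
  (\prod_(1 <= i < m.+1) (p + i%:Z)%:~R) / (m`!)%:R.

Lemma gbin0 p : gbin p 0 = 1.
Proof. by rewrite /gbin big_geq // fact0 divr1. Qed.

Lemma gbinN1 m : (0 < m)%N -> gbin (-1) m = 0.
Proof. by move=> m0; rewrite /gbin big_ltn // addNr !mul0r. Qed.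

Lemma gbin_pascal p m : gbin (p + 1) m.+1 = gbin p m.+1 + gbin (p + 1) m.
Proof.
rewrite /gbin [in RHS]big_ltn // !big_add1 /= [in LHS]big_nat_recr //=.
under [in LHS]eq_bigr => i _ do rewrite -addrA -intS.
under [X in _ + X / _]eq_bigr => i _ do rewrite -addrA -intS.
rewrite factS natrM invfM.
have h1 : (m.+1)%:R != 0 :> K by rewrite pnatr_eq0.
have h2 : (m`!)%:R != 0 :> K by rewrite pnatr_eq0 -lt0n fact_gt0.
rewrite !rmorphD /= -!pmulrn -!natr1 in h1 *; field.
by rewrite h1 h2.
Qed.

End GeneralizedBinomial.

Section Lagrange.
Variables (n : nat) (K : numFieldType) (I : finType).
Variables (e : I -> mindex n) (C : I -> I -> int).
Hypothesis e_neq0 : forall i, e i != 0.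
Local Notation S := (pseries n K).
Local Notation fam := {ffun I -> nat}.
Local Notation vac := {ffun I -> int}.

Definition fam_deg (m : fam) : mindex n := \sum_i e i *+ m i.

Definition fams (k : mindex n) : seq fam :=
  [seq m <- mindex_box I (mdeg k) | fam_deg m == k].

Lemma fam_degD m m' : fam_deg (m + m') = fam_deg m + fam_deg m'.
Proof. by rewrite -big_split; apply: eq_bigr => i _; rewrite mindexD mulrnDr. Qed.

Definition fam1 i : fam := [ffun l => (l == i : nat)].

Lemma fam_deg1 i : fam_deg (fam1 i) = e i.
Proof.
rewrite /fam_deg (bigD1 i) //= ffunE eqxx mulr1n big1 ?addr0 // => l /negPf li.
by rewrite ffunE li mulr0n.
Qed.

Lemma mem_fams k m : (m \in fams k) = (fam_deg m == k).
Proof.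
rewrite mem_filter andb_idr // => /eqP <-; rewrite mem_mindex_box.
apply/forallP => i; have [b eb] : exists b, e i b != 0%N.
  apply: contrapT => h; have /eqP[] := e_neq0 i; apply/ffunP => b.
  by rewrite mindex0; apply/eqP; apply: contrapT => /negP ?; apply: h; exists b.
apply: leq_trans (@leq_wdeg _ (fun=> 1%N) _ b _) => //.
rewrite mindex_sum (bigD1 i) //= mindexMn; apply: leq_trans (leq_addr _ _).
by rewrite leq_pmull // lt0n.
Qed.

Lemma fams_uniq k : uniq (fams k).
Proof. by rewrite filter_uniq ?mindex_box_uniq. Qed.

(** The vacancy numbers: [p] carries the contribution of nu, the sum that of the family [m]. *)
Definition vac_shift (p : vac) (m : fam) : vac :=
  [ffun l => p l - \sum_i C i l *+ m i].

Definition lag_weight (p : vac) (m : fam) : K := \prod_l gbin K (vac_shift p m l) (m l).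

Definition lagF (p : vac) : S := fun k => \sum_(m <- fams k) lag_weight p m.

Definition vac1 i : vac := [ffun l => (l == i)%:Z].
Definition vacC i : vac := [ffun l => C i l].

Lemma vac_shiftD p i m : vac_shift p (m + fam1 i) = vac_shift (p - vacC i) m.
Proof.
apply/ffunP => l; rewrite !ffunE.
under eq_bigr do rewrite mindexD mulrnDr.
have h : \sum_j C j l *+ fam1 i j = C i l.
  rewrite (bigD1 i) //= ffunE eqxx mulr1n big1 ?addr0 // => j /negPf ji.
  by rewrite ffunE ji.
by rewrite big_split /= h opprD addrA addrAC.
Qed.

Lemma vac_shift_add p v m : vac_shift (p + v) m = vac_shift p m + v.
Proof. by apply/ffunP => l; rewrite !ffunE addrAC. Qed.

(** Removing one member of kind [i] from the family shifts all vacancies by the row [C i]. The three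
    terms then share every factor except the one at [i], where Pascal's rule applies. *)
Lemma lag_weight_pascal p i m :
  lag_weight (p + vac1 i) (m + fam1 i) - lag_weight p (m + fam1 i)
    = lag_weight (p + vac1 i - vacC i) m.
Proof.
pose q := vac_shift (p - vacC i) m.
pose R := \prod_(l | l != i) gbin K (q l) (m l).
have v1 l : vac1 i l = (l == i)%:Z by rewrite ffunE.
have f1 l : fam1 i l = (l == i) by rewrite ffunE.
have qD l : (q + vac1 i) l = q l + (l == i)%:Z by rewrite ffunE v1.
have e1 : lag_weight (p + vac1 i) (m + fam1 i) = gbin K (q i + 1) (m i).+1 * R.
  rewrite /lag_weight (bigD1 i) //= vac_shift_add vac_shiftD -/q qD mindexD f1 eqxx addn1.
  congr (_ * _); apply: eq_bigr => l /negPf li.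
  by rewrite qD mindexD f1 li addn0 addr0.
have e2 : lag_weight p (m + fam1 i) = gbin K (q i) (m i).+1 * R.
  rewrite /lag_weight (bigD1 i) //= vac_shiftD -/q mindexD f1 eqxx addn1.
  congr (_ * _); apply: eq_bigr => l /negPf li.
  by rewrite mindexD f1 li addn0.
have e3 : lag_weight (p + vac1 i - vacC i) m = gbin K (q i + 1) (m i) * R.
  rewrite /lag_weight (bigD1 i) //= addrAC vac_shift_add -/q qD eqxx.
  congr (_ * _); apply: eq_bigr => l /negPf li.
  by rewrite qD li addr0.
by rewrite e1 e2 e3 gbin_pascal mulrDl addrC addKr.
Qed.

Lemma lag_weight_pascal0 p i (m : fam) : m i = 0%N -> lag_weight (p + vac1 i) m = lag_weight p m.
Proof.
move=> mi; apply: eq_bigr => l _; rewrite vac_shift_add.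
have -> : (vac_shift p m + vac1 i) l = vac_shift p m l + (l == i)%:Z.
  by rewrite ffunE [vac1 _ _]ffunE.
by case: (l =P i) => [->|_]; rewrite ?addr0 // mi !gbin0.
Qed.

(** Families with m i = 0 cancel, because their factor at [i] is 1 for every vacancy. All others are
    uniquely of the form m' + [fam1 i], which shifts the degree by [e i]. *)
Lemma lagF_pascal p i :
  lagF (p + vac1 i) - lagF p = ps_mono K (e i) * lagF (p + vac1 i - vacC i).
Proof.
apply/funext => k; rewrite psDE psNE /lagF -sumrB (bigID (fun m : fam => m i == 0%N)) /=.
rewrite big1 ?add0r => [|m /eqP mi]; last by rewrite lag_weight_pascal0 // subrr.
have dec (m : fam) : m i != 0%N -> exists m', m = m' + fam1 i.
  move=> mi; exists [ffun l => (m l - (l == i))%N]; apply/ffunP => l.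
  by rewrite mindexD !ffunE; case: eqP => [->|_]; rewrite ?subn0 ?addn0 // subnK // lt0n.
case: (pselect (exists k', e i + k' = k)) => [[k' <-]|h]; last first.
  rewrite ps_monoM_eq0 => [|l]; last by apply/eqP => el; apply: h; exists l.
  rewrite big_seq_cond big1 // => m; rewrite mem_fams => /andP[/eqP mk /dec[m' em]].
  by case: h; exists (fam_deg m'); rewrite -mk em fam_degD fam_deg1 addrC.
rewrite ps_monoM_add -big_filter.
rewrite (perm_big [seq m + fam1 i | m <- fams k']).
  by rewrite big_map; apply: eq_bigr => m _; apply: lag_weight_pascal.
apply: uniq_perm; first by rewrite filter_uniq ?fams_uniq.
  by rewrite map_inj_uniq ?fams_uniq // => m1 m2; rewrite ![_ + fam1 i]addrC => /mindex_addI.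
move=> m1; rewrite mem_filter mem_fams; apply/andP/mapP => [[/dec[m' ->]]|[m' + ->]].
  rewrite fam_degD fam_deg1 addrC => /eqP/mindex_addI/eqP h.
  by exists m'; rewrite ?mem_fams.
rewrite mem_fams => /eqP <-; rewrite fam_degD fam_deg1 [e i + _]addrC eqxx; split=> //.
by rewrite mindexD ffunE eqxx addn1.
Qed.

(** Induction on the sum of the absolute values; the equivalence allows each step to move one
    coordinate towards 0. *)
Lemma vac_ind (P : vac -> Prop) :
  P 0 -> (forall p i, P p <-> P (p + vac1 i)) -> forall p, P p.
Proof.
move=> P0 PS p; have [s hs] : exists s, (\sum_i `|p i| <= s)%N by exists (\sum_i `|p i|)%N.
elim: s p hs => [|s IH] p hs.
  suff -> : p = 0 by [].
  apply/ffunP => i; rewrite ffunE; apply/eqP; rewrite -absz_eq0 -leqn0.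
  by apply: leq_trans hs; rewrite (bigD1 i) //= leq_addr.
case: (pselect (p = 0)) => [->//|p0].
have [i pi] : exists i, p i != 0.
  apply: contrapT => h; apply: p0; apply/ffunP => i; rewrite ffunE; apply/eqP.
  by apply: contrapT => /negP ?; apply: h; exists i.
have key (q : vac) : (`|q i| < `|p i|)%N -> (forall l, l != i -> q l = p l) -> P q.
  move=> h1 h2; apply: IH; rewrite -ltnS; apply: leq_trans hs.
  rewrite (bigD1 i) //= [X in (_ < X)%N](bigD1 i) //= -addSn.
  by apply: leq_add => //; apply: leq_sum => l /h2 ->.
have v1 l : vac1 i l = (l == i)%:Z by rewrite ffunE.
have [hp|hp] : 0 < p i \/ p i < 0 by lia.
  rewrite -(subrK (vac1 i) p); apply: (iffLR (PS _ _)); apply: key => [|l /negPf li].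
    by rewrite ffunE ffunE v1 eqxx /=; lia.
  by rewrite ffunE ffunE v1 li subr0.
apply: (iffRL (PS p i)); apply: key => [|l /negPf li]; first by rewrite ffunE v1 eqxx /=; lia.
by rewrite ffunE v1 li addr0.
Qed.

Variables (M : 'I_n -> nat) (D : nat) (X : I -> S).
Hypothesis M_gt0 : forall b, (0 < M b)%N.
Hypothesis X1 : forall i, eqtr M 1 (X i) 1.
Hypothesis XE : forall i,
  eqtr M D (1 - (X i)^-1) (ps_mono K (e i) * \prod_l X l ^ (- C i l)).

Lemma unit_eqtr1 (f : S) : eqtr M 1 f 1 -> f \is a GRing.unit.
Proof. by move=> h; rewrite ps_unitE h ?wdeg0 // ps1E eqxx oner_eq0. Qed.

Let uX i : X i \is a GRing.unit. Proof. exact: unit_eqtr1. Qed.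

Definition monX (p : vac) : S := \prod_l X l ^ p l.

Lemma unit_monX p : monX p \is a GRing.unit.
Proof.
rewrite /monX; elim/big_rec: _ => [|i x _ ux]; first exact: unitr1.
by rewrite unitrM unitrXz ?uX.
Qed.

Lemma monXD p q : monX (p + q) = monX p * monX q.
Proof. by rewrite -big_split; apply: eq_bigr => l _; rewrite ffunE exprzDr ?uX. Qed.

Lemma monX0 : monX 0 = 1.
Proof. by rewrite /monX big1 // => l _; rewrite ffunE expr0z. Qed.

Lemma monX1 i : monX (vac1 i) = X i.
Proof.
rewrite /monX (bigD1 i) //= ffunE eqxx expr1z big1 ?mulr1 // => l /negPf li.
by rewrite ffunE li expr0z.
Qed.

Lemma monXN p : monX (- p) = (monX p)^-1.
Proof.
apply: (mulrI (unit_monX p)); rewrite mulrV ?unit_monX // -monXD subrr; exact: monX0.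
Qed.

(** The quotients G p = lagF p / X^p satisfy G(q + 1_i) - G(q) = (1 - 1/X_i) (G(q + 1_i - C_i) -
    G(q)) modulo degree [D], by [lagF_pascal] and the equation of X_i. Since 1 - 1/X_i has no
    constant term, constancy of G modulo degree d implies constancy modulo d + 1. *)
Theorem lagrange_inversion p : eqtr M D (lagF p) (lagF 0 * monX p).
Proof.
pose G p := lagF p * monX (- p).
suff h d : (d <= D)%N -> forall p, eqtr M d (G p) (G 0).
  have := eqtrM (h D (leqnn _) p) (@eqtr_refl _ _ M D (monX p)).
  by rewrite /G -mulrA -monXD addNr oppr0 monX0 !mulr1.
have GS q i : eqtr M D (G (q + vac1 i) - G q)
    ((1 - (X i)^-1) * (G (q + vac1 i - vacC i) - G q)).
  have e1 : G (q + vac1 i) - (X i)^-1 * G q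
      = ps_mono K (e i) * monX (- vacC i) * G (q + vac1 i - vacC i).
    have := congr1 ( *%R^~ (monX (- (q + vac1 i)))) (lagF_pascal q i).
    rewrite /= mulrBl -/(G _) => e2.
    have -> : (X i)^-1 * G q = lagF q * monX (- (q + vac1 i)).
      by rewrite /G opprD monXD [monX (- vac1 i)]monXN monX1; ring.
    rewrite e2 /G; set a := lagF _; rewrite opprB opprD addrA !monXD.
    by rewrite [monX (- vacC i)]monXN; move: (mulVr (unit_monX (vacC i))) => hC; ring: hC.
  have e3 : G (q + vac1 i) - G q
     = (ps_mono K (e i) * monX (- vacC i)) * G (q + vac1 i - vacC i) - (1 - (X i)^-1) * G q.
    by rewrite -e1; ring.
  rewrite e3 mulrBr; apply: eqtrB => //; apply: eqtrM => //; apply: eqtr_sym.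
  have -> : monX (- vacC i) = \prod_l X l ^ (- C i l).
    by apply: eq_bigr => l _; rewrite !ffunE.
  exact: XE.
elim: d => [//|d IH] dD.
have st q i : eqtr M d.+1 (G (q + vac1 i)) (G q).
  apply/eqtr_sub0; apply: eqtr_trans (eqtr_le dD (GS q i)) _.
  rewrite -add1n; apply: eqtr_mul0.
    have := eqtrV (uX i) (unitr1 _) (X1 i); rewrite invr1 => hX.
    by have /eqtr_sub0 := eqtr_sym hX.
  have dD' : (d <= D)%N by apply: ltnW.
  by have /eqtr_sub0 := eqtr_trans (IH dD' (q + vac1 i - vacC i)) (eqtr_sym (IH dD' q)).
elim/vac_ind => [|q i]; first exact: eqtr_refl.
split=> h; first exact: eqtr_trans (st q i) h.
exact: eqtr_trans (eqtr_sym (st q i)) h.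
Qed.

End Lagrange.

(** * Residues *)

Section Derivations.
Variables (n : nat) (K : numFieldType) (al : 'I_n -> 'rV[int]_n).
Local Notation S := (pseries n K).
Implicit Types (f g : S) (k : mindex n) (lam kap : 'rV[int]_n).

(** The series [f] together with [lam] encodes [e^lam f]; the monomial of index
    [k] has weight [lam - wt k]. *)
Definition wt k : 'rV[int]_n := \sum_b al b *+ k b.

Lemma wtD k l : wt (k + l) = wt k + wt l.
Proof. by rewrite -big_split; apply: eq_bigr => b _; rewrite mindexD mulrnDr. Qed.

Lemma wt0 : wt 0 = 0.
Proof. by rewrite /wt big1 // => b _; rewrite mindex0 mulr0n. Qed.

Lemma wt_sum (J : Type) (r : seq J) (P : pred J) (F : J -> mindex n) :
  wt (\sum_(j <- r | P j) F j) = \sum_(j <- r | P j) wt (F j).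
Proof. by elim/big_rec2: _ => [|j x y _ <-]; rewrite ?wt0 ?wtD. Qed.

(** The logarithmic derivative x_b d/dx_b of e^lam f, divided by e^lam. *)
Definition ps_der lam b f : S := fun k => ((lam - wt k) 0 b)%:~R * f k.

Lemma ps_derM lam kap b f g :
  ps_der (lam + kap) b (f * g) = ps_der lam b f * g + f * ps_der kap b g.
Proof.
apply/funext => k; rewrite psDE /ps_der !psME mulr_sumr -big_split /=.
rewrite big_seq [RHS]big_seq; apply: eq_bigr => -[l r]; rewrite mem_splits => /eqP/= <-.
have -> : lam + kap - wt (l + r) = lam - wt l + (kap - wt r) by rewrite wtD opprD addrACA.
by rewrite mxE rmorphD /=; ring.
Qed.

Lemma ps_derD lam b f g : ps_der lam b (f + g) = ps_der lam b f + ps_der lam b g.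
Proof. by apply/funext => k; rewrite psDE /ps_der mulrDr. Qed.

Lemma ps_der1 b : ps_der 0 b 1 = 0.
Proof.
apply/funext => k; rewrite /ps_der ps1E; case: eqP => [->|_]; last by rewrite mulr0.
by rewrite wt0 subr0 mxE mul0r.
Qed.

Lemma ps_der_shift lam b f : ps_der lam b f = ps_const (n := n) (lam 0 b)%:~R * f + ps_der 0 b f.
Proof.
apply/funext => k; rewrite psDE ps_constM /ps_der -mulrDl -rmorphD /=; congr (_%:~R * _).
by rewrite !mxE; ring.
Qed.

Lemma psMzE f (z : int) k : (f *~ z) k = f k *~ z.
Proof.
have hn m : (f *+ m) k = f k *+ m.
  by elim: m => [|m IH]; rewrite ?mulr0n // !mulrS psDE IH.
by case: z => m; rewrite ?NegzE ?mulrNz -!pmulrn ?psNE hn.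
Qed.

Lemma ps_der_comm b c f : ps_der 0 b (ps_der 0 c f) = ps_der 0 c (ps_der 0 b f).
Proof. by apply/funext => k; rewrite /ps_der; ring. Qed.

Lemma ps_der0M b f g : ps_der 0 b (f * g) = ps_der 0 b f * g + f * ps_der 0 b g.
Proof. by rewrite -ps_derM addr0. Qed.

Lemma ps_derV b f : f \is a GRing.unit -> ps_der 0 b f^-1 = - f^-1 ^+ 2 * ps_der 0 b f.
Proof.
move=> uf; have := ps_der0M b f f^-1; rewrite mulrV // ps_der1 => e.
have := mulVr uf => e2.
transitivity (f^-1 * (f * ps_der 0 b f^-1)); first by rewrite mulrA e2 mul1r.
have -> : f * ps_der 0 b f^-1 = - (ps_der 0 b f * f^-1) by apply/eqP; rewrite -addr_eq0 addrC -e.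
by ring.
Qed.

Lemma ps_der_exp b f m : ps_der 0 b (f ^+ m.+1) = f ^+ m * ps_der 0 b f *+ m.+1.
Proof.
elim: m => [|m IH]; first by rewrite expr1 expr0 mul1r.
by rewrite exprS ps_der0M IH -mulrnAr [in RHS]mulrS exprS; ring.
Qed.

Lemma ps_der_exprz b f (z : int) : f \is a GRing.unit ->
  ps_der 0 b (f ^ z) = f ^ (z - 1) * ps_der 0 b f *~ z.
Proof.
move=> uf; case: z => [[|m]|m].
- by rewrite expr0z ps_der1 mulr0z.
- by rewrite -exprnP ps_der_exp -pmulrn; congr (_ * _ *+ _); rewrite exprnP; congr (_ ^ _); lia.
rewrite NegzE -exprnN ps_derV ?unitrX // ps_der_exp mulrNz -pmulrn.
have -> : - m.+1%:Z - 1 = - (m.+2)%:Z by lia.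
rewrite -exprnN -!exprVn; set v := f^-1.
have e : v ^+ m.+1 ^+ 2 * f ^+ m = v ^+ m.+2.
  rewrite -exprM muln2 -addnn addSnnS exprD -mulrA [X in _ * X]mulrC.
  rewrite [X in _ * X]mulrC exprSr; transitivity (v * v ^+ m.+1 * (v * f) ^+ m).
    by rewrite exprMn !exprS; ring.
  by rewrite mulVr // expr1n mulr1 mulrC.
by rewrite -e -!mulNrn -!mulrnAl; ring.
Qed.

Definition mindex_of d (l : {ffun 'I_n -> 'I_d}) : mindex n := [ffun b => val (l b)].

Lemma ps_mono_sum (J : Type) (r : seq J) (F : J -> mindex n) :
  \prod_(j <- r) ps_mono K (F j) = ps_mono K (\sum_(j <- r) F j).
Proof. by elim/big_rec2: _ => [|j x y _ ->]; rewrite ?ps_mono0 ?ps_monoD. Qed.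

Lemma ps_const_prod (J : Type) (r : seq J) (F : J -> K) :
  \prod_(j <- r) ps_const (n := n) (F j) = ps_const (n := n) (\prod_(j <- r) F j).
Proof.
elim/big_rec2: _ => [|j x y _ ->]; first by apply/funext => k; rewrite ps1E /ps_const; case: eqP.
by apply/funext => k; rewrite ps_constM /ps_const; case: eqP; rewrite ?mulr0.
Qed.

(** Only the parts of the factors with entries at most [mdeg k] matter. Indexing by a finite type
    allows the sum to be exchanged with the sum over permutations in a determinant. *)
Lemma ps_prod_coef (J : finType) (f : J -> S) k :
  (\prod_a f a) k = \sum_(kap : {ffun J -> {ffun 'I_n -> 'I_(mdeg k).+1}})
    (\prod_a f a (mindex_of (kap a))) * (\sum_a mindex_of (kap a) == k)%:R.
Proof.
set d := mdeg k; pose B := {ffun 'I_n -> 'I_d.+1}.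
pose tr (g : S) : S :=
  \sum_(l : B) ps_const (n := n) (g (mindex_of l)) * ps_mono K (mindex_of l).
have trE g : eqtr (fun=> 1%N) d.+1 g (tr g).
  move=> l hl; rewrite /tr ps_sumE.
  have [l' el] : exists l' : B, mindex_of l' = l.
    have : l \in mindex_box 'I_n d by apply: (@mem_box_wdeg _ (fun=> 1%N)).
    by move=> /mapP[l' _ ->]; exists l'.
  rewrite (bigD1 l') //= big1 ?addr0 => [|i il].
    by rewrite ps_constM el /ps_mono eqxx mulr1.
  rewrite ps_constM /ps_mono; case: eqP => [e|_]; last by rewrite mulr0.
  case/eqP: il; apply/ffunP => b; apply: val_inj.
  by move/ffunP/(_ b): (etrans el e); rewrite !ffunE.
have -> : (\prod_a f a) k = (\prod_a tr (f a)) k.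
  by apply: (@eqtr_prod _ _ (fun=> 1%N) d.+1) => [a _|]; [exact: trE|exact: ltnSn].
rewrite /tr bigA_distr_bigA ps_sumE; apply: eq_bigr => kap _ /=.
by rewrite big_split /= ps_const_prod ps_mono_sum ps_constM /ps_mono eq_sym.
Qed.

Variable u : 'I_n -> S.
Hypothesis u1 : forall a, u a 0 = 1.
Hypothesis al_free : forall k, wt k = 0 -> k = 0.

Let uu a : u a \is a GRing.unit.
Proof. by rewrite ps_unitE u1 oner_eq0. Qed.

(** The determinant of the logarithmic derivatives of the functions e^(Lambda_a) u_a, divided by
    e^rho, the product of the e^(Lambda_a). *)
Definition jacobian : S := \det (\matrix_(a, b) ps_der (fund_weight a) b (u a)).

(** With U = e^(Lambda_a) u_a this is the row U^(z-1) dU without its exponential e^(z Lambda_a): the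
    differential of U^z / z when z is nonzero, that of log U when z = 0. *)
Definition log_row (z : int) a b : S := u a ^ (z - 1) * ps_der (fund_weight a) b (u a).

(** A row [u^(z-1) du] is a closed form on the torus: its coefficient at a
    nonzero weight is proportional to that weight. *)
Lemma log_row_coef (z : int) a : exists s : mindex n -> K, forall k b,
  log_row z a b k = ((fund_weight a *~ z - wt k) 0 b)%:~R * s k
    + ((z == 0) && (k == 0) && (a == b))%:R.
Proof.
have dL b : ps_der (fund_weight a) b (u a)
    = ps_const (n := n) (a == b)%:R * u a + ps_der 0 b (u a).
  by rewrite ps_der_shift /fund_weight mxE eqxx [b == a]eq_sym; case: (a == b).
case: (eqVneq z 0) => [->|z0].
  pose tau b := (u a)^-1 * ps_der 0 b (u a).
  have tauC b c : ps_der 0 c (tau b) = ps_der 0 b (tau c).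
    by rewrite /tau !ps_der0M !ps_derV // [ps_der 0 b (ps_der _ _ _)]ps_der_comm; ring.
  have tauk b c k : (wt k 0 c)%:~R * tau b k = (wt k 0 b)%:~R * tau c k.
    have := congr1 (fun f : S => f k) (tauC b c).
    by rewrite /ps_der !mxE !add0r !rmorphN /= !mulNr => /oppr_inj.
  have lr b k : log_row 0 a b k = ((k == 0) && (a == b))%:R + tau b k.
    rewrite /log_row sub0r -[u a ^ _]/((u a)^-1) dL mulrDr psDE; congr (_ + _).
    by rewrite mulrCA mulVr // mulr1 /ps_const; case: eqP; case: eqP.
  have tau0 b : tau b 0 = 0.
    by rewrite /tau ps_mul_coef0 /ps_der wt0 subr0 mxE mul0r mulr0.
  (* By [tauk] every nonzero coordinate of the weight yields the same factor of proportionality. *)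
  exists (fun k => if [pick c | wt k 0 c != 0] is Some c
                   then - tau c k / (wt k 0 c)%:~R else 0).
  move=> k b; rewrite lr mulr0z sub0r mxE addrC; congr (_ + _).
  case: pickP => [c hc|h].
    have c0 : (wt k 0 c)%:~R != 0 :> K by rewrite intr_eq0.
    apply: (mulfI c0); rewrite tauk rmorphN /=; field.
    by [].
  have -> : k = 0.
    by apply: al_free; apply/rowP => c; have := h c; rewrite mxE => /negbFE/eqP.
  by rewrite tau0 mulr0.
have zK : z%:~R != 0 :> K by rewrite intr_eq0.
exists (fun k => (u a ^ z) k / z%:~R) => k b; rewrite addr0.
have uz : u a ^ (z - 1) * u a = u a ^ z by rewrite -{2}[u a]expr1z -exprzDr ?uu // subrK.
have -> : log_row z a b k = (a == b)%:R * (u a ^ z) k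
    + (u a ^ (z - 1) * ps_der 0 b (u a)) k.
  by rewrite /log_row dL mulrDr psDE mulrCA uz ps_constM.
rewrite mulrA -[X in _ = X / _]/(ps_der (fund_weight a *~ z) b (u a ^ z) k).
rewrite [ps_der (_ *~ z) _ _]ps_der_shift psDE ps_constM ps_der_exprz // psMzE -mulrzl.
have -> : (fund_weight a *~ z) 0 b = z * (a == b)%:R.
  rewrite -scaler_int mxE /fund_weight mxE eqxx [b == a]eq_sym intz.
  by case: (a == b).
rewrite mulr1 rmorphM /= -[_ *~ z]mulrzl.
have -> : ((a == b)%:R : int)%:~R = (a == b)%:R :> K by case: (a == b).
by field.
Qed.

Lemma sum_fund_weight (z : 'I_n -> int) : \sum_a fund_weight a *~ z a = \row_a z a.
Proof.
apply/rowP => b; rewrite mxE summxE (bigD1 b) //= big1 ?addr0 => [|a /negPf ab].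
  by rewrite -scaler_int !mxE !eqxx mulr1 intz.
by rewrite -scaler_int !mxE eqxx eq_sym ab mulr0.
Qed.

(** Row [a] is a multiple of the weight [xi a], and these weights add up to 0, so the rows are
    dependent. The exceptions are the rows with z a = 0 and kap a = 0, which are unit vectors; if
    all rows are of this kind the matrix is the identity. *)
Lemma log_row_det (z : 'I_n -> int) (kap : 'I_n -> mindex n) :
  wt (\sum_a kap a) = \row_a z a ->
  \det (\matrix_(a, b) log_row (z a) a b (kap a)) = (\sum_a kap a == 0)%:R.
Proof.
move=> hz; pose sp a := (z a == 0) && (kap a == 0).
pose xi a := fund_weight a *~ z a - wt (kap a).
have [s hs] := choice (fun a => log_row_coef (z a) a).
case: (pselect (forall a, sp a)) => [h|/existsNP[a0 /negP ha0]].
  have -> : (\sum_a kap a == 0).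
    by rewrite big1 // => a _; have /andP[_ /eqP] := h a.
  transitivity (\det (1%:M : 'M[K]_n)); last exact: det1.
  congr (\det _); apply/matrixP => a b; have /andP[/eqP za /eqP ka] := h a.
  by rewrite !mxE hs za ka wt0 mulr0z subr0 mxE mul0r add0r !eqxx.
have -> : (\sum_a kap a == 0) = false.
  apply/negP => /eqP k0; move/negP: ha0; apply; apply/andP.
  have kap0 a : kap a = 0.
    apply/ffunP => b; move/ffunP/(_ b): k0; rewrite mindex_sum mindex0 => /eqP.
    by rewrite sum_nat_eq0 => /forallP/(_ a)/eqP.
  split; last exact/eqP.
  by move/rowP/(_ a0): hz; rewrite k0 wt0 !mxE => <-.
apply/eqP/det0P.
have [[a1 [na1 sa1]]|hne] := pselect (exists a, ~~ sp a /\ s a (kap a) = 0).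
  exists (delta_mx 0 a1); first by apply/eqP => /rowP/(_ a1)/eqP; rewrite !mxE !eqxx oner_eq0.
  by rewrite -rowE; apply/rowP => b; rewrite !mxE hs sa1 mulr0 add0r -/(sp a1) (negPf na1).
(* These coefficients turn the combination of the rows into the sum of the [xi a]; the exceptional
   rows may be left out because their [xi a] is 0. *)
pose v := \row_a (if sp a then 0 else (s a (kap a))^-1).
have sN a : ~~ sp a -> s a (kap a) != 0 by move=> na; apply/eqP => e; apply: hne; exists a.
exists v.
  apply/eqP => /rowP/(_ a0)/eqP; rewrite !mxE (negPf ha0) invr_eq0.
  by rewrite (negPf (sN _ ha0)).
have sxi : \sum_a xi a = 0.
  by rewrite sumrB -wt_sum hz sum_fund_weight subrr.
apply/rowP => b; rewrite !mxE -[RHS](_ : ((\sum_a xi a) 0 b)%:~R = 0 :> K); last first.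
  by rewrite sxi mxE.
rewrite summxE rmorph_sum /=; apply: eq_bigr => a _; rewrite !mxE hs.
case: ifPn => [/andP[/eqP za /eqP ka]|na].
  by rewrite mul0r za ka wt0 mulr0z !mxE subrr.
by rewrite -/(sp a) (negPf na) addr0 mulrCA mulVf ?sN // mulr1 !mxE.
Qed.

(** With U_a = e^(Lambda_a) u_a and z = wt k, the exponentials in the product of the U_a^(z_a - 1)
    dU_a contribute e^(wt k), so the coefficient of index [k] is a constant term. Expanding the
    determinant into homogeneous pieces, [log_row_det] evaluates each of them. *)
Lemma jacobian_residue k :
  (jacobian * \prod_a u a ^ (wt k 0 a - 1)) k = (k == 0)%:R.
Proof.
pose z a := wt k 0 a.
have -> : jacobian * \prod_a u a ^ (z a - 1) = \det (\matrix_(a, b) log_row (z a) a b).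
  rewrite /jacobian !big_distrl /=; apply: eq_bigr => s _.
  by rewrite mulrAC -mulrA; congr (_ * _); rewrite -big_split /=; apply: eq_bigr => a _;
     rewrite !mxE.
rewrite /determinant ps_sumE.
have -> : (k == 0)%:R = \sum_(kap : {ffun 'I_n -> {ffun 'I_n -> 'I_(mdeg k).+1}})
   \det (\matrix_(a, b) log_row (z a) a b (mindex_of (kap a)))
     * (\sum_a mindex_of (kap a) == k)%:R :> K.
  have sz : wt k = \row_a z a by apply/rowP => a; rewrite mxE.
  transitivity (\sum_(kap : {ffun 'I_n -> {ffun 'I_n -> 'I_(mdeg k).+1}})
     (k == 0)%:R * (\sum_a mindex_of (kap a) == k)%:R : K); last first.
    apply: eq_bigr => kap _; case: (_ =P k) => [e|_]; last by rewrite !mulr0.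
    by rewrite log_row_det e.
  case: (k =P 0) => [->|_]; last by rewrite big1 // => kap _; rewrite mul0r.
  rewrite (bigD1 [ffun _ => [ffun _ => ord0]]) //= [X in _ = _ + X]big1 => [|kap hk].
    rewrite big1 ?eqxx ?mulr1 ?addr0 // => a _.
    by apply/ffunP => b; rewrite !ffunE.
  case: (_ =P 0) => [e|_]; last by rewrite mulr0.
  case/eqP: hk; apply/ffunP => a; apply/ffunP => b; apply: val_inj; rewrite !ffunE /=.
  move/ffunP/(_ b): e; rewrite mindex_sum mindex0 => /eqP.
  by rewrite sum_nat_eq0 => /forallP/(_ a)/eqP; rewrite ffunE.
transitivity (\sum_(s : 'S_n) (-1) ^+ s * \sum_(kap : {ffun 'I_n -> {ffun 'I_n -> 'I_(mdeg k).+1}})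
   (\prod_a log_row (z a) a (s a) (mindex_of (kap a)))
     * (\sum_a mindex_of (kap a) == k)%:R).
  apply: eq_bigr => s _; rewrite -(ps_prod_coef (fun a => log_row (z a) a (s a))).
  have -> : (-1) ^+ s = ps_const (n := n) ((-1) ^+ s : K).
    case: (s : bool); rewrite ?expr1 ?expr0 //; apply/funext => l.
      by rewrite psNE ps1E /ps_const; case: eqP; rewrite ?oppr0.
    by rewrite ps1E /ps_const; case: eqP.
  rewrite ps_constM; congr (_ * _); congr ((_ : S) k).
  by apply: eq_bigr => a _; rewrite mxE.
under eq_bigr => s _ do rewrite mulr_sumr.
rewrite exchange_big /=; apply: eq_bigr => kap _.
rewrite /determinant mulr_suml; apply: eq_bigr => s _; rewrite mulrA; congr (_ * _ * _).
by apply: eq_bigr => a _; rewrite mxE.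
Qed.

(** The power product changes with [k] but always has constant term 1. Hence its product with H has
    at [k] the coefficient of H plus terms of lower degree, and the system is triangular. *)
Lemma residue_inj M d (H1 H2 : S) : (forall b, 0 < M b)%N ->
  (forall k, (wdeg M k < d)%N -> (H1 * \prod_a u a ^ (wt k 0 a - 1)) k =
             (H2 * \prod_a u a ^ (wt k 0 a - 1)) k) -> eqtr M d H1 H2.
Proof.
move=> M0 h; apply/eqtr_sub0 => k kd; rewrite ps0E.
pose U k := \prod_a u a ^ (wt k 0 a - 1).
set E := H1 - H2; have [e] := ubnP (wdeg M k); elim: e k kd => // e IH k kd ke.
have : (E * U k) k = 0 by rewrite /E mulrBl psDE psNE h // subrr.
rewrite psME (bigD1_seq (k, 0)) ?splits_uniq ?mem_splits ?addr0 //=.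
rewrite big_seq_cond big1 => [|[l r] /=]; last first.
  rewrite mem_splits /= => /andP[/eqP lrk /eqP lr].
  have lk : (wdeg M l < wdeg M k)%N.
    rewrite -lrk wdegD -addn1 leq_add2l lt0n; apply/eqP => /wdeg_eq0 r0; apply: lr.
    by rewrite -lrk; congr pair; rewrite r0 ?addr0.
  by rewrite IH ?mul0r //; [apply: ltn_trans kd|apply: leq_trans lk _].
rewrite /U addr0 ps_prod_coef0 big1 ?mulr1 // => a _.
have ex (m : nat) : (u a ^+ m) 0 = 1 by rewrite ps_exp_coef0 u1 expr1n.
case: (wt k 0 a - 1) => m; first exact: ex.
have := congr1 (fun f : S => f 0) (mulVr (unitrX m.+1 (uu a))).
by rewrite ps_mul_coef0 ex mulr1 ps1E eqxx NegzE -exprnN.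
Qed.

End Derivations.

(** * Canonical solutions of the Q-system *)

Definition lapl (f : nat -> int) (k : nat) : int := f k *+ 2 - f k.+1 - f k.-1.

(** Summation by parts in multiplicative form: the second difference passes from log c to the
    exponents [f], leaving boundary terms at N. *)
Lemma ratio_telescope (R : comUnitRingType) (c : nat -> R) (f : nat -> int) N :
  (forall k, c k \is a GRing.unit) -> c 0%N = 1 -> f 0%N = 0 ->
  \prod_(1 <= k < N.+1) (c k ^+ 2 * (c k.+1 * c k.-1)^-1) ^ f k =
  \prod_(1 <= k < N.+1) c k ^ lapl f k * (c N ^ f N.+1 * c N.+1 ^ (- f N)).
Proof.
move=> uc c0 f0; elim: N => [|N IH].
  by rewrite !big_geq // f0 c0 exp1rz oppr0 expr0z !mulr1.
rewrite [LHS]big_nat_recr //= IH [in RHS]big_nat_recr //=.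
set P := \prod_(_ <= _ < _) _.
have -> : (c N.+1 ^+ 2 * (c N.+2 * c N)^-1) ^ f N.+1
    = c N.+1 ^ (f N.+1 *+ 2) * (c N.+2 ^ (- f N.+1) * c N ^ (- f N.+1)).
  rewrite exprMz_comm ?unitrX ?unitrV ?unitrM ?uc //; last exact: mulrC.
  rewrite exprz_inv (exprMz_comm _ (uc N.+2) (uc N)); last exact: mulrC.
  by rewrite exprnP exprz_exp; congr (_ ^ _ * _); ring.
have -> : lapl f N.+1 = f N.+1 *+ 2 + (- f N.+2) + (- f N) by [].
rewrite !exprzDr ?uc //.
have h (k : nat) (z : int) : c k ^ z * c k ^ (- z) = 1.
  by rewrite -exprzDr ?uc // subrr expr0z.
have h1 := h N (f N.+1); have h2 := h N.+1 (f N.+2).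
ring: h1 h2.
Qed.

Lemma lapl_min (j k : nat) : (0 < j)%N -> (0 < k)%N ->
  lapl (fun i => (minn i j)%:Z) k = (k == j)%:Z.
Proof. by rewrite /lapl; case: k => // k; case: eqP; lia. Qed.

Lemma lapl_sum (J : Type) (r : seq J) (F : J -> nat -> int) k :
  lapl (fun i => \sum_(j <- r) F j i) k = \sum_(j <- r) lapl (F j) k.
Proof. by rewrite /lapl -sumrMnl -!sumrB. Qed.

Section QSystem.
Variables (n : nat) (K : numFieldType) (al : 'I_n -> 'rV[int]_n) (t M : 'I_n -> nat).
Hypothesis t_gt0 : forall a, (0 < t a)%N.
Hypothesis M_gt0 : forall a, (0 < M a)%N.
Hypothesis al_free : forall k, wt al k = 0 -> k = 0.
Local Notation S := (pseries n K).

(** The decrease of the vacancy number at (b, i) caused by one string of length j at node a. For the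
    affine data it equals (~alpha_b|~alpha_a) min(t_a i, t_b j) / t^vee_b. *)
Definition cmin a j b i : int :=
  ((al a ord0 b * (minn (t a * i) (t b * j))%:Z) %/ (t b)%:Z)%Z.

Hypothesis t_dvd : forall a j b i,
  ((t b)%:Z %| al a ord0 b * (minn (t a * i) (t b * j))%:Z)%Z.

Definition idelta a j : mindex n := [ffun b => if b == a then j else 0%N].

Lemma idelta_neq0 a j : (0 < j)%N -> idelta a j != 0.
Proof.
by move=> j0; apply/eqP => /ffunP/(_ a); rewrite !ffunE eqxx => /eqP; rewrite eqn0Ngt j0.
Qed.

Lemma wt_idelta a j : wt al (idelta a j) = al a *+ j.
Proof.
rewrite /wt (bigD1 a) //= ffunE eqxx big1 ?addr0 // => b /negPf ba.
by rewrite ffunE ba mulr0n.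
Qed.

Variable c : 'I_n -> nat -> S.
Hypothesis c0 : forall a, c a 0%N = 1.
Hypothesis c1 : forall a j, eqtr M 1 (c a j) 1.
Hypothesis c_stable : forall a j, eqtr M j.+1 (c a j) (c a j.+1).

Let uc a j : c a j \is a GRing.unit. Proof. exact: unit_eqtr1 (c1 a j). Qed.

(** The variables in which the Q-system becomes the system of Lagrange inversion: divided by the
    square of [c a j] it reads 1 - 1/X = (monomial) times a product of powers of the X. *)
Definition ratioX a k : S := c a k ^+ 2 * (c a k.+1 * c a k.-1)^-1.

Let uX a k : ratioX a k \is a GRing.unit.
Proof. by rewrite unitrM unitrX ?uc // unitrV unitrM !uc. Qed.

Lemma c_stable_le a j k : (j <= k)%N -> eqtr M j.+1 (c a j) (c a k).
Proof.
move=> /subnKC <-; elim: (k - j)%N => [|i IH]; first by rewrite addn0; apply: eqtr_refl.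
apply: eqtr_trans IH _; rewrite addnS.
have h : (j.+1 <= (j + i).+1)%N by rewrite ltnS leq_addr.
exact: (eqtr_le h (@c_stable a (j + i)%N)).
Qed.

Variable L : nat.
Local Notation I := ('I_n * 'I_L)%type.
Let X (i : I) : S := ratioX i.1 i.2.+1.
Let e (i : I) : mindex n := idelta i.1 i.2.+1.
Let C (i l : I) : int := cmin i.1 i.2.+1 l.1 l.2.+1.

Let e_neq0 i : e i != 0. Proof. exact: idelta_neq0. Qed.

Lemma ratioX1 a k : eqtr M 1 (ratioX a k) 1.
Proof.
have e1 : 1 = 1 ^+ 2 * (1 * 1)^-1 :> S by rewrite expr1n !mul1r invr1.
rewrite /ratioX e1; apply: eqtrM; first exact: eqtr_exp.
by apply: eqtrV; rewrite ?unitrM ?uc ?unitr1 //; apply: eqtrM.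
Qed.

Lemma ratioX_stable a k : (L < k)%N -> eqtr M L.+1 (ratioX a k) 1.
Proof.
case: k => // k; rewrite ltnS => Lk.
have h l : (L <= l)%N -> eqtr M L.+1 (c a l) (c a L).
  by move=> Ll; apply: eqtr_sym; apply: c_stable_le.
have e1 : 1 = c a L ^+ 2 * (c a L * c a L)^-1 by rewrite -expr2 mulrV ?unitrX ?uc.
rewrite /ratioX e1; apply: eqtrM; first by apply/eqtr_exp/h; rewrite leqW.
apply: eqtrV; rewrite ?unitrM ?uc //; apply: eqtrM; apply: h => //.
by rewrite !leqW.
Qed.

(** By stability the ratios above level L are 1 modulo degree L + 1, so the product may be extended
    up to N. There [f] is stationary and c_N, c_(N+1) are congruent, so the boundary terms of
    [ratio_telescope] cancel. *)
Lemma monX_telescope (f : 'I_n -> nat -> int) N :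
  (forall b, f b 0%N = 0) -> (L <= N)%N -> (forall b, f b N.+1 = f b N) ->
  eqtr M L.+1 (monX X [ffun i : I => f i.1 i.2.+1])
    (\prod_b \prod_(1 <= k < N.+1) c b k ^ lapl (f b) k).
Proof.
move=> f0 LN fN; rewrite /monX.
have -> : \prod_(l : I) X l ^ [ffun i : I => f i.1 i.2.+1] l
    = \prod_b \prod_(i < L) ratioX b i.+1 ^ f b i.+1.
  by rewrite pair_bigA /=; apply: eq_bigr => l _; rewrite ffunE.
apply: eqtr_prod => b _.
have -> : \prod_(i < L) ratioX b i.+1 ^ f b i.+1 = \prod_(1 <= k < L.+1) ratioX b k ^ f b k.
  by rewrite big_add1 /= big_mkord.
apply: (@eqtr_trans _ _ _ _ _ (\prod_(1 <= k < N.+1) ratioX b k ^ f b k)).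
  rewrite (@big_cat_nat _ _ _ L.+1 1 N.+1) //=; rewrite -[X in eqtr _ _ X _]mulr1.
  apply: eqtrM => //; apply: eqtr_sym.
  rewrite big_seq; elim/big_rec: _ => [|k x]; first exact: eqtr_refl.
  rewrite mem_index_iota => /andP[Lk _] hx; rewrite -[X in eqtr _ _ _ X]mulr1.
  apply: eqtrM => //; rewrite -[X in eqtr _ _ _ X](exp1rz _ (f b k)).
  by apply: eqtr_exprz; rewrite ?uX ?unitr1 //; apply: ratioX_stable.
rewrite (ratio_telescope N (uc b) (c0 b) (f0 b)).
rewrite -[X in eqtr _ _ _ X]mulr1; apply: eqtrM => //.
have h1 : c b N ^ f b N * c b N ^ (- f b N) = 1 by rewrite -exprzDr ?uc // subrr expr0z.
rewrite fN -[X in eqtr _ _ _ X]h1; apply: eqtrM; first exact: eqtr_refl.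
apply: eqtr_exprz; rewrite ?uc //; apply: eqtr_sym.
exact: (eqtr_le (LN : (L.+1 <= N.+1)%N) (@c_stable b N)).
Qed.

Variable E : 'I_n -> nat -> 'I_n -> nat -> nat.
Hypothesis E_def : forall a j b k, (0 < j)%N -> (0 < k)%N ->
  (E a j b k)%:Z = ((a == b) && (j == k))%:Z *+ 2 - lapl (cmin a j b) k.
Hypothesis Qsys : forall a j N, (0 < j)%N -> (forall b, t b * j < N)%N ->
  c a j ^+ 2 = c a j.+1 * c a j.-1
    + ps_mono K (idelta a j) * \prod_b \prod_(1 <= k < N.+1) c b k ^+ E a j b k.

Lemma cmin0 a j b : cmin a j b 0 = 0.
Proof. by rewrite /cmin muln0 min0n mulr0 div0z. Qed.

Lemma cminK a j b i : cmin a j b i * (t b)%:Z = al a ord0 b * (minn (t a * i) (t b * j))%:Z.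
Proof. exact: divzK. Qed.

Lemma cmin_const a j b i : (t b * j <= i)%N -> cmin a j b i.+1 = cmin a j b i.
Proof.
move=> h; rewrite /cmin; congr ((_ * _%:Z) %/ _)%Z.
by have := leq_pmull i.+1 (t_gt0 a); have := leq_pmull i (t_gt0 a); lia.
Qed.

(** After division by the square of [c a j] the exponents of the Q-system are minus the second
    differences of [cmin], which is the product supplied by [monX_telescope]. *)
Lemma ratioX_eqn i : eqtr M L.+1 (1 - (X i)^-1)
  (ps_mono K (e i) * \prod_l X l ^ (- C i l)).
Proof.
case: i => a i; rewrite /X /e /=; set j := i.+1.
(* Large enough for the functions [cmin a j b] to be constant from N on, and for the truncated
   product of the Q-system to be complete. *)
pose N := ((\max_b t b) * j + L).+1.
have hN b : (t b * j < N)%N.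
  by rewrite ltnS (leq_trans _ (leq_addr _ _)) // leq_mul2r leq_bigmax_cond ?orbT.
have -> : \prod_l X l ^ (- C (a, i) l) = monX X [ffun l : I => - cmin a j l.1 l.2.+1].
  by apply: eq_bigr => l _; rewrite ffunE.
have LN : (L <= N)%N by rewrite leqW // leq_addl.
have f0 b : - cmin a j b 0 = 0 by rewrite cmin0 oppr0.
have fN b : - cmin a j b N.+1 = - cmin a j b N by rewrite cmin_const // ltnW.
have hX := @monX_telescope (fun b k => - cmin a j b k) N f0 LN fN.
apply: (@eqtr_trans _ _ _ _ _ (ps_mono K (idelta a j) *
  \prod_b \prod_(1 <= k < N.+1) c b k ^ lapl (fun i => - cmin a j b i) k)); last first.
  by apply: eqtrM => //; apply: eqtr_sym.
have j0 : (0 < j)%N by [].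
have jN : j \in index_iota 1 N.+1.
  by rewrite mem_index_iota j0 ltnS; apply: leq_trans (ltnW (hN a)); rewrite leq_pmull.
have -> : \prod_b \prod_(1 <= k < N.+1) c b k ^ lapl (fun i => - cmin a j b i) k
    = \prod_b \prod_(1 <= k < N.+1) c b k ^+ E a j b k * (c a j ^+ 2)^-1.
  have h b k : (0 < k)%N -> c b k ^ lapl (fun i => - cmin a j b i) k
       = c b k ^+ E a j b k * (if (a == b) && (j == k) then (c a j ^+ 2)^-1 else 1).
    move=> k0; have -> : lapl (fun i => - cmin a j b i) k
        = (E a j b k)%:Z - ((a == b) && (j == k))%:Z *+ 2.
      by rewrite E_def // /lapl; ring.
    rewrite exprzDr ?uc // -exprnP; congr (_ * _).
    case: andP => [[/eqP <- /eqP <-]|_]; last by rewrite mul0rn oppr0 expr0z.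
    by rewrite -exprnN.
  under [LHS]eq_bigr => b _ do rewrite big_nat.
  under [LHS]eq_bigr => b _ do under eq_bigr => k /andP[k0 _] do rewrite h //.
  under [LHS]eq_bigr => b _ do rewrite -big_nat big_split /=.
  rewrite big_split /=; congr (_ * _); rewrite (bigD1 a) //= (bigD1_seq j jN (iota_uniq _ _)) /=.
  rewrite !eqxx /= !big1 ?mulr1 // => [b ba|k kj].
    by rewrite big1 // => k _; rewrite eq_sym (negPf ba).
  by rewrite eq_sym (negPf kj).
have := @Qsys a j N j0 hN; set P := _ * \prod_b _ => e1.
have u2 : c a j ^+ 2 \is a GRing.unit by rewrite unitrX.
have -> : (ratioX a j)^-1 = c a j.+1 * c a j.-1 * (c a j ^+ 2)^-1.
  by rewrite /ratioX invrM ?invrK ?unitrV ?unitrM ?uc //; apply: mulrC.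
have -> : 1 - c a j.+1 * c a j.-1 / c a j ^+ 2 = P / c a j ^+ 2.
  by rewrite -[X in X - _](mulrV u2) -mulrBl {1}e1 addrAC subrr add0r.
by rewrite /P -mulrA; apply: eqtr_refl.
Qed.

Lemma lagF_monX p : eqtr M L.+1 (lagF K e C p) (lagF K e C 0 * monX X p).
Proof.
apply: lagrange_inversion => // [i|i]; first exact: ratioX1.
exact: ratioX_eqn.
Qed.

(** With [p = wt k - 1] the vacancy number of a node of maximal level occupied
    by [m] equals [-1], so that the corresponding binomial coefficient vanishes. *)
Lemma lagF_residue k :
  lagF K e C [ffun l => wt al k ord0 l.1 - 1] k = (k == 0)%:R.
Proof.
have mem0 : k = 0 -> fams e k = [:: 0].
  move=> ->; apply: perm_small_eq => //; apply: uniq_perm; rewrite ?fams_uniq // => m.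
  rewrite mem_fams // inE; apply/eqP/eqP => [h|->]; last first.
    by rewrite /fam_deg big1 // => i _; rewrite mindex0 mulr0n.
  apply/ffunP => i; rewrite mindex0; have /eqP := e_neq0 i.
  have := congr1 (fun f : mindex n => f) h; case: (m i =P 0%N) => // /eqP mi _ ei.
  case: ei; apply/ffunP => b; rewrite mindex0; move/ffunP/(_ b): h.
  rewrite mindex_sum mindex0 => /eqP; rewrite sum_nat_eq0 => /forallP/(_ i)/eqP.
  by rewrite mindexMn => /eqP; rewrite muln_eq0 (negPf mi) orbF => /eqP.
rewrite /lagF; case: (k =P 0) => [k0|k0].
  rewrite mem0 // big_seq1 /lag_weight big1 // => l _.
  by rewrite mindex0 gbin0.
rewrite big_seq big1 // => m; rewrite mem_fams // => /eqP mk.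
have [i0 hi0] : exists i, m i != 0%N.
  apply: contrapT => h; apply: k0; rewrite -mk /fam_deg big1 // => i _.
  case: (m i =P 0%N) => [->|/eqP hi]; first by rewrite mulr0n.
  by case: h; exists i.
(* The level of a string of length i at node a is i / t_a; multiplication by [T] makes it an
   integer. *)
pose T := (\prod_b t b)%N; pose lev (i : I) := (i.2.+1 * (T %/ t i.1))%N.
have tT b : (t b * (T %/ t b) = T)%N.
  by rewrite mulnC divnK // /T (bigD1 b) //= dvdn_mulr.
have T0 : (0 < T)%N by rewrite prodn_gt0.
case: (@arg_maxnP _ i0 (fun i => m i != 0%N) lev hi0) => l hl hmax.
rewrite /lag_weight (bigD1 l) //=.
suff -> : vac_shift C [ffun l => wt al k ord0 l.1 - 1] m l = -1.
  by rewrite gbinN1 ?mul0r // lt0n.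
rewrite !ffunE.
suff -> : \sum_i C i l *+ m i = wt al k ord0 l.1 by ring.
rewrite -mk /fam_deg wt_sum summxE; apply: eq_bigr => i _.
have -> : wt al (e i *+ m i) = al i.1 *+ i.2.+1 *+ m i.
  by rewrite -wt_idelta; elim: (m i) => [|d IH]; rewrite ?mulr0n ?wt0 // !mulrS wtD IH.
case: (m i =P 0%N) => [->|/eqP mi]; first by rewrite !mulr0n mxE.
have h : (lev i <= lev l)%N := hmax _ mi.
(* As [l] has maximal level, the minimum in [C i l] is always the argument coming from [i]. The sum
   over the family is then a coordinate of its total weight, which is [wt al k]. *)
have le : (t l.1 * i.2.+1 <= t i.1 * l.2.+1)%N.
  have : (t i.1 * t l.1 * lev i <= t i.1 * t l.1 * lev l)%N by rewrite leq_mul2l h orbT.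
  have -> : (t i.1 * t l.1 * lev i = t l.1 * i.2.+1 * T)%N.
    by have := tT i.1; rewrite /lev; move: (T %/ _)%N => q <-; ring.
  have -> : (t i.1 * t l.1 * lev l = t i.1 * l.2.+1 * T)%N.
    by have := tT l.1; rewrite /lev; move: (T %/ _)%N => q <-; ring.
  by rewrite leq_pmul2r.
have tl : (t l.1)%:Z != 0 by rewrite -lt0n.
have -> : C i l = al i.1 ord0 l.1 *+ i.2.+1.
  apply: (mulIf tl); rewrite /C cminK (minn_idPr le) -mulr_natr natz PoszM.
  by ring.
by rewrite -!scaler_nat !mxE !mulr_natl.
Qed.

(** An exponent [f] that is constant from level 1 on has its second difference concentrated at level
    1, so X^p becomes a product of powers of the [c b 1]. The residues of [lagF 0] with respect to
    these series are thus known, and agree with those of the Jacobian. *)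
Theorem lagF0_jacobian : eqtr M L.+1 (lagF K e C 0) (jacobian al (fun a => c a 1%N)).
Proof.
have c10 a : c a 1%N 0 = 1 by rewrite (c1 a 1) ?wdeg0 // ps1E eqxx.
apply: (residue_inj (al := al) c10) => // k hk.
apply: etrans _ (esym (jacobian_residue (u := fun a => c a 1%N) c10 al_free k)).
pose f (b : 'I_n) (i : nat) : int := if i == 0%N then 0 else wt al k ord0 b - 1.
have fN b : f b L.+2 = f b L.+1 by [].
have h1 := @monX_telescope f L.+1 (fun=> erefl) (leqnSn L) fN.
rewrite -lagF_residue (lagF_monX _ hk); apply: eqtrM hk; first exact: eqtr_refl.
apply: eqtr_sym; apply: eqtr_trans h1 _.
rewrite [X in eqtr _ _ X _](_ : _ = \prod_b c b 1%N ^ (wt al k ord0 b - 1)); first exact: eqtr_refl.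
apply: eq_bigr => b _; rewrite big_ltn // [lapl _ _](_ : _ = wt al k ord0 b - 1); last first.
  by rewrite /lapl /f /=; ring.
rewrite big_nat big1 ?mulr1 // => i /andP[i1 _].
rewrite [lapl _ _](_ : _ = 0) ?expr0z // /lapl /f.
by case: i i1 => // -[|i] // _ /=; ring.
Qed.

(** The second difference of the initial vacancies sum_j min(i, j) nu_j is nu itself, so telescoping
    turns X^p into the product of the powers c^nu. *)
Theorem lagF_canonical (nu : 'I_n -> nat -> nat) :
  eqtr M L.+1
    (lagF K e C [ffun l : I => \sum_(1 <= j < L.+1) (minn l.2.+1 j * nu l.1 j)%:Z])
    (jacobian al (fun a => c a 1%N) * \prod_b \prod_(1 <= j < L.+1) c b j ^+ nu b j).
Proof.
pose f (b : 'I_n) (i : nat) : int := \sum_(1 <= j < L.+1) (minn i j * nu b j)%:Z.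
have f0 b : f b 0%N = 0 by rewrite /f big1 // => j _; rewrite min0n mul0n.
have fL b : f b L.+1 = f b L.
  rewrite /f big_nat [RHS]big_nat; apply: eq_bigr => j /andP[_ jL].
  by congr (_ * _)%:Z; lia.
have h := @monX_telescope f L f0 (leqnn L) fL.
apply: eqtr_trans (lagF_monX _) _; apply: eqtrM; first exact: lagF0_jacobian.
apply: eqtr_trans h _; rewrite [X in eqtr _ _ X _](_ : _ =
  \prod_b \prod_(1 <= j < L.+1) c b j ^+ nu b j); first exact: eqtr_refl.
apply: eq_bigr => b _; rewrite big_nat [RHS]big_nat; apply: eq_bigr => k /andP[k0 kL].
rewrite exprnP; congr (_ ^ _); rewrite /f lapl_sum.
rewrite (bigD1_seq k) ?iota_uniq //=; last by rewrite mem_index_iota k0.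
have hl j : (0 < j)%N -> lapl (fun i => (minn i j * nu b j)%:Z) k = (k == j)%:Z * (nu b j)%:Z.
  by move=> j0; rewrite -(lapl_min j0 k0) /lapl !PoszM; ring.
rewrite hl // eqxx mul1r big_seq_cond big1 ?addr0 // => j /andP[].
by rewrite mem_index_iota => /andP[j0 _] /negPf jk; rewrite hl // eq_sym jk mul0r.
Qed.

End QSystem.

(** * Representations of sl2 *)

Section Sl2.
Variables (K : numFieldType) (E : lmodType K) (e f : {linear E -> E}).
Variables (W : int -> E -> Prop) (N : nat).
Hypothesis We : forall p v, W p v -> W (p + 2) (e v).
Hypothesis Wf : forall p v, W p v -> W (p - 2) (f v).
Hypothesis Wh : forall p v, W p v -> e (f v) - f (e v) = p%:~R *: v.
Hypothesis WN : forall p v, N%:Z < p -> W p v -> v = 0.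

Lemma sl2_iterW p v k : W p v -> W (p - k%:Z *+ 2) (iter k f v).
Proof.
move=> hv; elim: k => [|k IH]; first by rewrite subr0.
by rewrite /= (_ : _ - _ = p - k%:Z *+ 2 - 2); [exact: Wf|lia].
Qed.

Lemma sl2_iter p v k : W p v ->
  e (iter k.+1 f v) = iter k.+1 f (e v) + (k.+1%:Z * (p - k%:Z))%:~R *: iter k f v.
Proof.
move=> hv; elim: k => [|k IH].
  by rewrite /= subr0 mul1r -(Wh hv) addrC subrK.
rewrite iterS -[e _](subrK (f (e (iter k.+1 f v)))) (Wh (sl2_iterW k.+1 hv)) IH.
rewrite linearD linearZ /= addrCA -scalerDl -rmorphD /=; congr (_ + _%:~R *: _).
by lia.
Qed.

(** Descending induction on [p], from the bound N. By [sl2_iter], f^(p+2) kills e v, so e v = 0 by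
    induction. Then e f^(k+1) v = (k+1)(p-k) f^k v, with a nonzero factor for k < p, descends from
    f^p v = 0 to v = 0. Weights enter only as predicates, which suits modules as well as the adjoint
    action on matrices. *)
Lemma sl2_inj (p : nat) v : W p%:Z v -> iter p f v = 0 -> v = 0.
Proof.
have [b] := ubnP (N.+1 - p)%N; elim: b p v => // b IH p v hb hv fv.
case: (ltnP N p) => [Np|pN]; first by apply: (WN _ hv); lia.
have fS k : (p <= k)%N -> iter k f v = 0.
  move=> /subnK <-; rewrite iterD fv; elim: (k - p)%N => [//|i IHi].
  by rewrite iterS IHi linear0.
have ev : e v = 0.
  apply: (IH p.+2); first by lia.
    have -> : (p.+2)%:Z = p%:Z + 2 by lia.
    exact: We.
  have := sl2_iter p.+1 hv.
  by rewrite !fS ?linear0 ?scaler0 ?addr0 // ?leqW // => <-.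
have {IH hb pN fS}: forall k, (k <= p)%N -> iter k f v = 0 -> v = 0.
  elim=> [//|k IHk] kp fk; apply: IHk; first exact: ltnW.
  have := sl2_iter k hv; rewrite fk linear0 ev.
  have -> : iter k.+1 f 0 = 0 by elim: k.+1 => [//|i IHi]; rewrite iterS IHi linear0.
  rewrite add0r => /esym/eqP; rewrite scaler_eq0 intr_eq0 mulf_eq0 => /orP[|/eqP//].
  by move=> /orP[] /eqP; lia.
by move=> h; apply: (h p).
Qed.

End Sl2.

(** The index type may be infinite: members are added until the dimension forbids it. Keeping [s0]
    as the tail leaves its members, such as a highest weight vector, at a known position. *)
Lemma free_span_exists (K : fieldType) (E : vectType K) (T : Type) (g : T -> E) (s0 : seq T) :
  free (map g s0) -> exists s, free (map g (s ++ s0)) /\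
    forall t, g t \in <<map g (s ++ s0)>>%VS.
Proof.
have [b] := ubnP (\dim {:E} - size s0)%N; elim: b s0 => // b IH s0 hb fs.
case: (pselect (forall t, g t \in <<map g s0>>%VS)) => [h|/existsNP[t /negP ht]].
  by exists [::].
have fs' : free (map g (t :: s0)) by rewrite /= free_cons ht.
have hs : (size (t :: s0) <= \dim {:E})%N.
  by rewrite -(size_map g) -(eqnP fs') dimvS // subvf.
have [|s [h1 h2]] := IH (t :: s0) _ fs'; first by move: hs hb; rewrite /=; lia.
by exists (rcons s t); rewrite cat_rcons.
Qed.

Definition lfun_iter (K : fieldType) (E : vectType K) (g : 'End(E)) p : 'End(E) :=
  iter p (fun u => (g \o u)%VF) \1%VF.

Lemma lfun_iterE (K : fieldType) (E : vectType K) (g : 'End(E)) p v :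
  lfun_iter g p v = iter p g v.
Proof. by elim: p => [|p IH] /=; rewrite ?id_lfunE // comp_lfunE IH. Qed.

Lemma injective_dim_le (K : fieldType) (E E' : vectType K) (phi : 'Hom(E, E'))
  (U : {vspace E}) (U' : {vspace E'}) :
  (forall v, v \in U -> phi v \in U') -> (forall v, v \in U -> phi v = 0 -> v = 0) ->
  (\dim U <= \dim U')%N.
Proof.
move=> hU hi; rewrite -(@limg_dim_eq _ _ _ phi U).
  by apply/dimvS/subvP => _ /memv_imgP[v vU ->]; apply: hU.
apply/eqP; rewrite -subv0; apply/subvP => v; rewrite memv_cap memv_ker.
by move=> /andP[vU /eqP /(hi _ vU) ->]; rewrite memv0.
Qed.

(** * Weights *)

Section Reflections.
Variables (n : nat) (A : 'M[int]_n).
Hypothesis A2 : forall i, A i i = 2.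
Local Notation al := (simple_root A).
Implicit Types mu : 'rV[int]_n.

Definition refl i mu : 'rV[int]_n := mu - al i *~ mu 0 i.

Lemma simple_rootE i a : al i 0 a = A a i. Proof. by rewrite mxE. Qed.

Lemma reflE i mu a : refl i mu 0 a = mu 0 a - A a i * mu 0 i.
Proof. by rewrite /refl -scaler_int intz !mxE mulrC. Qed.

Lemma reflK i : involutive (refl i).
Proof. by move=> mu; apply/rowP => a; rewrite !reflE A2; ring. Qed.

Lemma reflD i mu nu : refl i (mu + nu) = refl i mu + refl i nu.
Proof. by apply/rowP => a; rewrite [RHS]mxE !reflE !mxE; ring. Qed.

Lemma reflN i mu : refl i (- mu) = - refl i mu.
Proof. by apply/rowP => a; rewrite [RHS]mxE !reflE !mxE; ring. Qed.

Lemma refl_alpha i : refl i (al i) = - al i.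
Proof. by apply/rowP => a; rewrite [RHS]mxE reflE !mxE A2; ring. Qed.

End Reflections.

Section ChevalleyModule.
Variables (K : numFieldType) (n : nat) (A : 'M[int]_n).
Hypothesis A2 : forall i, A i i = 2.
Variable V : chevalley_module K A.
Local Notation al := (simple_root A).
Local Notation e := (mod_e V).
Local Notation f := (mod_f V).
Local Notation h := (mod_h V).

Implicit Types (mu kap : 'rV[int]_n) (i j : 'I_n) (v : V).

Lemma bracketE (U : vectType K) (u v : 'End(U)) x : lie_bracket u v x = u (v x) - v (u x).
Proof. by rewrite /lie_bracket add_lfunE opp_lfunE !comp_lfunE. Qed.

Definition weight_vec (mu : 'rV[int]_n) (v : V) := forall a, h a v = (mu 0 a)%:~R *: v.

Lemma mem_weight_space mu v : v \in weight_space V mu <-> weight_vec mu v.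
Proof.
rewrite memvE; split=> [/subv_bigcapP hv a|hv].
  have := hv a isT; rewrite -memvE memv_ker !lfunE /= lfunE /= !lfunE /=.
  by rewrite id_lfunE subr_eq0 => /eqP.
apply/subv_bigcapP => a _; rewrite -memvE memv_ker !lfunE /= lfunE /= !lfunE /=.
by rewrite id_lfunE (hv a) subrr.
Qed.

Lemma weight_e mu v i : weight_vec mu v -> weight_vec (mu + al i) (e i v).
Proof.
move=> hv a; have := congr1 (fun g : 'End(V) => g v) (mod_he V a i).
rewrite bracketE lfunE /= (hv a) linearZ /= => /eqP; rewrite subr_eq => /eqP ->.
by rewrite -scalerDl -rmorphD /= !mxE addrC.
Qed.

Lemma weight_f mu v i : weight_vec mu v -> weight_vec (mu - al i) (f i v).
Proof.
move=> hv a; have := congr1 (fun g : 'End(V) => g v) (mod_hf V a i).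
rewrite bracketE lfunE /= lfunE /= (hv a) linearZ /= => /eqP; rewrite subr_eq => /eqP ->.
by rewrite -scaleNr -scalerDl -rmorphN -rmorphD /= !mxE addrC.
Qed.

Lemma weight_ef mu v i j : weight_vec mu v ->
  e i (f j v) = f j (e i v) + (if i == j then (mu 0 i)%:~R *: v else 0).
Proof.
move=> hv; have := congr1 (fun g : 'End(V) => g v) (mod_ef V i j).
rewrite bracketE => /eqP; rewrite subr_eq => /eqP ->; rewrite addrC; congr (_ + _).
by case: eqP => _; rewrite ?hv // lfunE.
Qed.

Hypothesis Virr : mod_irreducible V.
Variables (lam : 'rV[int]_n) (v0 : V).
Hypothesis v0_neq0 : v0 != 0.
Hypothesis v0_hw : forall a, e a v0 = 0 /\ h a v0 = (lam 0 a)%:~R *: v0.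

Definition fword (s : seq 'I_n) : V := foldr (fun i v => f i v) v0 s.
Definition wsum (s : seq 'I_n) : 'rV[int]_n := \sum_(i <- s) al i.

Lemma weight_fword s : weight_vec (lam - wsum s) (fword s).
Proof.
elim: s => [|i s IH]; first by move=> a; rewrite /wsum big_nil subr0; have [] := v0_hw a.
rewrite /wsum big_cons opprD addrCA addrC; exact: weight_f.
Qed.

(** Moving a raising operator to the right through a word until it meets [v0] shows that the span of
    the words is stable, hence everything by irreducibility. *)
Lemma fword_basis : exists s : seq (seq 'I_n),
  basis_of fullv [seq fword t | t <- s ++ [:: [::]]].
Proof.
have fs0 : free [seq fword t | t <- [:: [::]]] by rewrite /= seq1_free.
have [s [fs hs]] := free_span_exists fs0; exists s.
rewrite basisEfree fs subvf; set U := <<_>>%VS in hs *.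
suff : U = 0%VS \/ U = fullv.
  case=> [U0|U1]; last first.
    by rewrite -(eqnP fs) -/U U1 leqnn.
  by have := hs [::]; rewrite U0 memv0 (negPf v0_neq0).
have stab (g : 'End(V)) : (forall t, g (fword t) \in U) -> (g @: U <= U)%VS.
  move=> hg; rewrite limg_span; apply/span_subvP => _ /mapP[_ /mapP[t _ ->] ->].
  exact: hg.
have hst a t : h a (fword t) \in U by rewrite weight_fword memvZ.
apply: (proj2 Virr) => a; split; last split; apply: (stab _) => t; last exact: hst.
  elim: t => [|i t IH]; first by rewrite (proj1 (v0_hw a)) mem0v.
  rewrite /= (weight_ef _ _ (weight_fword t)) rpredD //; last first.
    by case: eqP => _; rewrite ?mem0v // memvZ.
  have : (f i @: U <= U)%VS by apply: (stab _) => t'; apply: (hs (i :: t')).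
  by move/subvP; apply; apply: memv_img.
exact: (hs (a :: t)).
Qed.

Hypothesis lam_free : forall s, wsum s = 0 -> s = [::].

(** A module is encoded by the matrices of its generators in a basis of weight
    vectors obtained by applying lowering operators to [v0]. *)
Lemma weight_basis : exists d (w : 'I_d -> 'rV[int]_n) (X : d.-tuple V) (k0 : 'I_d),
  [/\ basis_of fullv X,
      forall k : 'I_d, exists s, X`_k = fword s /\ w k = lam - wsum s,
      X`_k0 = v0, w k0 = lam & forall k : 'I_d, k != k0 -> w k != lam].
Proof.
have [s bs] := fword_basis; set S := s ++ _ in bs.
exists (size S), (fun k => lam - wsum (nth [::] S k)), (map_tuple fword (in_tuple S)).
have k0S : (size s < size S)%N by rewrite size_cat addn1.
exists (Ordinal k0S).
have nthS k : (map fword S)`_k = fword (nth [::] S k) \/ (size S <= k)%N.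
  case: (ltnP k (size S)) => kS; last by right.
  by left; rewrite (nth_map [::]).
have S0 : nth [::] S (size s) = [::] by rewrite nth_cat ltnn subnn.
split=> //=.
- by move=> k; exists (nth [::] S k); case: (nthS k) => //; rewrite leqNgt ltn_ord.
- by case: (nthS (size s)) => [->|]; rewrite ?S0 // leqNgt k0S.
- by rewrite S0 /wsum big_nil subr0.
move=> k; apply: contraNneq => e; apply/eqP/val_inj => /=.
have uS : uniq (map fword S) by apply: free_uniq; apply: (basis_free bs).
have wS : nth [::] S k = [::].
  by apply: lam_free; move/eqP: e; rewrite subr_eq addrC -subr_eq subrr => /eqP.
apply/eqP; rewrite -(nth_uniq 0 _ _ uS) ?size_map //.
rewrite !(nth_map [::]) // S0 wS //.
Qed.

Section Basis.
Variables (d : nat) (w : 'I_d -> 'rV[int]_n) (X : d.-tuple V).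
Hypothesis bX : basis_of fullv X.
Hypothesis wX : forall k : 'I_d, weight_vec (w k) X`_k.

Lemma coordX v : v = \sum_k coord X k v *: X`_k.
Proof. exact: coord_basis bX (memvf v). Qed.

Lemma coordX_basis (k l : 'I_d) : coord X k X`_l = (k == l)%:R.
Proof. by rewrite coord_free ?(basis_free bX) // eq_sym. Qed.

Lemma coord_weight mu v k : weight_vec mu v -> w k != mu -> coord X k v = 0.
Proof.
move=> hv hk; have [a ha] : exists a, w k 0 a != mu 0 a.
  apply: contrapT => h0; case/eqP: hk; apply/rowP => a.
  by apply/eqP; apply: contrapT => /negP ?; apply: h0; exists a.
have h1 : coord X k (h a v) = (w k 0 a)%:~R * coord X k v.
  rewrite [in LHS](coordX v) linear_sum /= linear_sum /= (bigD1 k) //= big1 ?addr0.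
    by rewrite linearZ /= wX !linearZ /= coordX_basis eqxx mulr1 mulrC.
  move=> l /negPf lk; rewrite linearZ /= wX !linearZ /= coordX_basis eq_sym lk.
  by rewrite !mulr0.
have := h1; rewrite hv linearZ /= => /eqP; rewrite -subr_eq0 -mulrBl mulf_eq0 => /orP[|/eqP//].
by rewrite -rmorphB intr_eq0 subr_eq0 eq_sym (negPf ha).
Qed.

Lemma weight_bound mu v : weight_vec mu v -> (forall k, w k != mu) -> v = 0.
Proof.
move=> hv hk; rewrite (coordX v) big1 // => k _.
by rewrite (coord_weight hv) ?scale0r.
Qed.

Lemma dim_weight_space mu : \dim (weight_space V mu) = #|[pred k | w k == mu]|.
Proof.
have -> : weight_space V mu = <<[seq X`_k | k : 'I_d <- enum [pred k | w k == mu]]>>%VS.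
  apply/vspaceP => v; apply/idP/idP => [/mem_weight_space hv|].
    rewrite (coordX v) rpred_sum // => k _; case: (eqVneq (w k) mu) => [wk|wk].
      rewrite memvZ // memv_span //; apply/mapP; exists k => //.
      by rewrite mem_enum inE wk.
    by rewrite (coord_weight hv wk) scale0r mem0v.
  move: v; apply/subvP/span_subvP => _ /mapP[k + ->]; rewrite mem_enum inE => /eqP wk.
  by apply/mem_weight_space; rewrite -wk; apply: wX.
have fr : free [seq X`_k | k : 'I_d <- enum [pred k | w k == mu]].
  set Y := map _ _; have pY : perm_eq [seq x <- X | x \in Y] Y.
    apply: uniq_perm; first by rewrite filter_uniq ?free_uniq ?(basis_free bX).
      rewrite map_inj_uniq ?enum_uniq // => k l /eqP.
      by rewrite nth_uniq ?size_tuple ?free_uniq ?(basis_free bX) // => /eqP/val_inj.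
    move=> v; rewrite mem_filter /=; apply: andb_idr => /mapP[k _ ->].
    by rewrite mem_nth // size_tuple.
  by rewrite -(perm_free pY) filter_free // (basis_free bX).
by rewrite (eqnP fr) size_map cardE.
Qed.

Let Ws i (p : int) v := exists mu, mu 0 i = p /\ weight_vec mu v.
Let Nb (i : 'I_n) := (\sum_k absz (w k 0%R i))%N.

Lemma weight_bound_i i p v : (Nb i)%:Z < `|p| -> Ws i p v -> v = 0.
Proof.
move=> hp [mu [mp hv]]; apply: weight_bound hv _ => k; apply/eqP => e.
move: hp; rewrite -mp -e /Nb (bigD1 k) //= -abszE; lia.
Qed.

Lemma f_iter_inj i mu v (p : nat) : mu 0 i = p%:Z -> weight_vec mu v ->
  iter p (f i) v = 0 -> v = 0.
Proof.
move=> mp hv; apply: (@sl2_inj K V (e i) (f i) (Ws i) (Nb i)) => //.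
- move=> q u [kap [kq hu]]; exists (kap + al i); split; last exact: weight_e.
  by rewrite mxE mxE A2 kq.
- move=> q u [kap [kq hu]]; exists (kap - al i); split; last exact: weight_f.
  by rewrite !mxE A2 kq.
- move=> q u [kap [kq hu]]; have := weight_ef i i hu; rewrite eqxx kq => E.
  by apply: etrans (congr1 (fun z => z - f i (e i u)) E) _; rewrite addrAC subrr add0r.
- by move=> q u hq; apply: weight_bound_i; lia.
- by exists mu.
Qed.

Lemma e_iter_inj i mu v (p : nat) : mu 0 i = - p%:Z -> weight_vec mu v ->
  iter p (e i) v = 0 -> v = 0.
Proof.
move=> mp hv; apply: (@sl2_inj K V (f i) (e i) (fun q => Ws i (- q)) (Nb i)) => //.
- move=> q u [kap [kq hu]]; exists (kap - al i); split; last exact: weight_f.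
  by rewrite !mxE A2 kq; ring.
- move=> q u [kap [kq hu]]; exists (kap + al i); split; last exact: weight_e.
  by rewrite mxE mxE A2 kq; ring.
- move=> q u [kap [kq hu]]; have := weight_ef i i hu; rewrite eqxx kq => E.
  apply: etrans (congr1 (fun z => f i (e i u) - z) E) _.
  by rewrite opprD addrA subrr sub0r rmorphN scaleNr opprK.
- by move=> q u hq; apply: weight_bound_i; lia.
- by exists mu.
Qed.

(** For mu_i = p >= 0, the operators f_i^p and e_i^p embed the two weight spaces into one
    another. *)
Lemma dim_refl i mu :
  \dim (weight_space V (refl A i mu)) = \dim (weight_space V mu).
Proof.
have iterf p v kap : weight_vec kap v -> weight_vec (kap - al i *+ p) (iter p (f i) v).
  move=> hv; elim: p => [|p IH]; first by rewrite subr0.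
  by rewrite mulrSr opprD addrA iterS; apply: weight_f.
have itere p v kap : weight_vec kap v -> weight_vec (kap + al i *+ p) (iter p (e i) v).
  move=> hv; elim: p => [|p IH]; first by rewrite addr0.
  by rewrite mulrSr addrA iterS; apply: weight_e.
have main kap (p : nat) : kap 0 i = p%:Z ->
    \dim (weight_space V (refl A i kap)) = \dim (weight_space V kap).
  move=> kp; have rE : refl A i kap = kap - al i *+ p by rewrite /refl kp -pmulrn.
  apply/eqP; rewrite eqn_leq; apply/andP; split.
    apply: (@injective_dim_le _ _ _ (lfun_iter (e i) p)) => v; rewrite mem_weight_space => hv.
      rewrite lfun_iterE mem_weight_space -{1}(subrK (al i *+ p) kap) -rE.
      exact: itere.
    rewrite lfun_iterE; apply: (e_iter_inj _ hv).
    by rewrite reflE kp A2; ring.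
  apply: (@injective_dim_le _ _ _ (lfun_iter (f i) p)) => v; rewrite mem_weight_space => hv.
    by rewrite lfun_iterE mem_weight_space rE; apply: iterf.
  by rewrite lfun_iterE; apply: (f_iter_inj kp hv).
case: (lerP 0 (mu 0 i)) => hmu.
  by apply: (main mu (absz (mu 0 i))); lia.
rewrite -{2}(reflK A2 i mu); symmetry; apply: (main _ (absz (mu 0 i))).
by rewrite reflE A2; lia.
Qed.

Definition mxof (u : 'End(V)) : 'M[K]_d := \matrix_(k, l) coord X k (u X`_l).
Definition cvof (v : V) : 'cV[K]_d := \col_k coord X k v.

Lemma cvof_mxof (u : 'End(V)) v : cvof (u v) = mxof u *m cvof v.
Proof.
apply/colP => k; rewrite !mxE {1}(coordX v) !linear_sum /=; apply: eq_bigr => l _.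
by rewrite !mxE !linearZ /= mulrC.
Qed.

Lemma cvof_basis (l : 'I_d) : cvof X`_l = delta_mx l 0.
Proof. by apply/colP => k; rewrite !mxE coordX_basis eqxx andbT. Qed.

Lemma mxofM (u v : 'End(V)) : mxof (u \o v)%VF = mxof u *m mxof v.
Proof.
apply/matrixP => k l; rewrite !mxE comp_lfunE {1}(coordX (v X`_l)) !linear_sum /=.
by apply: eq_bigr => j _; rewrite !mxE !linearZ /= mulrC.
Qed.

Lemma mxofB (u v : 'End(V)) : mxof (u - v) = mxof u - mxof v.
Proof. by apply/matrixP => k l; rewrite !mxE add_lfunE opp_lfunE linearB. Qed.

Lemma mxof0 : mxof 0 = 0.
Proof. by apply/matrixP => k l; rewrite !mxE zero_lfunE linear0. Qed.

Lemma mxof_h i : mxof (h i) = diag_mx (\row_k (w k 0 i)%:~R).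
Proof.
apply/matrixP => k l; rewrite !mxE wX linearZ /= coordX_basis mulr_natr.
by case: eqP => [->|].
Qed.

Lemma mxof_ef i j : mxof (e i) *m mxof (f j) - mxof (f j) *m mxof (e i)
  = if i == j then diag_mx (\row_k (w k 0 i)%:~R) else 0.
Proof.
rewrite -!mxofM -mxofB -[X in mxof X]/(lie_bracket (e i) (f j)) mod_ef.
by case: eqP => _; rewrite ?mxof_h ?mxof0.
Qed.

Lemma mxof_e_weight i k l : mxof (e i) k l != 0 -> w k = w l + al i.
Proof.
rewrite mxE; apply: contraNeq => hk.
by rewrite (coord_weight (weight_e _ (wX l)) hk).
Qed.

Lemma mxof_f_weight i k l : mxof (f i) k l != 0 -> w k = w l - al i.
Proof.
rewrite mxE; apply: contraNeq => hk.
by rewrite (coord_weight (weight_f _ (wX l)) hk).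
Qed.

End Basis.

End ChevalleyModule.

(** * The Lie algebra of operators and its trace form *)

Section Adjoint.
Variables (K : numFieldType) (d : nat).
Implicit Types x y z : 'M[K]_d.

Definition ad x y : 'M[K]_d := x *m y - y *m x.

Fact ad_linear x : linear (ad x).
Proof.
by move=> c y z; rewrite /ad mulmxDr mulmxDl -scalemxAl -scalemxAr opprD addrACA scalerBr.
Qed.

HB.instance Definition _ x := GRing.isLinear.Build K 'M[K]_d 'M[K]_d _ (ad x) (ad_linear x).

Lemma adC x y : ad x y = - ad y x. Proof. by rewrite /ad opprB. Qed.

Lemma ad_jacobi x y z : ad x (ad y z) = ad (ad x y) z + ad y (ad x z).
Proof.
rewrite /ad !(mulmxBr, mulmxBl) !mulmxA.
move: (x *m y *m z) (x *m z *m y) (y *m z *m x) (z *m y *m x) (y *m x *m z) (z *m x *m y).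
by move=> a b c e f g; apply/matrixP => i j; rewrite !mxE; ring.
Qed.

Lemma adM x y z : ad x (y *m z) = ad x y *m z + y *m ad x z.
Proof.
rewrite /ad mulmxBl mulmxBr !mulmxA.
by rewrite addrA subrK.
Qed.

Lemma tr_ad x y z : \tr (ad x y *m z) = - \tr (y *m ad x z).
Proof.
by rewrite /ad mulmxBl mulmxBr !mxtraceD !raddfN /= -mulmxA mxtrace_mulC -!mulmxA opprB.
Qed.

Variables (n : nat).

Fixpoint br (X : 'I_n -> 'M[K]_d) (s : seq 'I_n) : 'M[K]_d :=
  if s is i :: s' then (if s' is [::] then X i else ad (X i) (br X s')) else 0.

Lemma br_cons X i s : s != [::] -> br X (i :: s) = ad (X i) (br X s).
Proof. by case: s. Qed.

Lemma span_stable (T : eqType) (g : T -> 'M[K]_d) (s : seq T) (U : {vspace 'M[K]_d})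
    (phi : 'End('M[K]_d)) x :
  (forall t, phi (g t) \in U) -> x \in <<map g s>>%VS -> phi x \in U.
Proof.
move=> h hx; have : (phi @: <<map g s>> <= U)%VS.
  by rewrite limg_span; apply/span_subvP => _ /mapP[_ /mapP[t _ ->] ->].
by move/subvP; apply; apply: memv_img.
Qed.

(** Induction on the word with the Jacobi identity, which needs a space stable under all [ad (Y j)].
    That is not assumed of [U], but holds for the span [L] of the words in Y and of the Z. *)
Lemma ad_word_stable (U : {vspace 'M[K]_d}) (X Y Z : 'I_n -> 'M[K]_d) :
  (forall i j, ad (X i) (Y j) = if i == j then Z i else 0) ->
  (forall i s, exists c, ad (Z i) (br Y s) = c *: br Y s) ->
  (forall s, br Y s \in U) -> (forall i, Z i \in U) ->
  forall i s, ad (X i) (br Y s) \in U.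
Proof.
move=> XY ZY YU ZU.
pose g (t : seq 'I_n + 'I_n) := match t with inl s => br Y s | inr i => Z i end.
have [|s0 [_ hg]] := @free_span_exists _ _ _ g [::]; first exact: nil_free.
set L := <<_>>%VS in hg.
have LU : (L <= U)%VS by apply/span_subvP => _ /mapP[[s|i] _ ->]; [exact: YU|exact: ZU].
have adY j x : x \in L -> ad (Y j) x \in L.
  have := @span_stable _ g (s0 ++ [::]) L (linfun (ad (Y j))) x; rewrite lfunE; apply.
  move=> [s|i]; rewrite lfunE /=.
    case: (s =P [::]) => [->|/eqP s0']; first by rewrite linear0 mem0v.
    by rewrite -br_cons //; exact: (hg (inl (j :: s))).
  have [c /= e] := ZY i [:: j]; rewrite adC e rpredN memvZ //.
  exact: (hg (inl [:: j])).
suff h i s : ad (X i) (br Y s) \in L by move=> i s; apply: (subvP LU); apply: h.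
elim: s => [|j s IH]; first by rewrite linear0 mem0v.
case: (s =P [::]) => [->|/eqP s1].
  by rewrite /= XY; case: eqP => _; rewrite ?mem0v //; exact: (hg (inr i)).
rewrite br_cons // ad_jacobi XY rpredD ?adY //; case: eqP => [_|_].
  by have [c ->] := ZY i s; rewrite memvZ //; exact: (hg (inl s)).
by rewrite adC linear0 oppr0 mem0v.
Qed.

End Adjoint.

Section LieRep.
Variables (K : numFieldType) (n d : nat) (A : 'M[int]_n).
Variables (w : 'I_d -> 'rV[int]_n) (E F : 'I_n -> 'M[K]_d).
Local Notation al := (simple_root A).
Local Notation rt := (wt al).
Hypothesis A2 : forall i, A i i = 2.
Hypothesis A_pos : forall k : 'I_n -> rat, (exists b, k b != 0) ->
  exists i, 0 < k i * \sum_j (A i j)%:~R * k j.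
Hypothesis E_weight : forall i k l, E i k l != 0 -> w k = w l + al i.
Hypothesis F_weight : forall i k l, F i k l != 0 -> w k = w l - al i.
Definition Hmx i : 'M[K]_d := diag_mx (\row_k (w k 0 i)%:~R).
Hypothesis EF : forall i j, ad (E i) (F j) = if i == j then Hmx i else 0.
Hypothesis E_neq0 : forall i, E i != 0.
Implicit Types (beta gam : 'rV[int]_n) (x y : 'M[K]_d).

(** [A_pos] stands in for positive definiteness of the root form: besides linear independence of the
    simple roots it yields a simple reflection direction that brings a given root nearer to 0. *)
Lemma root_pos (k : 'I_n -> int) : (exists b, k b != 0) ->
  exists i, 0 < k i * (\sum_b al b *~ k b) 0 i.
Proof.
move=> [b kb]; have [|i hi] := @A_pos (fun i => (k i)%:~R).
  by exists b; rewrite intr_eq0.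
exists i; rewrite -(ltr0z rat) rmorphM /=; congr (_ < _ * _): hi.
rewrite summxE rmorph_sum /=; apply: eq_bigr => j _.
by rewrite -scaler_int !mxE intz rmorphM /= mulrC.
Qed.

Lemma root_free (k : 'I_n -> int) : \sum_b al b *~ k b = 0 -> forall b, k b = 0.
Proof.
move=> h b; apply/eqP; apply: contrapT => /negP kb.
have [|i] := @root_pos k; first by exists b.
by rewrite h mxE mulr0 ltxx.
Qed.

Lemma wtz (k : mindex n) : rt k = \sum_b al b *~ (k b)%:Z.
Proof. by apply: eq_bigr => b _; rewrite pmulrn. Qed.

Lemma rt_free (k : mindex n) : rt k = 0 -> k = 0.
Proof.
rewrite wtz => /root_free h; apply/ffunP => b; rewrite mindex0.
by have [] := h b.
Qed.

Definition graded beta x := forall k l, x k l != 0 -> w k = w l + beta.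

Lemma graded0 beta : graded beta 0.
Proof. by move=> k l; rewrite mxE eqxx. Qed.

Lemma gradedD beta x y : graded beta x -> graded beta y -> graded beta (x + y).
Proof.
move=> hx hy k l; rewrite mxE; case: (eqVneq (x k l) 0) => [->|/hx //].
by rewrite add0r => /hy.
Qed.

Lemma gradedZ beta c x : graded beta x -> graded beta (c *: x).
Proof. by move=> hx k l; rewrite mxE mulf_eq0 => /norP[_ /hx]. Qed.

Lemma gradedN beta x : graded beta x -> graded beta (- x).
Proof. by move=> hx k l; rewrite mxE oppr_eq0 => /hx. Qed.

Lemma graded_mul beta gam x y : graded beta x -> graded gam y -> graded (beta + gam) (x *m y).
Proof.
move=> hx hy k l; rewrite mxE => h.
have [j] : exists j, x k j * y j l != 0.
  apply: contrapT => hn; case/eqP: h; rewrite big1 // => j _; apply/eqP.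
  by apply: contrapT => /negP ?; apply: hn; exists j.
by rewrite mulf_eq0 => /norP[/hx -> /hy ->]; rewrite addrAC addrA.
Qed.

Lemma graded_ad beta gam x y : graded beta x -> graded gam y -> graded (beta + gam) (ad x y).
Proof.
move=> hx hy; apply: gradedD; first exact: graded_mul.
by apply: gradedN; rewrite addrC; apply: graded_mul.
Qed.

Lemma graded_H i : graded 0 (Hmx i).
Proof. by move=> k l; rewrite !mxE; case: (k =P l) => [->|]; rewrite ?addr0 // mulr0n eqxx. Qed.

Lemma ad_H beta x i : graded beta x -> ad (Hmx i) x = (beta 0 i)%:~R *: x.
Proof.
move=> hx; apply/matrixP => k l; rewrite /ad mul_diag_mx mul_mx_diag !mxE.
case: (eqVneq (x k l) 0) => [->|/hx ->]; first by rewrite mulr0 mul0r subrr mulr0.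
by rewrite mxE rmorphD /=; ring.
Qed.

Lemma graded_tr beta x : graded beta x -> beta != 0 -> \tr x = 0.
Proof.
move=> hx b0; rewrite /mxtrace big1 // => k _; apply/eqP.
apply: contrapT => /negP /hx /eqP; rewrite -subr_eq0 opprD addrA subrr sub0r oppr_eq0.
by rewrite (negPf b0).
Qed.

Definition cnt (s : seq 'I_n) : mindex n := \sum_(i <- s) idelta i 1.

Lemma cnt_cons i s : cnt (i :: s) = idelta i 1 + cnt s. Proof. exact: big_cons. Qed.

Lemma rt_cnt_cons i s : rt (cnt (i :: s)) = al i + rt (cnt s).
Proof. by rewrite cnt_cons wtD wt_idelta. Qed.

Lemma cnt_eq0 s : cnt s = 0 -> s = [::].
Proof.
case: s => // i s; rewrite cnt_cons => /ffunP/(_ i)/eqP.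
by rewrite mindexD mindex0 ffunE eqxx.
Qed.

Lemma graded_brE s : graded (rt (cnt s)) (br E s).
Proof.
elim: s => [|i s IH]; first exact: graded0.
case: (s =P [::]) => [->|/eqP s0].
  by rewrite rt_cnt_cons /cnt big_nil wt0 addr0; exact: E_weight.
by rewrite rt_cnt_cons br_cons //; apply: graded_ad => //; apply: E_weight.
Qed.

Lemma graded_brF s : graded (- rt (cnt s)) (br F s).
Proof.
elim: s => [|i s IH]; first exact: graded0.
case: (s =P [::]) => [->|/eqP s0].
  by rewrite rt_cnt_cons /cnt big_nil wt0 addr0; exact: F_weight.
by rewrite rt_cnt_cons opprD br_cons //; apply: graded_ad => //; apply: F_weight.
Qed.

(** Spanning elements adapted to the triangular decomposition: brackets of raising operators,
    brackets of lowering operators, and Cartan elements. All are homogeneous, so the basis [bs]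
    chosen among them is too. *)
Definition gen (t : seq 'I_n + seq 'I_n + 'I_n) : 'M[K]_d :=
  match t with inl (inl s) => br E s | inl (inr s) => br F s | inr i => Hmx i end.

Definition gdeg (t : seq 'I_n + seq 'I_n + 'I_n) : 'rV[int]_n :=
  match t with inl (inl s) => rt (cnt s) | inl (inr s) => - rt (cnt s) | inr i => 0 end.

Lemma graded_gen t : graded (gdeg t) (gen t).
Proof. case: t => [[s|s]|i]; [exact: graded_brE|exact: graded_brF|exact: graded_H]. Qed.

Variable bs : seq (seq 'I_n + seq 'I_n + 'I_n).
Hypothesis bs_free : free (map gen bs).
Let L := <<map gen bs>>%VS.
Hypothesis bs_span : forall t, gen t \in L.

Lemma L_adE i x : x \in L -> ad (E i) x \in L.
Proof.
have := @span_stable K d _ gen bs L (linfun (ad (E i))) x; rewrite lfunE; apply.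
move=> [[s|s]|j]; rewrite lfunE /=.
- case: (s =P [::]) => [->|/eqP s0]; first by rewrite linear0 mem0v.
  by rewrite -br_cons //; exact: (bs_span (inl (inl (i :: s)))).
- apply: (@ad_word_stable _ _ _ L E F Hmx) => //.
  + by move=> k t; eexists; apply: ad_H; apply: graded_brF.
  + by move=> t; apply: (bs_span (inl (inr t))).
  + by move=> k; apply: (bs_span (inr k)).
- rewrite adC (ad_H _ (@E_weight i)) rpredN memvZ //.
  exact: (bs_span (inl (inl [:: i]))).
Qed.

Lemma L_adF i x : x \in L -> ad (F i) x \in L.
Proof.
have := @span_stable K d _ gen bs L (linfun (ad (F i))) x; rewrite lfunE; apply.
move=> [[s|s]|j]; rewrite lfunE /=.
- apply: (@ad_word_stable _ _ _ L F E (fun i => - Hmx i)).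
  + by move=> k l; rewrite adC EF eq_sym; case: eqP => [->|]; rewrite ?oppr0.
  + move=> k t; exists (- ((rt (cnt t)) 0 k)%:~R); rewrite adC linearN /= opprK adC.
    by rewrite (ad_H _ (@graded_brE t)) scaleNr.
  + by move=> t; apply: (bs_span (inl (inl t))).
  + by move=> k; rewrite rpredN; apply: (bs_span (inr k)).
- case: (s =P [::]) => [->|/eqP s0]; first by rewrite linear0 mem0v.
  by rewrite -br_cons //; exact: (bs_span (inl (inr (i :: s)))).
- rewrite adC (ad_H _ (@F_weight i)) rpredN memvZ //.
  exact: (bs_span (inl (inr [:: i]))).
Qed.

Lemma L_ad x y : x \in L -> y \in L -> ad x y \in L.
Proof.
move=> hx hy; rewrite adC rpredN.
have := @span_stable K d _ gen bs L (linfun (ad y)) x; rewrite lfunE; apply => //.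
move=> t; rewrite lfunE /= adC rpredN {x hx}; move: y hy.
have word X s : (forall i y, y \in L -> ad (X i) y \in L) ->
    forall y, y \in L -> ad (br X s) y \in L.
  move=> hX; elim: s => [|i s IH] y hy; first by rewrite adC linear0 oppr0 mem0v.
  case: (s =P [::]) => [->|/eqP s0]; first exact: hX.
  have -> : ad (br X (i :: s)) y = ad (X i) (ad (br X s) y) - ad (br X s) (ad (X i) y).
    by rewrite br_cons // [X in _ = X - _]ad_jacobi addrK.
  by rewrite rpredB ?hX ?IH ?hX.
case: t => [[s|s]|i]; [exact: word L_adE|exact: word L_adF|].
move=> y hy; have := @span_stable K d _ gen bs L (linfun (ad (Hmx i))) y.
rewrite lfunE; apply => // t; rewrite lfunE /= (ad_H _ (graded_gen (t := t))) memvZ //.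
Qed.

Definition comp beta x : 'M[K]_d := \matrix_(k, l) (if w k == w l + beta then x k l else 0).

Fact comp_linear beta : linear (comp beta).
Proof.
by move=> c x y; apply/matrixP => k l; rewrite !mxE; case: eqP => _ //; rewrite mulr0 addr0.
Qed.

HB.instance Definition _ beta :=
  GRing.isLinear.Build K 'M[K]_d 'M[K]_d _ (comp beta) (comp_linear beta).

Lemma graded_comp beta x : graded beta (comp beta x).
Proof. by move=> k l; rewrite mxE; case: (w k =P _) => //; rewrite eqxx. Qed.

Lemma comp_graded beta gam x : graded beta x -> comp gam x = if beta == gam then x else 0.
Proof.
move=> hx; apply/matrixP => k l; rewrite mxE; case: (beta =P gam) => [<-|/eqP bg].
  by case: (w k =P _) => // h; apply/esym/eqP; apply: contrapT => /negP /hx.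
rewrite mxE; case: (w k =P _) => // h; apply/eqP; apply: contrapT => /negP /hx.
by rewrite h => /addrI/eqP; rewrite eq_sym (negPf bg).
Qed.

Lemma comp_L beta x : x \in L -> comp beta x \in L.
Proof.
have := @span_stable K d _ gen bs L (linfun (comp beta)) x; rewrite lfunE; apply => t.
by rewrite lfunE /= (comp_graded _ (graded_gen (t := t))); case: eqP; rewrite ?mem0v.
Qed.

Lemma tr_comp beta x y : \tr (comp beta x *m y) = \tr (x *m comp (- beta) y).
Proof.
rewrite /mxtrace; apply: eq_bigr => k _; rewrite !mxE; apply: eq_bigr => l _; rewrite !mxE.
have -> : (w l == w k - beta) = (w k == w l + beta).
  by rewrite eq_sym subr_eq.
by case: eqP; rewrite ?mul0r ?mulr0.
Qed.

Lemma comp_gdeg beta x : x \in L -> comp beta x != 0 -> exists t, gdeg t = beta.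
Proof.
move=> hx; apply: contra_neqP => /forallNP h.
have := @span_stable K d _ gen bs 0%VS (linfun (comp beta)) x; rewrite lfunE memv0 => /(_ _ hx).
move=> hc; apply/eqP; apply: hc => t.
by rewrite lfunE /= (comp_graded _ (graded_gen (t := t))) memv0; case: (gdeg t =P beta) => // ht; case: (h t ht).
Qed.

Lemma L_graded0 x : x \in L -> graded 0 x -> exists c : 'rV[K]_n, x = \sum_i c 0 i *: Hmx i.
Proof.
move=> hx gx; pose X := map_tuple Hmx (ord_tuple n).
have : x \in <<X>>%VS.
  have := @span_stable K d _ gen bs <<X>>%VS (linfun (comp 0)) x.
  rewrite lfunE /= (comp_graded _ gx) eqxx; apply => // t.
  have Hi i : Hmx i \in <<X>>%VS by rewrite memv_span //; apply/mapP; exists i; rewrite ?mem_enum.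
  rewrite lfunE /= (comp_graded _ (graded_gen (t := t))).
  case: t => [[s|s]|i] /=; last by rewrite eqxx.
    by case: eqP => [/rt_free/cnt_eq0 ->|]; rewrite mem0v.
  by rewrite oppr_eq0; case: eqP => [/rt_free/cnt_eq0 ->|]; rewrite mem0v.
move/coord_span => ->; exists (\row_i coord X i x); apply: eq_bigr => i _.
by rewrite mxE (nth_map i) ?size_enum_ord // nth_ord_enum.
Qed.

(** The trace form on the Cartan subalgebra. *)
Definition Kmx : 'M[rat]_n := \matrix_(i, j) (\sum_k w k 0 i * w k 0 j)%:~R.

Lemma unit_cartan : map_mx (fun z : int => z%:~R : rat) A \in unitmx.
Proof.
rewrite -unitmx_tr unitmxE unitfE; apply/det0P => -[v v0 hv].
have [|i] := @A_pos (fun i => v 0 i).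
  apply: contrapT => /forallNP h; case/eqP: v0; apply/rowP => b; rewrite mxE.
  by have /negP/negPn/eqP := h b.
move/rowP/(_ i): hv; rewrite !mxE => hv.
have -> : \sum_j (A i j)%:~R * v 0 j = 0.
  by apply: etrans _ hv; apply: eq_bigr => j _; rewrite !mxE mulrC.
by rewrite mulr0 ltxx.
Qed.

(** The value is the sum over the weights of the squares of their pairings with [v]. If it is 0,
    then [v] also annihilates each alpha_j, which is a difference of two weights because E_j is
    nonzero. Rational entries are used because [K] may fail to be totally ordered. *)
Lemma Kmx_pos (v : 'rV[rat]_n) : v != 0 -> 0 < (v *m Kmx *m v^T) 0 0.
Proof.
move=> v0; pose p k : rat := \sum_i v 0 i * (w k 0 i)%:~R.
have -> : (v *m Kmx *m v^T) 0 0 = \sum_k p k ^+ 2.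
  rewrite mxE; under eq_bigr => j _ do rewrite !mxE mulr_suml.
  rewrite exchange_big /=.
  transitivity (\sum_i \sum_j \sum_k v 0 i * (w k 0 i)%:~R * (v 0 j * (w k 0 j)%:~R) : rat).
    apply: eq_bigr => i _; apply: eq_bigr => j _.
    rewrite !mxE rmorph_sum /= mulr_sumr mulr_suml; apply: eq_bigr => k _.
    by rewrite rmorphM /=; ring.
  rewrite (eq_bigr _ (fun i _ => exchange_big _ _ _ _ _ _)) /= exchange_big /=.
  apply: eq_bigr => k _; rewrite expr2 /p mulr_suml; apply: eq_bigr => i _.
  by rewrite mulr_sumr.
rewrite lt_neqAle sumr_ge0 ?andbT => [|k _]; last exact: sqr_ge0.
apply/negP; rewrite eq_sym psumr_eq0 => [/allP h|k _]; last exact: sqr_ge0.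
have pk k : p k = 0 by apply/eqP; have := h k; rewrite mem_index_enum sqrf_eq0; apply.
case/eqP: v0; apply: (row_free_inj (A := map_mx (fun z : int => z%:~R : rat) A)).
  by rewrite row_free_unit unit_cartan.
rewrite mul0mx; apply/rowP => j; rewrite !mxE.
have [k [l Ekl]] : exists k l, E j k l != 0.
  apply: contrapT => hn; case/eqP: (E_neq0 j); apply/matrixP => k l; rewrite mxE.
  by apply/eqP; apply: contrapT => /negP ?; apply: hn; exists k, l.
have wkl := E_weight Ekl.
transitivity (p k - p l); last by rewrite !pk subrr.
rewrite /p -sumrB; apply: eq_bigr => i _; rewrite wkl !mxE rmorphD /=; ring.
Qed.

Lemma unit_Kmx : Kmx \in unitmx.
Proof.
rewrite unitmxE unitfE; apply/det0P => -[v v0 hv].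
by have := Kmx_pos v0; rewrite hv mul0mx mxE ltxx.
Qed.

Definition KmxK : 'M[K]_n := map_mx ratr Kmx.

Lemma unit_KmxK : KmxK \in unitmx.
Proof. by rewrite map_unitmx unit_Kmx. Qed.

Lemma tr_HH i j : \tr (Hmx i *m Hmx j) = KmxK i j.
Proof.
rewrite mulmx_diag !mxE mxtrace_diag ratr_int rmorph_sum /=.
by apply: eq_bigr => k _; rewrite !mxE rmorphM.
Qed.

Lemma tr_cartan (c : 'rV[K]_n) j : \tr ((\sum_i c 0 i *: Hmx i) *m Hmx j) = (c *m KmxK) 0 j.
Proof.
rewrite mulmx_suml raddf_sum /= mxE; apply: eq_bigr => i _.
by rewrite -scalemxAl mxtraceZ tr_HH.
Qed.

(** [sl2_inj] for the adjoint action on matrices; the boolean exchanges the roles of E and F. Only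
    the shift of the weight coordinate [i] is recorded, so the bound on the weights comes from the
    finitely many [w k]. *)
Lemma ad_inj_iter beta x i (s : bool) : graded beta x ->
  0 < (if s then beta 0 i else - beta 0 i) ->
  iter (absz (beta 0%R i)) (ad ((if s then F else E) i)) x = 0 -> x = 0.
Proof.
move=> gx bi0 fx.
pose Wp (p : int) (z : 'M[K]_d) := forall k l, z k l != 0 -> w k 0 i = w l 0 i + p.
have WE p z : Wp p z -> Wp (p + 2) (ad (E i) z).
  move=> hz k l; rewrite !mxE; case: (pselect (exists j, E i k j != 0 /\ z j l != 0)).
    by move=> [j [/E_weight e2 /hz e1]] _; rewrite e2 mxE simple_rootE A2 e1; lia.
  move=> h1; case: (pselect (exists j, z k j != 0 /\ E i j l != 0)).
    by move=> [j [/hz e1 /E_weight e2]] _; rewrite e1 e2 mxE simple_rootE A2 addrAC -addrA.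
  move=> h2; rewrite !big1 ?subrr ?eqxx // => j _; apply/eqP; rewrite mulf_eq0.
    by apply: contrapT => /negP/norP[? ?]; apply: h2; exists j.
  by apply: contrapT => /negP/norP[? ?]; apply: h1; exists j.
have WF p z : Wp p z -> Wp (p - 2) (ad (F i) z).
  move=> hz k l; rewrite !mxE; case: (pselect (exists j, F i k j != 0 /\ z j l != 0)).
    by move=> [j [/F_weight e2 /hz e1]] _; rewrite e2 !mxE A2 e1; lia.
  move=> h1; case: (pselect (exists j, z k j != 0 /\ F i j l != 0)).
    by move=> [j [/hz e1 /F_weight e2]] _;
       rewrite e1 e2 mxE [(- al i) _ _]mxE simple_rootE A2 addrAC -addrA.
  move=> h2; rewrite !big1 ?subrr ?eqxx // => j _; apply/eqP; rewrite mulf_eq0.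
    by apply: contrapT => /negP/norP[? ?]; apply: h2; exists j.
  by apply: contrapT => /negP/norP[? ?]; apply: h1; exists j.
have WH p z : Wp p z -> ad (E i) (ad (F i) z) - ad (F i) (ad (E i) z) = p%:~R *: z.
  move=> hz; rewrite ad_jacobi EF eqxx addrK; apply/matrixP => k l.
  rewrite /ad mul_diag_mx mul_mx_diag !mxE.
  case: (eqVneq (z k l) 0) => [->|/hz ->]; first by rewrite mulr0 mul0r subrr mulr0.
  by rewrite rmorphD /=; ring.
pose N := (\sum_k absz (w k 0%R i) * 2)%N.
have WN p z : N%:Z < `|p| -> Wp p z -> z = 0.
  move=> hp hz; apply/matrixP => k l; rewrite mxE; apply/eqP; apply: contrapT => /negP /hz e1.
  have wN j : (absz (w j 0%R i) * 2 <= N)%N by rewrite /N (bigD1 j) //= leq_addr.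
  by have := wN k; have := wN l; move: hp e1; rewrite -!abszE; lia.
have Wx : Wp (beta 0 i) x by move=> k l /gx ->; rewrite mxE.
case: s bi0 fx => bi0 fx.
  apply: (@sl2_inj _ _ (ad (E i)) (ad (F i)) Wp N WE WF WH _ (absz (beta 0%R i))).
  - by move=> p z hp; apply: WN; lia.
  - by rewrite gtz0_abs.
  - exact: fx.
apply: (@sl2_inj _ _ (ad (F i)) (ad (E i)) (fun p => Wp (- p)) N _ _ _ _ (absz (beta 0%R i))).
- by move=> p z /WF; rewrite -opprD.
- by move=> p z /WE; rewrite opprB addrC.
- move=> p z /WH e1; apply: oppr_inj; rewrite opprB -scaleNr -rmorphN /= -e1.
  by [].
- by move=> p z hp; apply: WN; lia.
- by rewrite ltz0_abs ?opprK // -oppr_gt0.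
- exact: fx.
Qed.

Lemma ad_inj_weight beta x i (s : bool) : graded beta x ->
  0 < (if s then beta 0 i else - beta 0 i) -> ad ((if s then F else E) i) x = 0 -> x = 0.
Proof.
move=> gx bi0 fx; apply: (ad_inj_iter gx bi0).
have : (0 < absz (beta 0%R i))%N by case: s bi0 {fx}; lia.
case: absz => // p _; rewrite iterSr fx; elim: p => [//|p IH].
by rewrite iterS IH linear0.
Qed.

(** A nonzero vector of the radical can be moved to weight zero, where the
    trace form is positive. *)
Lemma trace_form_nondeg x : x \in L -> (forall y, y \in L -> \tr (x *m y) = 0) -> x = 0.
Proof.
pose Rad x := x \in L /\ (forall y, y \in L -> \tr (x *m y) = 0).
have RadE i z : Rad z -> Rad (ad (E i) z).
  by move=> [h1 h2]; split=> [|y hy]; [exact: L_adE|rewrite tr_ad h2 ?oppr0 // L_adE].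
have RadF i z : Rad z -> Rad (ad (F i) z).
  by move=> [h1 h2]; split=> [|y hy]; [exact: L_adF|rewrite tr_ad h2 ?oppr0 // L_adF].
(* Induction on the sum of the absolute values of the k_b. By [root_pos] some k_i has the same sign
   as the coordinate beta_i; bracketing with F_i or E_i is then injective and lowers the absolute
   value of k_i. *)
have main N (k : 'I_n -> int) z : (\sum_b absz (k b) <= N)%N ->
    Rad z -> graded (\sum_b al b *~ k b) z -> z = 0.
  elim: N k z => [|N IH] k z hk rz gz.
    have k0 b : k b = 0 by apply/eqP; move: hk; rewrite leqn0 sum_nat_eq0 => /forallP/(_ b);
      rewrite /= absz_eq0.
    have gz0 : graded 0 z by rewrite big1 // in gz => b _; rewrite k0 mulr0z.
    have [c zc] := L_graded0 (proj1 rz) gz0.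
    suff c0 : c = 0 by rewrite zc c0 big1 // => i _; rewrite mxE scale0r.
    apply: (row_free_inj (A := KmxK)); first by rewrite row_free_unit unit_KmxK.
    rewrite mul0mx; apply/rowP => j; rewrite -tr_cartan -zc mxE.
    by apply: (proj2 rz); apply: (bs_span (inr j)).
  case: (pselect (exists b, k b != 0)) => [hk1|hk0]; last first.
    apply: (IH k) => //; rewrite big1 // => b _; apply/eqP; rewrite absz_eq0.
    by apply: contrapT => /negP ?; apply: hk0; exists b.
  case: (root_pos hk1) => i; set beta := \sum_b _ in gz * => ki.
  have dec (s : int) : (absz (k i - s)%R < absz (k i))%N ->
      (\sum_b absz (k b - s * (b == i)%:Z)%R <= N)%N.
    move=> h; rewrite -ltnS; apply: leq_trans hk.
    rewrite (bigD1 i) //= [X in (_ < X)%N](bigD1 i) //= eqxx mulr1 -addSn leq_add //.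
    by apply: leq_sum => b /negPf ->; rewrite mulr0 subr0.
  have beta' s : \sum_b al b *~ (k b - s * (b == i)%:Z) = beta - al i *~ s.
    rewrite /beta; under eq_bigr do rewrite mulrzBr; rewrite sumrB; congr (_ - _).
    by rewrite (bigD1 i) //= eqxx mulr1 big1 ?addr0 // => b /negPf ->; rewrite mulr0.
  have [hki|hki] : (0 < k i /\ 0 < beta 0 i) \/ (k i < 0 /\ beta 0 i < 0).
    move: ki; case: (ltrgtP (k i) 0) => k0; last by rewrite k0 mul0r ltxx.
      by rewrite nmulr_rgt0 //; right.
    by rewrite pmulr_rgt0 //; left.
    apply: (@ad_inj_weight _ _ i true gz (proj2 hki)) => /=.
    apply: (IH (fun b => k b - 1 * (b == i)%:Z)); [apply: dec; lia|exact: RadF|].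
    by rewrite beta' addrC -mulrNz; apply: graded_ad => //; apply: F_weight.
  apply: (@ad_inj_weight _ _ i false gz); first by rewrite oppr_gt0 (proj2 hki).
  apply: (IH (fun b => k b - (-1) * (b == i)%:Z)); [apply: dec; lia|exact: RadE|].
  by rewrite beta' mulrNz opprK addrC; apply: graded_ad => //; apply: E_weight.
move=> hx rx; apply/matrixP => k l; rewrite mxE; apply/eqP; apply: contrapT => /negP xkl.
pose beta := w k - w l.
have cx : comp beta x != 0.
  by apply/eqP => /matrixP/(_ k l)/eqP; rewrite !mxE /beta addrC subrK eqxx (negPf xkl).
have rc : Rad (comp beta x).
  by split=> [|y hy]; [exact: comp_L|rewrite tr_comp rx // comp_L].
have [t ht] := comp_gdeg hx cx.
case/eqP: cx; have [k' hk'] : exists k', beta = \sum_b al b *~ k' b.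
  rewrite -ht; case: t {ht} => [[s|s]|i] /=.
  - by exists (fun b => (cnt s b)%:Z); rewrite -wtz.
  - exists (fun b => - (cnt s b)%:Z); rewrite wtz -sumrN.
    by apply: eq_bigr => b _; rewrite mulrNz.
  - by exists (fun b => 0); rewrite big1 // => b _; rewrite mulr0z.
apply: (main _ k' _ (leqnn _) rc); rewrite -hk'; exact: graded_comp.
Qed.

(** * The Casimir operator *)

Let N := size bs.
Let ty (s : 'I_N) := tnth (in_tuple bs) s.
Let B (s : 'I_N) := gen (ty s).
Let deg (s : 'I_N) := gdeg (ty s).
Let X := map_tuple gen (in_tuple bs).

Let XB (s : 'I_N) : X`_s = B s.
Proof. by rewrite -tnth_nth tnth_map. Qed.

Let X_free : free X. Proof. exact: bs_free. Qed.

Lemma L_expand x : x \in L -> x = \sum_s coord X s x *: B s.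
Proof. by move=> hx; rewrite {1}(coord_span (hx : x \in <<X>>%VS)); apply: eq_bigr => s _; rewrite -XB. Qed.

Lemma B_L s : B s \in L. Proof. exact: bs_span. Qed.

Lemma B_graded s : graded (deg s) (B s). Proof. exact: graded_gen. Qed.

Lemma B_neq0 s : B s != 0.
Proof. by apply: (free_not0 X_free); rewrite -XB mem_nth // size_tuple. Qed.

Lemma B_inj s t : B s = B t -> s = t.
Proof.
move=> e; apply/val_inj/eqP; rewrite -(nth_uniq 0 _ _ (free_uniq X_free)) ?size_tuple //.
  by rewrite /= !XB e.
all: exact: ltn_ord.
Qed.

Definition Gram : 'M[K]_N := \matrix_(s, t) \tr (B s *m B t).

Lemma Gram_sym : Gram^T = Gram.
Proof. by apply/matrixP => s t; rewrite !mxE mxtrace_mulC. Qed.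

Lemma Gram_unit : Gram \in unitmx.
Proof.
rewrite unitmxE unitfE; apply/det0P => -[v v0 hv]; case/eqP: v0.
have e : \sum_s v 0 s *: B s = 0.
  apply: trace_form_nondeg => [|y /L_expand ->].
    by rewrite rpred_sum // => s _; rewrite memvZ // B_L.
  rewrite mulmx_sumr raddf_sum /= big1 // => t _; rewrite -scalemxAr mxtraceZ.
  rewrite mulmx_suml raddf_sum /=; move/rowP/(_ t): hv; rewrite !mxE => hv.
  rewrite [X in _ * X](_ : _ = 0) ?mulr0 //; apply: etrans _ hv; apply: eq_bigr => s _.
  by rewrite -scalemxAl mxtraceZ [Gram _ _]mxE.
apply/rowP => s; rewrite mxE; have /freeP h := X_free.
by apply: (h (fun s => v 0 s)); apply: etrans _ e; apply: eq_bigr => t _; rewrite -XB.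
Qed.

Definition Ginv : 'M[K]_N := invmx Gram.

Lemma Ginv_sym s t : Ginv s t = Ginv t s.
Proof. by rewrite -{1}[Ginv]trmxK mxE /Ginv trmx_inv Gram_sym. Qed.

Definition dualB s : 'M[K]_d := \sum_t Ginv s t *: B t.

Lemma tr_dualB s t : \tr (dualB s *m B t) = (s == t)%:R.
Proof.
transitivity ((Ginv *m Gram) s t); last by rewrite mulVmx ?Gram_unit // mxE.
rewrite mulmx_suml raddf_sum mxE /=; apply: eq_bigr => u _.
by rewrite -scalemxAl mxtraceZ mxE.
Qed.

Lemma dualB_L s : dualB s \in L.
Proof. by rewrite rpred_sum // => t _; rewrite memvZ // B_L. Qed.

Definition casimir : 'M[K]_d := \sum_s B s *m dualB s.

Section Invariance.
Variable z : 'M[K]_d.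
Hypothesis zL : forall x, x \in L -> ad z x \in L.
Let Z : 'M[K]_N := \matrix_(s, u) coord X u (ad z (B s)).

Let adB s : ad z (B s) = \sum_u Z s u *: B u.
Proof. by rewrite (L_expand (zL (B_L s))); apply: eq_bigr => u _; rewrite mxE. Qed.

Lemma Ginv_invariant : Z^T *m Ginv + Ginv *m Z = 0.
Proof.
have e : Z *m Gram + Gram *m Z^T = 0.
  apply/matrixP => s t; rewrite !mxE; apply/eqP; rewrite addr_eq0; apply/eqP.
  transitivity (\tr (ad z (B s) *m B t)).
    rewrite adB mulmx_suml raddf_sum /=; apply: eq_bigr => u _.
    by rewrite -scalemxAl mxtraceZ [Gram _ _]mxE.
  rewrite tr_ad adB mulmx_sumr; congr (- _); rewrite raddf_sum /=; apply: eq_bigr => u _.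
  by rewrite -scalemxAr mxtraceZ [Gram _ _]mxE [Z^T _ _]mxE mulrC.
have := congr1 (fun M => Ginv *m M *m Ginv) e.
rewrite /= mulmx0 mul0mx mulmxDr mulmxDl => <-; rewrite addrC; congr (_ + _).
  by rewrite mulmxA -[RHS]mulmxA mulmxV ?Gram_unit // mulmx1.
by rewrite mulmxA mulVmx ?Gram_unit // mul1mx.
Qed.

(** By [tr_ad] the trace form is invariant under [ad z]. Carried over to the inverse Gram matrix
    this becomes [Ginv_invariant], the invariance of the tensor whose image under multiplication is
    the Casimir operator. *)
Lemma ad_casimir : ad z casimir = 0.
Proof.
pose P (M : 'M[K]_N) := \sum_s \sum_t M s t *: (B s *m B t).
have PD M M' : P M + P M' = P (M + M').
  rewrite -big_split; apply: eq_bigr => s _; rewrite -big_split; apply: eq_bigr => t _.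
  by rewrite mxE scalerDl.
have -> : ad z casimir = P (Z^T *m Ginv) + P (Ginv *m Z).
  rewrite linear_sum /=.
  transitivity (\sum_s (ad z (B s) *m dualB s + B s *m ad z (dualB s))).
    by apply: eq_bigr => s _; rewrite adM.
  rewrite big_split /=; congr (_ + _).
    rewrite /P (eq_bigr (fun s => \sum_u \sum_t (Z s u * Ginv s t) *: (B u *m B t))); last first.
      move=> s _; rewrite adB mulmx_suml; apply: eq_bigr => u _.
      rewrite mulmx_sumr; apply: eq_bigr => t _.
      by rewrite -scalemxAl -scalemxAr scalerA.
    rewrite exchange_big /=; apply: eq_bigr => u _; rewrite exchange_big /=.
    apply: eq_bigr => t _; rewrite -scaler_suml mxE; congr (_ *: _).
    by apply: eq_bigr => s _; rewrite [Z^T _ _]mxE.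
  apply: eq_bigr => s _; rewrite linear_sum mulmx_sumr /=.
  rewrite (eq_bigr (fun t => \sum_u (Ginv s t * Z t u) *: (B s *m B u))); last first.
    move=> t _; rewrite linearZ /= adB -scalemxAr mulmx_sumr scaler_sumr.
    by apply: eq_bigr => u _; rewrite -scalemxAr scalerA.
  rewrite exchange_big /=; apply: eq_bigr => u _.
  by rewrite -scaler_suml mxE.
rewrite PD Ginv_invariant /P big1 // => s _; rewrite big1 // => t _.
by rewrite mxE scale0r.
Qed.

End Invariance.

Lemma L_adH i x : x \in L -> ad (Hmx i) x \in L.
Proof. by move=> hx; apply: L_ad => //; apply: (bs_span (inr i)). Qed.

(** Invariance under [ad (Hmx j)] multiplies the entry of [Ginv] at (s, t) by the coordinate j of
    deg s + deg t and gives 0. *)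
Lemma Ginv_deg s t : Ginv s t != 0 -> deg s + deg t = 0.
Proof.
move=> g0; apply/rowP => j.
have := congr1 (fun M : 'M[K]_N => M s t) (Ginv_invariant (fun x hx => @L_adH j x hx)).
have Zd u v : coord X v (ad (Hmx j) (B u)) = (deg u 0 j)%:~R *+ (u == v).
  by rewrite (ad_H _ (@B_graded u)) linearZ /= -XB coord_free // eq_sym mulr_natr.
rewrite !mxE (bigD1 s) //= [X in _ + X](bigD1 t) //= !mxE !Zd !eqxx !mulr1n.
rewrite !big1 ?addr0 => [|u /negPf us|u /negPf ut]; last 2 first.
- by rewrite !mxE Zd us mulr0.
- by rewrite !mxE Zd ut mul0r.
rewrite mulrC -mulrDr => /eqP; rewrite mulf_eq0 (negPf g0) -rmorphD intr_eq0 => /eqP.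
by [].
Qed.

Lemma dualB_graded s : graded (- deg s) (dualB s).
Proof.
rewrite /dualB; elim/big_rec: _ => [|t x _ hx]; first exact: graded0.
apply: gradedD => //; case: (eqVneq (Ginv s t) 0) => [->|/Ginv_deg].
  by rewrite scale0r; apply: graded0.
rewrite addrC => /eqP; rewrite addr_eq0 => /eqP <-.
by apply: gradedZ; apply: B_graded.
Qed.

Definition isE (t : seq 'I_n + seq 'I_n + 'I_n) := if t is inl (inl _) then true else false.
Definition isH (t : seq 'I_n + seq 'I_n + 'I_n) := if t is inr _ then true else false.
Definition kx (t : seq 'I_n + seq 'I_n + 'I_n) : mindex n :=
  match t with inl (inl s) => cnt s | inl (inr s) => cnt s | inr i => 0 end.
Let pos s := isE (ty s).

Lemma kx_neq0 s : ~~ isH (ty s) -> kx (ty s) != 0.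
Proof.
move=> h; apply/eqP => e; have := B_neq0 s; rewrite /B; move: h e.
by case: (ty s) => [[t|t]|i] //= _ /cnt_eq0 ->; rewrite eqxx.
Qed.

Lemma degE s : deg s = if isE (ty s) then rt (kx (ty s)) else
  if isH (ty s) then 0 else - rt (kx (ty s)).
Proof. by rewrite /deg; case: (ty s) => [[]|]. Qed.

Lemma Ginv_type s t : Ginv s t != 0 ->
  (isH (ty s) = isH (ty t)) /\ (~~ isH (ty s) -> isE (ty s) = ~~ isE (ty t)).
Proof.
move/Ginv_deg; rewrite !degE.
have ks := @kx_neq0 s; have kt := @kx_neq0 t.
have EH (u : seq 'I_n + seq 'I_n + 'I_n) : isE u -> isH u = false by case: u.
case Es : (isE (ty s)) ks; rewrite ?(EH _ Es).
  move=> /(_ isT) ks; case Et : (isE (ty t)) kt; rewrite ?(EH _ Et).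
    move=> _; rewrite -wtD => /rt_free/ffunP h; case/eqP: ks; apply/ffunP => b.
    by have := h b; rewrite mindexD !mindex0 => /eqP; rewrite addn_eq0 => /andP[/eqP].
  case: (isH (ty t)) => // _; rewrite addr0 => /rt_free.
  by move/eqP: ks.
case Hs : (isH (ty s)) => ks.
  case Et : (isE (ty t)) kt; rewrite ?(EH _ Et) add0r.
    by move=> /(_ isT) /eqP kt /rt_free.
  by case: (isH (ty t)) => // /(_ isT) /eqP kt /eqP; rewrite oppr_eq0 => /eqP/rt_free.
have {}ks := ks isT; case Et : (isE (ty t)) kt; rewrite ?(EH _ Et) // => kt.
case Ht : (isH (ty t)) kt => kt.
  by rewrite addr0 => /eqP; rewrite oppr_eq0 => /eqP/rt_free/eqP; rewrite (negPf ks).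
rewrite -opprD -wtD => /eqP; rewrite oppr_eq0 => /eqP/rt_free/ffunP h; case/eqP: ks.
apply/ffunP => b.
by have := h b; rewrite mindexD !mindex0 => /eqP; rewrite addn_eq0 => /andP[/eqP].
Qed.

(** [Ginv] pairs only opposite degrees, so expanding the dual vectors of the negative basis elements
    and exchanging the sums produces the products in reversed order, indexed by the positive
    ones. *)
Lemma casimir_split : casimir = \sum_(s | isH (ty s)) B s *m dualB s
  + \sum_(s | pos s) (B s *m dualB s + dualB s *m B s).
Proof.
rewrite /casimir (bigID (fun s => isH (ty s))) /=; congr (_ + _).
rewrite (bigID pos) big_split /=; congr (_ + _).
  apply: eq_bigl => s; rewrite /pos.
  by case: (ty s) => [[]|].
transitivity (\sum_(s | ~~ isH (ty s) && ~~ pos s) \sum_(t | pos t) Ginv s t *: (B s *m B t)).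
  apply: eq_bigr => s /andP[hs ps]; rewrite /dualB mulmx_sumr [LHS](bigID pos) /=.
  rewrite [X in _ + X]big1 ?addr0 => [|t pt].
    by apply: eq_bigr => t _; rewrite -scalemxAr.
  case: (eqVneq (Ginv s t) 0) => [->|/Ginv_type[_ /(_ hs)]]; first by rewrite scale0r mulmx0.
  by move: ps pt; rewrite /pos => /negPf -> /negPf ->.
rewrite exchange_big /=; apply: eq_bigr => t pt.
rewrite /dualB mulmx_suml [RHS](bigID (fun s => ~~ isH (ty s) && ~~ pos s)) /=.
rewrite [X in _ = _ + X]big1 ?addr0 => [|s hs].
  by apply: eq_bigr => s _; rewrite -scalemxAl Ginv_sym.
case: (eqVneq (Ginv t s) 0) => [->|/Ginv_type[h1 h2]]; first by rewrite scale0r mul0mx.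
have ht : isH (ty t) = false by move: pt; rewrite /pos; case: (ty t) => [[]|].
by move: hs (h2 (negbT ht)) pt; rewrite /pos -h1 ht /= negbK => -> ->.
Qed.

Definition wproj (mu : 'rV[int]_n) : 'M[K]_d := diag_mx (\row_k (w k == mu)%:R).
Definition mult (mu : 'rV[int]_n) : nat := #|[pred k | w k == mu]|.

Lemma tr_wproj mu : \tr (wproj mu) = (mult mu)%:R.
Proof.
rewrite mxtrace_diag /mult -sum1_card natr_sum [RHS]big_mkcond /=.
by apply: eq_bigr => k _; rewrite mxE inE; case: eqP.
Qed.

Lemma wproj_graded beta x mu : graded beta x -> wproj mu *m x = x *m wproj (mu - beta).
Proof.
move=> hx; apply/matrixP => k l; rewrite mul_diag_mx mul_mx_diag !mxE.
case: (eqVneq (x k l) 0) => [->|/hx ->]; first by rewrite mulr0 mul0r.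
by rewrite mulrC (can2_eq (addrK beta) (subrK beta)).
Qed.

Lemma wproj_H mu i : wproj mu *m Hmx i = (mu 0 i)%:~R *: wproj mu.
Proof.
rewrite mulmx_diag; apply/matrixP => k l; rewrite !mxE mulrnAr; congr (_ *+ _).
by case: eqP => [->|]; rewrite ?mulr1 ?mul1r // mulr0 mul0r.
Qed.

(** The form on weights dual to the trace form. *)
Definition wform (mu nu : 'rV[int]_n) : rat :=
  (map_mx intr mu *m invmx Kmx *m (map_mx intr nu)^T) 0 0.

Definition cartan_of (mu : 'rV[int]_n) : 'M[K]_d :=
  \sum_i ((map_mx intr mu : 'rV[K]_n) *m invmx KmxK) 0 i *: Hmx i.

Lemma tr_cartan_of mu j : \tr (cartan_of mu *m Hmx j) = (mu 0 j)%:~R.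
Proof. by rewrite /cartan_of tr_cartan mulmxKV ?unit_KmxK // mxE. Qed.

Lemma cartan_of_unique x (mu : 'rV[int]_n) : x \in L -> graded 0 x ->
  (forall j, \tr (x *m Hmx j) = (mu 0 j)%:~R) -> x = cartan_of mu.
Proof.
move=> hx gx hj; have [c e] := L_graded0 hx gx; rewrite e /cartan_of.
have -> : map_mx intr mu = c *m KmxK.
  by apply/rowP => j; rewrite mxE -hj e tr_cartan.
by rewrite mulmxK ?unit_KmxK.
Qed.

Lemma wform_sum mu nu : ratr (wform mu nu) =
  \sum_i ((map_mx intr mu : 'rV[K]_n) *m invmx KmxK) 0 i * (nu 0 i)%:~R.
Proof.
rewrite /wform mxE rmorph_sum /=; apply: eq_bigr => i _; rewrite rmorphM /= !mxE ratr_int.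
congr (_ * _); rewrite rmorph_sum /=; apply: eq_bigr => j _.
by rewrite rmorphM /= !mxE ratr_int -map_invmx mxE.
Qed.

Lemma tr_wproj_cartan mu nu : \tr (wproj nu *m cartan_of mu) = ratr (wform mu nu) * (mult nu)%:R.
Proof.
rewrite /cartan_of mulmx_sumr raddf_sum /= wform_sum mulr_suml; apply: eq_bigr => i _.
by rewrite -scalemxAr mxtraceZ wproj_H mxtraceZ tr_wproj mulrA.
Qed.

(** For a positive root beta this is Freudenthal's inner sum, over j >= 0, of (beta, mu + j beta)
    times the multiplicity of mu + j beta. It is characterized by a difference equation and its
    vanishing off the weights, without being summed. *)
Definition Ucoef s mu : K := \tr (wproj mu *m B s *m dualB s).

Lemma tr_dualB_B s mu : \tr (wproj mu *m (dualB s *m B s)) = Ucoef s (mu + deg s).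
Proof.
rewrite mulmxA (wproj_graded _ (@dualB_graded s)) opprK -mulmxA mxtrace_mulC.
by rewrite /Ucoef.
Qed.

(** Cyclicity of the trace reduces the difference to the commutator of [B s] with its dual vector,
    which is the Cartan element dual to [deg s] under the trace form. *)
Lemma Ucoef_diff s mu :
  Ucoef s mu - Ucoef s (mu + deg s) = ratr (wform (deg s) mu) * (mult mu)%:R.
Proof.
rewrite -tr_dualB_B /Ucoef -mulmxA -raddfB /= -mulmxBr -/(ad (B s) (dualB s)).
rewrite (@cartan_of_unique (ad (B s) (dualB s)) (deg s)) ?tr_wproj_cartan //.
- by apply: L_ad; rewrite ?B_L ?dualB_L.
- by rewrite -(subrr (deg s)); apply: graded_ad; [exact: B_graded|exact: dualB_graded].
move=> j; rewrite tr_ad adC (ad_H _ (@B_graded s)) mulmxN raddfN opprK /=.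
by rewrite -scalemxAr mxtraceZ tr_dualB eqxx mulr1.
Qed.

Lemma tr_casimir_cartan mu :
  \tr (wproj mu *m \sum_(s | isH (ty s)) B s *m dualB s) = ratr (wform mu mu) * (mult mu)%:R.
Proof.
pose h := cartan_of mu; pose a := \row_s coord X s h.
have hL : h \in L.
  by rewrite rpred_sum // => i _; rewrite memvZ //; apply: (bs_span (inr i)).
have gh : graded 0 h.
  rewrite /h /cartan_of; elim/big_rec: _ => [|i x _ hx]; first exact: graded0.
  by apply: gradedD => //; apply/gradedZ/graded_H.
have hB t : \tr (h *m B t) = (a *m Gram) 0 t.
  rewrite {1}(L_expand hL) mulmx_suml raddf_sum mxE /=; apply: eq_bigr => s _.
  by rewrite -scalemxAl mxtraceZ [Gram _ _]mxE [a _ _]mxE.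
have hB0 t : ~~ isH (ty t) -> \tr (h *m B t) = 0.
  move=> ht; apply: (graded_tr (beta := deg t)).
    by rewrite -[deg t]add0r; apply: graded_mul => //; apply: B_graded.
  have := kx_neq0 ht; rewrite degE (negPf ht).
  by case: ifP => _; rewrite ?oppr_eq0 => k1; apply: contra_neq k1; apply: rt_free.
have BH t : isH (ty t) -> exists i, B t = Hmx i by rewrite /B; case: (ty t) => // i _; exists i.
have tHH s t : isH (ty s) -> isH (ty t) ->
    \tr (wproj mu *m (B s *m B t)) = \tr (h *m B s) * \tr (h *m B t) * (mult mu)%:R.
  move=> /BH[i ->] /BH[j ->]; rewrite !tr_cartan_of mulmxA wproj_H -scalemxAl wproj_H.
  by rewrite !mxtraceZ tr_wproj mulrA.
transitivity (\sum_s \sum_t Ginv s t * (\tr (h *m B s) * \tr (h *m B t)) * (mult mu)%:R).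
  rewrite mulmx_sumr raddf_sum /= [RHS](bigID (fun s => isH (ty s))) /=.
  rewrite [X in _ = _ + X]big1 ?addr0 => [|s hs]; last first.
    by rewrite big1 // => t _; rewrite (hB0 _ hs) mul0r mulr0 mul0r.
  apply: eq_bigr => s hs; rewrite /dualB !mulmx_sumr raddf_sum /=; apply: eq_bigr => t _.
  rewrite -!scalemxAr mxtraceZ -mulrA; case: (eqVneq (Ginv s t) 0) => [->|/Ginv_type[ht _]].
    by rewrite !mul0r.
  by rewrite tHH // -ht.
under eq_bigr => s _ do rewrite -mulr_suml.
rewrite -mulr_suml; congr (_ * _).
transitivity ((a *m Gram *m Ginv *m (a *m Gram)^T) 0 0).
  rewrite mxE exchange_big /=; apply: eq_bigr => t _; rewrite mxE mulr_suml.
  apply: eq_bigr => s _; rewrite !hB [((a *m Gram)^T) _ _]mxE.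
  by ring.
rewrite mulmxK ?Gram_unit //.
transitivity (\tr (h *m h)).
  rewrite {2}(L_expand hL) mulmx_sumr raddf_sum mxE /=; apply: eq_bigr => t _.
  by rewrite -scalemxAr mxtraceZ hB [a _ _]mxE [((a *m Gram)^T) _ _]mxE.
rewrite {2}/h /cartan_of mulmx_sumr raddf_sum wform_sum /=; apply: eq_bigr => i _.
by rewrite -scalemxAr mxtraceZ tr_cartan_of.
Qed.

Variable k0 : 'I_d.
Hypothesis k0_uniq : forall k, k != k0 -> w k != w k0.
Hypothesis F_gen : forall l, exists s : seq 'I_n,
  delta_mx l 0 = foldr (fun i v => F i *m v) (delta_mx k0 0 : 'cV[K]_d) s.

(** The operator preserves weights, so it has the vector at [k0], alone in its weight, as an
    eigenvector. It commutes with the lowering operators, which generate everything from that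
    vector. *)
Lemma casimir_scalar : exists c, casimir = c%:M.
Proof.
have comm x : x \in L -> casimir *m x = x *m casimir.
  move=> hx; have := ad_casimir (fun y hy => L_ad hx hy).
  by rewrite /ad => /eqP; rewrite subr_eq0 => /eqP.
have gc : graded 0 casimir.
  rewrite /casimir; elim/big_rec: _ => [|s x _ hx]; first exact: graded0.
  apply: gradedD => //; rewrite -(subrr (deg s)); apply: graded_mul; first exact: B_graded.
  exact: dualB_graded.
exists (casimir k0 k0).
have c0 : casimir *m delta_mx k0 0 = casimir k0 k0 *: (delta_mx k0 0 : 'cV[K]_d).
  rewrite -colE; apply/colP => k; rewrite !mxE eqxx andbT.
  case: (eqVneq k k0) => [->|hk]; first by rewrite mulr1.
  rewrite mulr0; apply/eqP; apply: contrapT => /negP /gc; rewrite addr0 => /eqP.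
  by rewrite (negPf (k0_uniq hk)).
have FL i : F i \in L by apply: (bs_span (inl (inr [:: i]))).
have cl l : casimir *m delta_mx l 0 = casimir k0 k0 *: (delta_mx l 0 : 'cV[K]_d).
  have [s ->] := F_gen l; elim: s => [//|i s IH] /=.
  by rewrite mulmxA (comm _ (FL i)) -mulmxA IH scalemxAr.
apply/matrixP => k l; have /colP/(_ k) := cl l; rewrite -colE !mxE eqxx andbT => ->.
by rewrite mulr_natr eq_sym.
Qed.

(** The trace of the Casimir operator on one weight space, computed from its scalar value and from
    [casimir_split]. *)
Theorem freudenthal : exists c : K, forall mu, c * (mult mu)%:R =
  ratr (wform mu mu) * (mult mu)%:R
  + \sum_(s | isE (ty s)) (Ucoef s mu + Ucoef s (mu + rt (kx (ty s)))).
Proof.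
have [c hc] := casimir_scalar; exists c => mu.
transitivity (\tr (wproj mu *m casimir)).
  by rewrite hc mul_mx_scalar mxtraceZ tr_wproj.
rewrite casimir_split mulmxDr mxtraceD tr_casimir_cartan; congr (_ + _).
rewrite mulmx_sumr raddf_sum /=; apply: eq_bigr => s ps.
rewrite mulmxDr mxtraceD /Ucoef mulmxA; congr (_ + _).
by rewrite tr_dualB_B degE; move: ps; rewrite /pos => ->.
Qed.

Lemma Ucoef_root s mu : isE (ty s) ->
  Ucoef s mu - Ucoef s (mu + rt (kx (ty s))) = ratr (wform (rt (kx (ty s))) mu) * (mult mu)%:R.
Proof. by move=> ps; have := Ucoef_diff s mu; rewrite degE ps. Qed.

Lemma Ucoef_mult0 s mu : mult mu = 0%N -> Ucoef s mu = 0.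
Proof.
move=> m0; suff -> : Ucoef s mu = 0 by [].
rewrite /Ucoef; have -> : wproj mu = 0; last by rewrite !mul0mx mxtrace0.
apply/matrixP => k l; rewrite !mxE; have /card0_eq/(_ k) := m0.
by rewrite inE => ->; rewrite mul0rn.
Qed.

(** * Roots *)

Definition rootspace beta := (linfun (comp beta) @: L)%VS.

Lemma mem_rootspace beta x : (x \in rootspace beta) <-> (x \in L /\ graded beta x).
Proof.
split=> [/memv_imgP[y hy ->]|[hx gx]].
  by rewrite lfunE /=; split; [exact: comp_L|exact: graded_comp].
by apply/memv_imgP; exists x; rewrite ?lfunE //= (comp_graded _ gx) eqxx.
Qed.

Lemma dim_rootspace beta : \dim (rootspace beta) = #|[pred s | deg s == beta]|.
Proof.
have -> : rootspace beta = <<[seq B s | s <- enum [pred s | deg s == beta]]>>%VS.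
  apply/eqP; rewrite eqEsubv; apply/andP; split.
    rewrite /rootspace limg_span; apply/span_subvP => _ /mapP[x /mapP[t ht ->] ->].
    rewrite lfunE /= (comp_graded _ (graded_gen (t := t))).
    case: eqP => [e|_]; last by rewrite mem0v.
    have /(tnthP (in_tuple bs))[s es] := ht.
    rewrite memv_span //; apply/mapP; exists s; last by rewrite es.
    by rewrite mem_enum inE /deg /ty -es e.
  apply/span_subvP => _ /mapP[s + ->]; rewrite mem_enum inE => /eqP e.
  by apply/mem_rootspace; split; [exact: B_L|rewrite -e; apply: B_graded].
have fr : free [seq B s | s <- enum [pred s | deg s == beta]].
  set Y := map _ _; have pY : perm_eq [seq x <- X | x \in Y] Y.
    apply: uniq_perm; first by rewrite filter_uniq ?free_uniq.
      by rewrite map_inj_uniq ?enum_uniq // => s t /B_inj.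
    move=> x; rewrite mem_filter /=; apply: andb_idr => /mapP[s _ ->].
    by rewrite -XB mem_nth // size_tuple.
  by rewrite -(perm_free pY) filter_free.
by rewrite (eqnP fr) size_map cardE.
Qed.

Definition nroot beta : nat := #|[pred s | deg s == beta]|.

Lemma rootspace_refl_le i beta :
  (\dim (rootspace beta) <= \dim (rootspace (refl A i beta)))%N.
Proof.
case: (eqVneq (beta 0 i) 0) => [b0|b0]; first by rewrite /refl b0 mulr0z subr0.
pose s := 0 < beta 0 i; pose Z := (if s then F else E) i.
pose m := absz (beta 0%R i).
have bs0 : 0 < (if s then beta 0 i else - beta 0 i).
  by rewrite /s; case: ifP => //; move: b0; lia.
pose phi := lfun_iter (linfun (ad Z)) m.
have phiE x : phi x = iter m (ad Z) x.
  by rewrite /phi lfun_iterE; apply: eq_iter => y; rewrite lfunE.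
apply: (@injective_dim_le _ _ _ phi) => x /mem_rootspace[hx gx]; rewrite phiE; last first.
  exact: (ad_inj_iter gx bs0).
apply/mem_rootspace; split.
  have LZ y : y \in L -> ad Z y \in L.
    by rewrite /Z; case: (s) => hy; [apply: L_adF|apply: L_adE].
  by elim: (m) => [//|p IH] /=; apply: LZ.
have -> : refl A i beta = beta - al i *~ (if s then m%:Z else - m%:Z).
  by rewrite /refl /m /s; case: ifP => h; congr (_ - _ *~ _); move: h; lia.
elim: (m) => [|p IH].
  by rewrite /= oppr0 if_same mulr0z subr0.
rewrite [iter _ _ _]/=.
have -> : beta - al i *~ (if s then p.+1%:Z else - p.+1%:Z)
   = (if s then - al i else al i) + (beta - al i *~ (if s then p%:Z else - p%:Z)).
  case: (s); rewrite addrCA; congr (_ + _).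
    by rewrite -opprD intS mulrzDr mulr1z.
  by rewrite !mulrNz !opprK intS mulrzDr mulr1z.
by apply: graded_ad => //; rewrite /Z; case: (s); [apply: F_weight|apply: E_weight].
Qed.

Lemma nroot_refl i beta : nroot (refl A i beta) = nroot beta.
Proof.
apply/eqP; rewrite eqn_leq /nroot -!dim_rootspace.
by rewrite -{2}[beta](reflK A2 i) !rootspace_refl_le.
Qed.

(** One entry for each basis vector of positive degree, so positive roots are listed with
    multiplicity. *)
Definition roots : seq (mindex n) := [seq kx (ty s) | s <- enum 'I_N & isE (ty s)].

Lemma rt_inj : injective (fun k : mindex n => rt k).
Proof.
move=> k l /eqP; rewrite -subr_eq0 !wtz -sumrB => /eqP h.
apply/ffunP => b; have := @root_free (fun b => (k b)%:Z - (l b)%:Z) _ b.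
rewrite (_ : \sum_b _ = 0) => [/(_ erefl) e1|]; first by apply/eqP; rewrite -eqz_nat -subr_eq0 e1.
by apply: etrans _ h; apply: eq_bigr => c _; rewrite mulrzBr.
Qed.

Lemma deg_pos s k : k != 0 -> (deg s == rt k) = isE (ty s) && (kx (ty s) == k).
Proof.
move=> kz; rewrite degE; case: ifP => hE; first exact: (inj_eq rt_inj).
apply/negbTE/eqP; case: ifP => hH; first by move/esym/rt_free; apply/eqP.
move/eqP; rewrite -subr_eq0 -opprD oppr_eq0 -wtD => /eqP/rt_free/ffunP h.
case/eqP: kz; apply/ffunP => b.
by have := h b; rewrite mindexD !mindex0 => /eqP; rewrite addn_eq0 => /andP[_ /eqP].
Qed.

Lemma count_roots k : k != 0 -> count_mem k roots = nroot (rt k).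
Proof.
move=> kz; rewrite /roots count_map count_filter /nroot -sum1_count -sum1_card big_enum_cond /=.
by apply: eq_bigl => s /=; rewrite inE /= (deg_pos _ kz) andbC.
Qed.

Lemma roots_neq0 k : k \in roots -> k != 0.
Proof.
case/mapP => s; rewrite mem_filter => /andP[h _] ->; apply: kx_neq0.
by move: h; case: (ty s) => [[]|].
Qed.

Lemma nroot_simple i : nroot (al i) = 1%N.
Proof.
rewrite /nroot; have e i' : rt (idelta i' 1) = al i' by rewrite wt_idelta mulr1n.
have i0 : idelta i 1 != 0 by exact: idelta_neq0.
have h s : deg s == al i -> B s = E i.
  rewrite -e deg_pos // /B; case: (ty s) => [[[|j u]|]|] //=; first by move: i0; rewrite /cnt big_nil eq_sym => /negPf ->.
  move/eqP => hc; have u0 : u = [::].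
    apply: cnt_eq0; apply/ffunP => b; move/ffunP: hc => hc; rewrite mindex0.
    have := hc j; have := hc b; rewrite cnt_cons !mindexD !ffunE !eqxx.
    by case: (j =P i) => [<-|_]; move: (cnt u b) => c; case: (b == _) => /=; lia.
  move/ffunP/(_ j): hc; rewrite u0 cnt_cons /cnt big_nil addr0 !ffunE eqxx.
  by case: eqP => // ->.
have [s hs] : exists s, deg s == al i.
  have : E i \in rootspace (al i).
    by apply/mem_rootspace; split; [apply: (bs_span (inl (inl [:: i])))|apply: E_weight].
  case: (pickP [pred s | deg s == al i]) => [s hs _|p0]; first by exists s.
  have : \dim (rootspace (al i)) = 0%N by rewrite dim_rootspace eq_card0.
  by move/eqP; rewrite dimv_eq0 => /eqP ->; rewrite memv0 (negPf (E_neq0 i)).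
transitivity #|pred1 s|; last exact: card1.
apply: eq_card => t; rewrite !inE.
apply/idP/eqP => [ht|->//]; apply: B_inj.
by rewrite (h _ hs) (h _ ht).
Qed.

(** A bracket word of this content uses only the letter [i], so it begins from [E_i, E_i] = 0. *)
Lemma roots_multiple i m : idelta i m.+2 \notin roots.
Proof.
apply/negP => /mapP[s]; rewrite mem_filter => /andP[h _].
have := B_neq0 s; rewrite /B; case: (ty s) h => [[u|]|] //= _ + hc.
have hu : all (pred1 i) u.
  elim: u (m.+2) hc => [//|j u IH] p; rewrite cnt_cons => /ffunP hc /=.
  have ji : j = i.
    by have := hc j; rewrite mindexD !ffunE eqxx; case: (j =P i) => // _; lia.
  rewrite ji eqxx /=; apply: (IH p.-1); apply/ffunP => b.
  have := hc b; rewrite ji mindexD !ffunE.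
  by move: (cnt u b) => c; case: (b == i) => /=; lia.
have su : (1 < size u)%N.
  case: u hc {hu} => [|j [|j' u]] // /ffunP/(_ i); rewrite ?cnt_cons /cnt ?big_nil ?mindexD !ffunE eqxx;
   rewrite ?mul1n //; case: eqP => _ /=; lia.
case/eqP; case/all_pred1P: hu su => ->; rewrite size_nseq.
case: (size u) => [|[|p]] // _; elim: p => [|p IH].
  by rewrite /= /ad subrr.
by rewrite [nseq _ _]/= br_cons // -/(nseq _ _) IH linear0.
Qed.

Definition roots' i := [seq rt k | k <- roots & k != idelta i 1].

(** A reflection changes only the coefficient of alpha_i. If it made a positive root negative, all
    other coefficients would be 0, and the root would be a multiple of alpha_i, hence alpha_i by
    [roots_multiple]. *)
Lemma count_roots' i beta : beta \in roots' i ->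
  count_mem beta (roots' i) = nroot beta /\ refl A i beta \in roots' i.
Proof.
case/mapP => k; rewrite mem_filter => /andP[ki kr] ->; have kz := roots_neq0 kr.
split.
  rewrite -count_roots // /roots' count_map count_filter; apply: eq_count => l /=.
  rewrite (inj_eq rt_inj); case: (eqVneq l k) => [->|//].
  by rewrite ki.
have : (0 < nroot (refl A i (rt k)))%N.
  by rewrite nroot_refl -count_roots // -has_count has_pred1.
case/card_gt0P => s; rewrite inE => /eqP hs.
have hk : refl A i (rt k) + al i *~ (rt k) 0 i = rt k by rewrite /refl subrK.
move: hs; rewrite degE; case: ifP => hE.
  move=> e; rewrite -e; apply/mapP; exists (kx (ty s)) => //; rewrite mem_filter.
  apply/andP; split; last by apply/mapP; exists s => //; rewrite mem_filter hE mem_enum.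
  apply/eqP => e'; move: e; rewrite e' wt_idelta mulr1n => /(congr1 (refl A i)).
  rewrite reflK // refl_alpha // => /esym/eqP; rewrite -addr_eq0 -(mulr1n (al i)) -[1%N]/(1 * 1)%N.
  rewrite -(wt_idelta (simple_root A) i 1) -wtD => /eqP/rt_free/ffunP/(_ i).
  by rewrite mindexD !ffunE eqxx addn1.
have e0 k' : refl A i (rt k) = - rt k' -> False.
  move=> e; move: hk; rewrite e => /eqP; rewrite -subr_eq0 => /eqP h.
  have hb b : (b == i)%:Z * (rt k) 0 i - (k' b)%:Z - (k b)%:Z = 0.
    apply: (@root_free (fun b => (b == i)%:Z * (rt k) 0 i - (k' b)%:Z - (k b)%:Z)).
    apply: etrans _ h; under eq_bigr do rewrite !mulrzBr.
    rewrite !sumrB -!wtz (bigD1 i) //= eqxx mul1r big1 ?addr0 => [|c /negPf ->].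
      by rewrite [in RHS](addrC (- _)).
    by rewrite mul0r mulr0z.
  have ke : k = idelta i (k i).
    apply/ffunP => b; rewrite !ffunE; have := hb b.
    by rewrite eq_sym; case: eqP => [<-|_]; rewrite ?mul1n ?mul0n //; lia.
  case ek : (k i) => [|[|m]].
  - by case/eqP: kz; rewrite ke ek; apply/ffunP => b; rewrite !ffunE; case: ifP.
  - by move: ki; rewrite ke ek eqxx.
  - by have := roots_multiple i m; rewrite -ek -ke kr.
by case: ifP => hH /esym h; exfalso; [apply: (e0 0); rewrite wt0 oppr0|apply: e0 h].
Qed.

Lemma roots_refl i : perm_eq (roots' i) [seq refl A i beta | beta <- roots' i].
Proof.
have cm beta : count_mem beta [seq refl A i b | b <- roots' i] = count_mem (refl A i beta) (roots' i).
  rewrite count_map; apply: eq_count => b /=.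
  by rewrite (can2_eq (reflK A2 i) (reflK A2 i)).
apply/allP => beta _; rewrite /= cm.
case: (boolP (beta \in roots' i)) => [h|h].
  have [-> h'] := count_roots' h; have [-> _] := count_roots' h'.
  by rewrite nroot_refl.
rewrite (count_memPn h); case: (boolP (refl A i beta \in roots' i)) => [h'|/count_memPn -> //].
by have [_] := count_roots' h'; rewrite reflK // (negPf h).
Qed.

Lemma count_simple i : count_mem (idelta i 1) roots = 1%N.
Proof. by rewrite count_roots ?idelta_neq0 // wt_idelta mulr1n nroot_simple. Qed.

(** The positive roots other than alpha_i are permuted by the reflection [i], so coordinate [i] of
    their sum is 0; alpha_i itself adds 2. *)
Lemma sum_roots : \sum_(k <- roots) rt k = \row_i 2.
Proof.
apply/rowP => i; rewrite mxE.
rewrite (bigID (pred1 (idelta i 1))) /= mxE.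
have -> : \sum_(k <- roots | k == idelta i 1) rt k = al i.
  rewrite (eq_bigr (fun=> al i)); last by move=> k /eqP ->; rewrite wt_idelta mulr1n.
  by rewrite big_const_seq count_simple /= addr0.
rewrite simple_rootE A2 -[RHS]addr0; congr (_ + _).
have h : \sum_(k <- roots | k != idelta i 1) rt k = \sum_(b <- roots' i) b.
  by rewrite [RHS]big_map [RHS]big_filter.
have refl_sum (l : seq 'rV[int]_n) : refl A i (\sum_(b <- l) b) = \sum_(b <- map (refl A i) l) b.
  elim: l => [|b l IH] /=; last by rewrite !big_cons reflD IH.
  by rewrite !big_nil; apply/rowP => b; rewrite reflE !mxE mulr0 subr0.
have := refl_sum (roots' i); rewrite h -(perm_big _ (roots_refl i)) /=.
by move: (\sum_(b <- roots' i) b) => S /rowP/(_ i); rewrite reflE A2; lia.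
Qed.

(** Invariance of the trace gives tr(H_i H_j) = tr([E_i, F_i] H_j) = A_ji tr(E_i F_i); j = i
    eliminates the last trace. *)
Lemma Kmx_cartan i j : Kmx i j = Kmx i i / 2 * (A j i)%:~R.
Proof.
have h j' : ratr (Kmx i j') = (A j' i)%:~R * \tr (E i *m F i) :> K.
  have -> : ratr (Kmx i j') = \tr (Hmx i *m Hmx j') by rewrite tr_HH [KmxK _ _]mxE.
  have := EF i i; rewrite eqxx => <-.
  rewrite tr_ad adC mulmxN raddfN opprK /=.
  by rewrite (ad_H j' (@E_weight i)) -scalemxAr mxtraceZ simple_rootE mxtrace_mulC.
have ratr_inj : injective (ratr : rat -> K) by exact: fmorph_inj.
apply: ratr_inj; transitivity (ratr (Kmx i i) / 2 * (A j i)%:~R : K).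
  by rewrite (h j) (h i) A2; field.
rewrite [RHS]rmorphM /= ratr_int; congr (_ * _).
by rewrite [RHS]rmorphM fmorphV /= ratr_nat.
Qed.

Lemma Kmx_diag_gt0 i : 0 < Kmx i i.
Proof.
have := @Kmx_pos (delta_mx 0 i); rewrite -rowE trmx_delta -colE !mxE; apply.
by apply/eqP => /rowP/(_ i)/eqP; rewrite !mxE !eqxx oner_eq0.
Qed.

Lemma wform_alpha i nu : wform (al i) nu = 2 / Kmx i i * (nu 0 i)%:~R.
Proof.
have K0 : Kmx i i != 0 by rewrite gt_eqF ?Kmx_diag_gt0.
rewrite /wform; have -> : map_mx intr (al i) = (2 / Kmx i i) *: (delta_mx 0 i *m Kmx) :> 'rV[rat]_n.
  apply/rowP => j; rewrite -rowE [LHS]mxE simple_rootE [RHS]mxE [row _ _ _ _]mxE [X in _ = _ * X]Kmx_cartan.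
  by field; rewrite ?K0.
by rewrite -scalemxAl mulmxK ?unit_Kmx // -scalemxAl mxE -rowE !mxE.
Qed.

End LieRep.

(** * Freudenthal's recursion for an irreducible module *)

Section FreudenthalData.
Variables (K : numFieldType) (n : nat) (A : 'M[int]_n).
Local Notation al := (simple_root A).
Local Notation rt := (wt al).
Local Notation P := 'rV[int]_n.

Definition wf (W : 'M[K]_n) (mu nu : P) : K :=
  ((map_mx intr mu : 'rV[K]_n) *m W *m (map_mx intr nu)^T) 0 0.

(** Everything that the denominator computation uses of a module. The basis of weight vectors and
    the matrices are hidden behind it. *)
Record freudenthal_data (N : nat) (m : P -> nat) (pos : pred 'I_N) (r : 'I_N -> mindex n)
    (U : 'I_N -> P -> K) (W : 'M[K]_n) (tau : 'I_n -> K) (c : K) : Prop := FreudenthalData {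
  fd_sym : W^T = W;
  fd_tau : forall i, 0 < tau i;
  fd_alpha : forall i nu, wf W (al i) nu = tau i * (nu 0 i)%:~R;
  fd_casimir : forall mu, c * (m mu)%:R = wf W mu mu * (m mu)%:R
    + \sum_(s | pos s) (U s mu + U s (mu + rt (r s)));
  fd_diff : forall s mu, pos s -> U s mu - U s (mu + rt (r s)) = wf W (rt (r s)) mu * (m mu)%:R;
  fd_U0 : forall s mu, m mu = 0%N -> U s mu = 0;
  fd_neq0 : forall s, pos s -> r s != 0;
  fd_sum : \sum_(s | pos s) rt (r s) = \row_i 2;
  fd_simple : forall i, #|[pred s | pos s && (r s == idelta i 1)]| = 1%N;
  fd_refl : forall i beta,
    #|[pred s | [&& pos s, r s != idelta i 1 & rt (r s) == refl A i beta]]|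
    = #|[pred s | [&& pos s, r s != idelta i 1 & rt (r s) == beta]]|
}.

Hypothesis A2 : forall i, A i i = 2.
Hypothesis A_pos : forall k : 'I_n -> rat, (exists b, k b != 0) ->
  exists i, 0 < k i * \sum_j (A i j)%:~R * k j.
Variable V : chevalley_module K A.
Hypothesis Virr : mod_irreducible V.
Variable lam : P.
Hypothesis Vhw : has_highest_weight V lam.

Definition wmult (mu : P) : nat := \dim (weight_space V mu).

Let wsum_rt s : wsum A s = rt (cnt s).
Proof.
rewrite /wsum /cnt wt_sum; apply: eq_bigr => i _.
by rewrite wt_idelta mulr1n.
Qed.

Let wsum_free s : wsum A s = 0 -> s = [::].
Proof. by rewrite wsum_rt => /(rt_free A_pos)/cnt_eq0. Qed.

Lemma wmult_below mu : wmult mu != 0%N -> exists k, mu = lam - rt k.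
Proof.
case: Vhw => v0 v00 hv0.
have [d [w [X [k0 [bX hX X0 w0 _]]]]] := weight_basis Virr v00 hv0 wsum_free.
have wX k : weight_vec (w k) X`_k by have [s [-> ->]] := hX k; apply: weight_fword.
rewrite /wmult (dim_weight_space bX wX) -lt0n => /card_gt0P[k]; rewrite inE => /eqP <-.
by have [s [_ ->]] := hX k; exists (cnt s); rewrite wsum_rt.
Qed.

Lemma wmult_lam : wmult lam = 1%N.
Proof.
case: Vhw => v0 v00 hv0.
have [d [w [X [k0 [bX hX X0 w0 wk]]]]] := weight_basis Virr v00 hv0 wsum_free.
have wX k : weight_vec (w k) X`_k by have [s [-> ->]] := hX k; apply: weight_fword.
rewrite /wmult (dim_weight_space bX wX); transitivity #|pred1 k0|; last exact: card1.
apply: eq_card => k; rewrite !inE.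
by apply/eqP/eqP => [e|-> //]; apply: contrapT => /eqP/wk/eqP.
Qed.

Lemma wmult_refl i mu : wmult (refl A i mu) = wmult mu.
Proof.
case: Vhw => v0 v00 hv0.
have [d [w [X [k0 [bX hX X0 w0 _]]]]] := weight_basis Virr v00 hv0 wsum_free.
have wX k : weight_vec (w k) X`_k by have [s [-> ->]] := hX k; apply: weight_fword.
exact: (dim_refl A2 v00 bX wX).
Qed.

Lemma wmult_finite : exists s : seq P, forall mu, wmult mu != 0%N -> mu \in s.
Proof.
case: Vhw => v0 v00 hv0.
have [d [w [X [k0 [bX hX X0 w0 _]]]]] := weight_basis Virr v00 hv0 wsum_free.
have wX k : weight_vec (w k) X`_k by have [s [-> ->]] := hX k; apply: weight_fword.
exists [seq w k | k : 'I_d] => mu.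
rewrite /wmult (dim_weight_space bX wX) -lt0n => /card_gt0P[k]; rewrite inE => /eqP <-.
by rewrite map_f // mem_enum.
Qed.

(** The trivial module is set apart because its operators are all 0, so that its trace form cannot
    define a form on weights. *)
Lemma wmult_trivial : (forall i, mod_e V i = 0) -> lam = 0 /\ forall mu, wmult mu = (mu == 0).
Proof.
move=> e0.
have h0 i : mod_h V i = 0.
  have := mod_ef V i i; rewrite eqxx => <-.
  by apply/lfunP => v; rewrite bracketE e0 !lfunE /= linear0 subrr.
have f0 i : mod_f V i = 0.
  have := mod_hf V i i; rewrite A2 h0 => e; apply/eqP; rewrite -oppr_eq0.
  have /eqP : - (2%:~R *: mod_f V i) = 0.
    by rewrite -e; apply/lfunP => v; rewrite bracketE !lfunE /= linear0 subrr.
  by rewrite !oppr_eq0 scaler_eq0 intr_eq0.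
case: Vhw => v0 v00 hv0.
have lam0 : lam = 0.
  apply/rowP => a; have [_] := hv0 a; rewrite h0 lfunE /= mxE => /esym/eqP.
  by rewrite scaler_eq0 (negPf v00) orbF intr_eq0 => /eqP.
split=> // mu.
have [d [w [X [k0 [bX hX X0 w0 wk]]]]] := weight_basis Virr v00 hv0 wsum_free.
have wX k : weight_vec (w k) X`_k by have [s [-> ->]] := hX k; apply: weight_fword.
have wl k : w k = lam.
  have [[|i s] [eX ->]] := hX k; first by rewrite /wsum big_nil subr0.
  have : X`_k != 0.
    by apply: (free_not0 (basis_free bX)); rewrite mem_nth // size_tuple.
  by rewrite eX /= f0 lfunE /= eqxx.
have kk k : k = k0 by apply: contrapT => /eqP/wk/eqP; apply; apply: wl.
rewrite /wmult (dim_weight_space bX wX); case: eqP => [->|mu0].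
  rewrite /=; transitivity #|pred1 k0|; last exact: card1.
  by apply: eq_card => k; rewrite !inE wl lam0 (kk k) !eqxx.
by apply: eq_card0 => k; rewrite !inE wl lam0 eq_sym; apply/eqP.
Qed.

Lemma freudenthal_dataP : (forall i, mod_e V i != 0) ->
  exists N (pos : pred 'I_N) r U W tau c, freudenthal_data wmult pos r U W tau c.
Proof.
move=> e0; case: Vhw => v0 v00 hv0.
have [d [w [X [k0 [bX hX X0 w0 wk]]]]] := weight_basis Virr v00 hv0 wsum_free.
have wX k : weight_vec (w k) X`_k by have [s [-> ->]] := hX k; apply: weight_fword.
pose E i := mxof X (mod_e V i); pose F i := mxof X (mod_f V i).
have E_w := mxof_e_weight bX wX.
have F_w := mxof_f_weight bX wX.
have EF i j : ad (E i) (F j) = if i == j then Hmx K w i else 0.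
  exact: (mxof_ef bX wX).
have E0 i : E i != 0.
  apply: contra_neq (e0 i) => h; apply/lfunP => v; rewrite zero_lfunE.
  rewrite (coordX bX (mod_e V i v)) big1 // => k _.
  have := cvof_mxof bX (mod_e V i) v; rewrite -/(E i) h mul0mx => /colP/(_ k).
  by rewrite !mxE => ->; rewrite scale0r.
have fs0 : free [seq gen w E F t | t <- [::]] by exact: nil_free.
have [bs []] := free_span_exists fs0; rewrite cats0 => bs_free bs_span.
have k0u k : k != k0 -> w k != w k0 by rewrite w0; apply: wk.
have Fg l : exists s : seq 'I_n,
    delta_mx l 0 = foldr (fun i v => F i *m v) (delta_mx k0 0 : 'cV[K]_d) s.
  have [s [eX _]] := hX l; exists s; rewrite -(cvof_basis bX) eX -(cvof_basis bX k0) X0.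
  by elim: s {eX} => //= i s <-; rewrite -(cvof_mxof bX).
pose ty (s : 'I_(size bs)) := tnth (in_tuple bs) s.
have [c hc] := freudenthal A2 A_pos E_w F_w EF E0 bs_free bs_span k0u Fg.
have mE mu : wmult mu = mult w mu by rewrite /wmult (dim_weight_space bX wX).
pose W : 'M[K]_n := map_mx ratr (invmx (Kmx w)).
have WE mu nu : wf W mu nu = ratr (wform w mu nu).
  rewrite /wf /wform !mxE rmorph_sum; apply: eq_bigr => j _.
  rewrite rmorphM /= !mxE ratr_int rmorph_sum; congr (_ * _); apply: eq_bigr => k _.
  by rewrite rmorphM /= !mxE ratr_int.
have cE (p : pred 'I_(size bs)) : count p (enum 'I_(size bs)) = #|p|.
  by rewrite -sum1_count big_enum_cond sum1_card.
exists (size bs), (fun s => isE (ty s)), (fun s => kx (ty s)), (Ucoef w E F (bs := bs)), W,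
  (fun i => ratr (2 / Kmx w i i)), c; split.
- have Ks : (invmx (Kmx w))^T = invmx (Kmx w).
    rewrite trmx_inv; congr (invmx _); apply/matrixP => i j; rewrite !mxE; congr (_%:~R).
    by apply: eq_bigr => k _; rewrite mulrC.
  by apply/matrixP => i j; rewrite !mxE -{1}Ks mxE.
- by move=> i; rewrite ltr0q divr_gt0 // (Kmx_diag_gt0 A_pos E_w E0).
- by move=> i nu; rewrite WE (wform_alpha A2 A_pos E_w EF E0) rmorphM /= ratr_int.
- by move=> mu; rewrite mE hc WE.
- by move=> s mu ps; rewrite (Ucoef_root A2 A_pos E_w F_w EF E0 bs_free bs_span) // WE mE.
- by move=> s mu; rewrite mE; apply: Ucoef_mult0.
- move=> s ps; apply: (kx_neq0 bs_free); move: ps.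
  by rewrite /ty; case: (tnth _ s) => [[]|].
- rewrite -(sum_roots A2 A_pos E_w F_w EF E0 bs_free bs_span) /roots big_map big_filter.
  by rewrite big_enum_cond.
- move=> i; apply: etrans _ (count_simple A_pos E_w F_w E0 bs_free bs_span i).
  rewrite /roots count_map count_filter cE; apply: eq_card => s.
  by rewrite !inE /= andbC.
move=> i beta.
have e b : #|[pred s | [&& isE (ty s), kx (ty s) != idelta i 1 & rt (kx (ty s)) == b]]|
    = count_mem b (roots' A bs i).
  rewrite /roots' count_map count_filter /roots count_map count_filter cE.
  by apply: eq_card => s; rewrite !inE /= [RHS]andbC; congr (_ && _); rewrite andbC.
rewrite !e; have /seq.permP -> := roots_refl A2 A_pos E_w F_w EF bs_free bs_span i.
by rewrite count_map; apply: eq_count => b /=; rewrite (inj_eq (inv_inj (reflK A2 i))).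
Qed.

End FreudenthalData.

(** * Laurent polynomials on the torus and simple reflections *)

Section Laurent.
Variables (K : numFieldType) (n : nat).
Local Notation P := 'rV[int]_n.
Implicit Types (mu nu : P) (x : 'I_n -> K) (l : seq (P * K)).

Definition torus x := forall b, x b != 0.

Lemma wexpD x mu nu : torus x -> wexp x (mu + nu) = wexp x mu * wexp x nu.
Proof.
move=> hx; rewrite /wexp -big_split; apply: eq_bigr => a _.
by rewrite mxE expfzDr.
Qed.

Lemma wexp0 x : wexp x 0 = 1.
Proof. by rewrite /wexp big1 // => a _; rewrite mxE expr0z. Qed.

Lemma wexp_neq0 x mu : torus x -> wexp x mu != 0.
Proof. by move=> hx; apply/prodf_neq0 => a _; rewrite expfz_neq0. Qed.

Lemma wexpN x mu : torus x -> wexp x (- mu) = (wexp x mu)^-1.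
Proof.
move=> hx; apply: (mulfI (wexp_neq0 mu hx)).
by rewrite -wexpD // subrr wexp0 mulfV // wexp_neq0.
Qed.

Lemma wexpMz x mu z : torus x -> wexp x (mu *~ z) = wexp x mu ^ z.
Proof.
move=> hx; have hn m : wexp x (mu *+ m) = wexp x mu ^+ m.
  by elim: m => [|m IH]; rewrite ?mulr0n ?wexp0 // mulrS wexpD // IH exprS.
by case: z => m; rewrite ?NegzE ?mulrNz ?wexpN // -pmulrn hn.
Qed.

Lemma wexp_sum x (J : Type) (r : seq J) (F : J -> P) : torus x ->
  wexp x (\sum_(j <- r) F j) = \prod_(j <- r) wexp x (F j).
Proof. by move=> hx; elim/big_rec2: _ => [|j y z _ <-]; rewrite ?wexp0 ?wexpD. Qed.

Lemma wexp_fund x a : wexp x (fund_weight a) = x a.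
Proof.
rewrite /wexp (bigD1 a) //= big1 ?mulr1 => [|b /negPf ba]; first by rewrite mxE !eqxx expr1z.
by rewrite mxE ba andbF expr0z.
Qed.

Definition lev l x : K := \sum_(p <- l) p.2 * wexp x p.1.
Definition lcoef l mu : K := \sum_(p <- l | p.1 == mu) p.2.
Definition lmap (g : P -> P) (c : P -> K) l := [seq (g p.1, c p.1 * p.2) | p <- l].

Lemma lev_lcoef l (s : seq P) x : uniq s -> (forall p, p \in l -> p.1 \in s) ->
  lev l x = \sum_(mu <- s) lcoef l mu * wexp x mu.
Proof.
move=> us hs; rewrite /lev /lcoef.
transitivity (\sum_(mu <- s) \sum_(p <- l | p.1 == mu) p.2 * wexp x p.1); last first.
  by apply: eq_bigr => mu _; rewrite mulr_suml; apply: eq_bigr => p /eqP ->.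
under [RHS]eq_bigr do rewrite big_mkcond.
rewrite exchange_big big_seq [RHS]big_seq; apply: eq_bigr => p /hs ps.
rewrite -big_mkcond (big_rem _ ps) /= eqxx big_seq_cond big1 ?addr0 // => mu.
by rewrite (mem_rem_uniq _ us) inE => /andP[/andP[/negPf h _]]; rewrite eq_sym h.
Qed.

(** Doubling coordinate [a] multiplies e^mu by 2^(mu_a). Subtracting 2^(mu0_a) times the original
    relation removes mu0, and induction applies; some coordinate separates mu from mu0, and powers
    of 2 are distinct in characteristic 0. *)
Lemma wexp_free (s : seq P) (c : P -> K) : uniq s ->
  (forall x, torus x -> \sum_(mu <- s) c mu * wexp x mu = 0) ->
  forall mu, mu \in s -> c mu = 0.
Proof.
elim: s c => [//|mu0 s IH] c /= /andP[mu0s us] hc.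
have h a mu : mu \in s -> c mu * (2 ^ mu 0 a - 2 ^ mu0 0 a) = 0.
  move: mu; apply: IH => // x hx.
  pose x' b := if b == a then 2 * x b else x b.
  have hx' : torus x' by move=> b; rewrite /x'; case: ifP; rewrite ?mulf_neq0 // pnatr_eq0.
  have wx' mu : wexp x' mu = 2 ^ mu 0 a * wexp x mu.
    rewrite /wexp (bigD1 a) //= [X in _ = _ * X](bigD1 a) //= /x' eqxx mulrA; congr (_ * _).
      by rewrite exprzMl // unitfE ?pnatr_eq0.
    by apply: eq_bigr => b /negPf ->.
  have := hc _ hx; have := hc _ hx'; rewrite !big_cons wx' => e1 e2.
  rewrite (eq_bigr (fun mu => c mu * wexp x' mu - 2 ^ mu0 0 a * (c mu * wexp x mu))); last first.
    by move=> mu _; rewrite wx'; ring.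
  rewrite sumrB -mulr_sumr.
  have -> : \sum_(mu <- s) c mu * wexp x' mu = - (c mu0 * (2 ^ mu0 0 a * wexp x mu0)).
    by apply/eqP; rewrite -addr_eq0 addrC e1.
  have -> : \sum_(mu <- s) c mu * wexp x mu = - (c mu0 * wexp x mu0).
    by apply/eqP; rewrite -addr_eq0 addrC e2.
  by ring.
have hs mu : mu \in s -> c mu = 0.
  move=> ms; have [a ha] : exists a, mu 0 a != mu0 0 a.
    apply: contrapT => h0; move: mu0s; have -> : mu0 = mu; last by rewrite ms.
    by apply/rowP => a; apply/eqP; rewrite eq_sym; apply: contrapT => /negP ?; apply: h0; exists a.
  have /eqP := h a mu ms; rewrite mulf_eq0 subr_eq0 => /orP[/eqP //|].
  have h2 : injective (fun z : int => (2 : K) ^ z).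
    move=> y z e; have h3 : injective (fun z : int => (2 : rat) ^ z) by apply: ieexprIz.
    have ratr_inj : injective (ratr : rat -> K) by exact: fmorph_inj.
    by apply/h3/ratr_inj; rewrite /= !fmorphXz /= !rmorph_nat.
  by move/eqP/h2/eqP; rewrite (negPf ha).
move=> mu; rewrite inE => /orP[/eqP ->|]; last exact: hs.
have h1 : torus (fun=> 1) by move=> b; rewrite oner_eq0.
have := hc _ h1; rewrite big_cons big_seq big1 ?addr0 => [|nu /hs ->]; last by rewrite mul0r.
by move/eqP; rewrite mulf_eq0 (negPf (wexp_neq0 _ h1)) orbF => /eqP.
Qed.

Lemma lcoef_eq0 l mu : mu \notin map fst l -> lcoef l mu = 0.
Proof.
move=> h; rewrite /lcoef big_seq_cond big1 // => p /andP[pl /eqP e].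
by case/mapP: h; exists p.
Qed.

Lemma lev_inj l : (forall x, torus x -> lev l x = 0) -> forall mu, lcoef l mu = 0.
Proof.
move=> h mu; case: (boolP (mu \in map fst l)) => [ml|]; last exact: lcoef_eq0.
have us := undup_uniq (map fst l).
have hs p : p \in l -> p.1 \in undup (map fst l) by move=> pl; rewrite mem_undup map_f.
apply: (@wexp_free (undup (map fst l)) (lcoef l)); rewrite ?mem_undup // => x hx.
by rewrite -(lev_lcoef _ us hs) h.
Qed.

Lemma lev_cat l l' x : lev (l ++ l') x = lev l x + lev l' x.
Proof. exact: big_cat. Qed.

Lemma lcoef_cat l l' mu : lcoef (l ++ l') mu = lcoef l mu + lcoef l' mu.
Proof. exact: big_cat. Qed.

Lemma lcoef_lmap (g h : P -> P) c l mu : cancel g h -> cancel h g ->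
  lcoef (lmap g c l) mu = c (h mu) * lcoef l (h mu).
Proof.
move=> gK hK; rewrite /lcoef big_map mulr_sumr.
by apply: eq_big => [p|p /eqP <-] /=; rewrite ?(can2_eq gK hK) ?gK.
Qed.

Lemma lev_lmap0 (c : K) l x : lev (lmap id (fun=> c) l) x = c * lev l x.
Proof. by rewrite /lev big_map mulr_sumr; apply: eq_bigr => p _; rewrite /= mulrA. Qed.

Lemma lev_eq l l' : (forall mu, lcoef l mu = lcoef l' mu) -> forall x, lev l x = lev l' x.
Proof.
move=> h x; set s := undup (map fst (l ++ l')).
have us : uniq s by exact: undup_uniq.
rewrite !(@lev_lcoef _ s) //.
- by apply: eq_bigr => mu _; rewrite h.
- by move=> p pl; rewrite mem_undup map_f // mem_cat pl orbT.
- by move=> p pl; rewrite mem_undup map_f // mem_cat pl.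
Qed.

Section Reflection.
Variable A : 'M[int]_n.
Hypothesis A2 : forall i, A i i = 2.
Local Notation al := (simple_root A).

Definition refl_pt i x : 'I_n -> K := fun a => wexp x (refl A i (fund_weight a)).

Lemma torus_refl i x : torus x -> torus (refl_pt i x).
Proof. by move=> hx a; apply: wexp_neq0. Qed.

Lemma wexp_refl i x mu : torus x -> wexp (refl_pt i x) mu = wexp x (refl A i mu).
Proof.
move=> hx; rewrite {1}/wexp /refl_pt.
under eq_bigr do rewrite -wexpMz //.
rewrite -wexp_sum //; congr (wexp x _); apply/rowP => b; rewrite summxE reflE.
have e a : (refl A i (fund_weight a) *~ mu 0 a) 0 b
    = mu 0 a * (b == a)%:Z - A b i * (mu 0 a * (i == a)%:Z).
  rewrite -scaler_int intz mxE reflE !mxE !eqxx /= !natz.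
  by case: (b == a); case: (i == a); ring.
under eq_bigr do rewrite e.
rewrite sumrB -mulr_sumr.
have d c : \sum_a mu 0 a * (c == a)%:Z = mu 0 c.
  rewrite (bigD1 c) //= eqxx mulr1 big1 ?addr0 // => a /negPf ac.
  by rewrite eq_sym ac mulr0.
by rewrite !d.
Qed.

Lemma lcoef_refl i (c : K) l : (forall x, torus x -> lev l (refl_pt i x) = c * lev l x) ->
  forall mu, lcoef l (refl A i mu) = c * lcoef l mu.
Proof.
move=> h mu.
have h0 x : torus x -> lev (lmap (refl A i) (fun=> 1) l ++ lmap id (fun=> - c) l) x = 0.
  move=> hx; rewrite lev_cat lev_lmap0 mulNr -h // -[X in X - _](_ : lev l (refl_pt i x) = _) ?subrr //.
  by rewrite /lev big_map; apply: eq_bigr => p _; rewrite /= mul1r wexp_refl.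
have := lev_inj h0 mu; rewrite lcoef_cat (lcoef_lmap _ _ _ (reflK A2 i) (reflK A2 i)).
rewrite (@lcoef_lmap id id) // mul1r mulNr => /eqP.
by rewrite subr_eq0 => /eqP.
Qed.

Definition lder b l := lmap id (fun mu => (mu 0 b)%:~R) l.

Lemma lev_lder_refl i b l x : torus x -> (forall mu, lcoef l (refl A i mu) = lcoef l mu) ->
  lev (lder b l) (refl_pt i x) = lev (lder b l) x - (A b i)%:~R * lev (lder i l) x.
Proof.
move=> hx hl.
transitivity (lev (lmap (refl A i) (fun mu => (mu 0 b)%:~R) l) x).
  by rewrite /lev !big_map; apply: eq_bigr => p _ /=; rewrite wexp_refl.
rewrite -mulNr -lev_lmap0 -lev_cat; apply: lev_eq => mu.
rewrite lcoef_cat (lcoef_lmap _ _ _ (reflK A2 i) (reflK A2 i)) !(@lcoef_lmap id id) //.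
by rewrite hl reflE rmorphB rmorphM /=; ring.
Qed.

(** A finitely supported antisymmetric function vanishing at the regular
    dominant weights is zero: look at a weight of maximal height in its support. *)
Lemma antisym_eq0 (ht : {additive P -> int}) (a : P -> K) (s : seq P) :
  (forall i, 0 < ht (al i)) -> (forall mu, a mu != 0 -> mu \in s) ->
  (forall i mu, a (refl A i mu) = - a mu) ->
  (forall mu, (forall i, 1 <= mu 0 i) -> a mu = 0) -> forall mu, a mu = 0.
Proof.
move=> ht0 as_ anti a0; pose B := \sum_(nu <- s) `|ht nu|.
have hB nu : nu \in s -> ht nu <= B.
  move=> h; rewrite /B (big_rem _ h) /= (le_trans (ler_norm _)) // lerDl.
  by apply: sumr_ge0.
suff main (N : nat) mu : B - ht mu < N%:Z -> a mu = 0.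
  by move=> mu; apply: (main (absz (B - ht mu)).+1); lia.
elim: N mu => [|N IH] mu hN; apply/eqP; apply: contrapT => /negP amu.
  by have := hB _ (as_ _ amu); lia.
case/eqP: (amu); apply: a0 => i; rewrite leNgt; apply/negP => mi.
case: (eqVneq (mu 0 i) 0) => [m0|m0].
  case/eqP: (amu); have := anti i mu; rewrite /refl m0 mulr0z subr0 => /eqP.
  by rewrite -addr_eq0 -mulr2n mulrn_eq0 /= => /eqP.
case/eqP: (amu); apply: oppr_inj; rewrite -(anti i) oppr0; apply: IH.
have hm : ht (al i *~ mu 0 i) = ht (al i) * mu 0 i by rewrite raddfMz -mulrzr intz.
have hk : ht (al i) * mu 0 i < 0.
  by rewrite pmulr_rlt0 // lt_neqAle m0 /=; move: mi; lia.
have -> : ht (refl A i mu) = ht mu - ht (al i) * mu 0 i by rewrite /refl raddfB hm.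
by move: hk hN; move: (ht (al i) * mu 0 i) (ht mu) => u v; lia.
Qed.

End Reflection.
End Laurent.

(** * The Weyl denominator and the character formula *)

Section WeylFormula.
Variables (K : numFieldType) (n : nat) (A : 'M[int]_n).
Local Notation P := 'rV[int]_n.
Local Notation al := (simple_root A).
Hypothesis A2 : forall i, A i i = 2.
Hypothesis A_pos : forall k : 'I_n -> rat, (exists b, k b != 0) ->
  exists i, 0 < k i * \sum_j (A i j)%:~R * k j.
Variables (al' : 'I_n -> P) (ep : 'I_n -> nat).
Hypothesis ep_gt0 : forall b, (0 < ep b)%N.
Hypothesis al_ep : forall b, al b = al' b *+ ep b.
Variable ht : {additive P -> int}.
Hypothesis ht_gt0 : forall b, 0 < ht (al' b).
Local Notation wt' := (wt al').
Local Notation S := (pseries n K).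
Implicit Types (mu nu lam : P) (k m : mindex n) (f g : S).

Let al'_pos (k : 'I_n -> int) : (exists b, k b != 0) ->
  exists i, 0 < k i * (\sum_b al' b *~ k b) 0 i.
Proof.
move=> [b kb]; have [|i] := A_pos (k := fun b => (k b)%:~R / (ep b)%:R).
  by exists b; rewrite mulf_neq0 ?intr_eq0 // invr_eq0 pnatr_eq0 -lt0n.
move=> h; exists i; move: h.
have -> : \sum_j (A i j)%:~R * ((k j)%:~R / (ep j)%:R) = ((\sum_b al' b *~ k b) 0 i)%:~R :> rat.
  rewrite summxE rmorph_sum /=; apply: eq_bigr => j _.
  rewrite -simple_rootE al_ep pmulrn -!scaler_int !intz !mxE !rmorphM /= -pmulrn.
  by field; rewrite pnatr_eq0 -lt0n.
by rewrite mulrAC pmulr_lgt0 ?invr_gt0 ?ltr0n // -rmorphM ltr0z.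
Qed.

Lemma half_root_free (k : 'I_n -> int) : \sum_b al' b *~ k b = 0 -> forall b, k b = 0.
Proof.
move=> h b; apply/eqP; apply: contrapT => /negP kb.
by have [|i] := @al'_pos k; [exists b|rewrite h mxE mulr0 ltxx].
Qed.

Lemma wtz' k : wt' k = \sum_b al' b *~ (k b)%:Z.
Proof. by apply: eq_bigr => b _; rewrite pmulrn. Qed.

Lemma wt'_inj : injective (fun k => wt' k).
Proof.
move=> k l /eqP; rewrite -subr_eq0 !wtz' -sumrB => /eqP h.
apply/ffunP => b; have := @half_root_free (fun b => (k b)%:Z - (l b)%:Z) _ b.
rewrite (_ : \sum_b _ = 0) => [/(_ erefl) e1|]; first by apply/eqP; rewrite -eqz_nat -subr_eq0 e1.
by apply: etrans _ h; apply: eq_bigr => c _; rewrite mulrzBr.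
Qed.

Lemma wt'_dominant k : (forall i, wt' k 0 i <= 0) -> k = 0.
Proof.
move=> h; apply/ffunP => b; rewrite mindex0; apply/eqP; apply: contrapT => /negP kb.
have [|i] := @al'_pos (fun b => (k b)%:Z); first by exists b; rewrite eqz_nat.
by rewrite -wtz' ltNge mulr_ge0_le0.
Qed.

Definition prep f (F : ('I_n -> K) -> K) := exists2 l : seq (mindex n * K),
  f = \sum_(p <- l) ps_const (n := n) p.2 * ps_mono K p.1 &
  forall x, torus x -> F x = \sum_(p <- l) p.2 * wexp x (- wt' p.1).

Lemma prep_ext f F G : prep f F -> (forall x, torus x -> G x = F x) -> prep f G.
Proof. by move=> [l h1 h2] h; exists l => // x hx; rewrite h // h2. Qed.

Lemma prep_const c : prep (ps_const (n := n) c) (fun=> c).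
Proof.
exists [:: (0, c)]; first by rewrite big_seq1 mulr1.
by move=> x hx; rewrite big_seq1 wt0 oppr0 wexp0 mulr1.
Qed.

Lemma ps_const1 : ps_const (n := n) 1 = 1 :> S.
Proof. by apply/funext => k; rewrite ps1E /ps_const; case: eqP. Qed.

Lemma prep1 : prep 1 (fun=> 1).
Proof. by rewrite -ps_const1; apply: prep_const. Qed.

Lemma ps_constMM a b : ps_const (n := n) (a * b) = ps_const (n := n) a * ps_const (n := n) b :> S.
Proof. by apply/funext => k; rewrite ps_constM /ps_const; case: eqP; rewrite ?mulr0. Qed.

Lemma ps_constD a b : ps_const (n := n) (a + b) = ps_const (n := n) a + ps_const (n := n) b :> S.
Proof. by apply/funext => k; rewrite psDE /ps_const; case: eqP; rewrite ?addr0. Qed.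

Lemma prep_mono m : prep (ps_mono K m) (fun x => wexp x (- wt' m)).
Proof.
exists [:: (m, 1)]; first by rewrite big_seq1 ps_const1 mul1r.
by move=> x hx; rewrite big_seq1 mul1r.
Qed.

Lemma prepD f g F G : prep f F -> prep g G -> prep (f + g) (fun x => F x + G x).
Proof.
move=> [l h1 h2] [l' h1' h2']; exists (l ++ l'); first by rewrite big_cat h1 h1'.
by move=> x hx; rewrite big_cat h2 ?h2'.
Qed.

Lemma prepM f g F G : prep f F -> prep g G -> prep (f * g) (fun x => F x * G x).
Proof.
move=> [l h1 h2] [l' h1' h2'].
exists [seq (p.1 + q.1, p.2 * q.2) | p <- l, q <- l'].
  rewrite big_allpairs_dep h1 h1' mulr_suml; apply: eq_bigr => p _.
  rewrite mulr_sumr; apply: eq_bigr => q _ /=; rewrite ps_constMM ps_monoD; ring.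
move=> x hx; rewrite big_allpairs_dep h2 // h2' // mulr_suml; apply: eq_bigr => p _.
by rewrite mulr_sumr; apply: eq_bigr => q _ /=; rewrite wtD opprD wexpD //; ring.
Qed.

Lemma prepN f F : prep f F -> prep (- f) (fun x => - F x).
Proof.
move=> h; have -> : - f = ps_const (n := n) (-1) * f.
  by apply/funext => k; rewrite ps_constM psNE mulN1r.
by apply: prep_ext (prepM (prep_const _) h) _ => x _; rewrite mulN1r.
Qed.

Lemma prep_sum (I : Type) (r : seq I) (Q : pred I) (f : I -> S) F :
  (forall i, Q i -> prep (f i) (F i)) ->
  prep (\sum_(i <- r | Q i) f i) (fun x => \sum_(i <- r | Q i) F i x).
Proof.
move=> h; elim: r => [|i r IH].
  rewrite big_nil; exists [::]; first by rewrite big_nil.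
  by move=> x _; rewrite !big_nil.
rewrite big_cons; case: ifP => Qi.
  by apply: prep_ext (prepD (h i Qi) IH) _ => x _; rewrite big_cons Qi.
by apply: prep_ext IH _ => x _; rewrite big_cons Qi.
Qed.

Lemma prep_prod (I : Type) (r : seq I) (Q : pred I) (f : I -> S) F :
  (forall i, prep (f i) (F i)) ->
  prep (\prod_(i <- r | Q i) f i) (fun x => \prod_(i <- r | Q i) F i x).
Proof.
move=> h; elim: r => [|i r IH].
  by rewrite big_nil; apply: prep_ext prep1 _ => x _; rewrite big_nil.
rewrite big_cons; case: ifP => Qi.
  by apply: prep_ext (prepM (h i) IH) _ => x _; rewrite big_cons Qi.
by apply: prep_ext IH _ => x _; rewrite big_cons Qi.
Qed.

Lemma prep_exp f F j : prep f F -> prep (f ^+ j) (fun x => F x ^+ j).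
Proof.
move=> h; elim: j => [|j IH]; first exact: prep1.
by rewrite exprS; apply: prep_ext (prepM h IH) _ => x _; rewrite exprS.
Qed.

Lemma prep_det (f : 'I_n -> 'I_n -> S) F : (forall a b, prep (f a b) (F a b)) ->
  prep (\det (\matrix_(a, b) f a b)) (fun x => \det (\matrix_(a, b) F a b x)).
Proof.
move=> h; pose g (s : 'S_n) : S := (-1) ^+ s * \prod_i f i (s i).
pose G (s : 'S_n) x : K := (-1) ^+ s * \prod_i F i (s i) x.
have hg s : prep (g s) (G s).
  apply: prepM; last by apply: prep_prod.
  exact: prep_exp (prepN prep1).
have -> : \det (\matrix_(a, b) f a b) = \sum_s g s.
  by apply: eq_bigr => s _; congr (_ * _); apply: eq_bigr => a _; rewrite mxE.
apply: (@prep_ext _ (fun x => \sum_s G s x)); first by apply: prep_sum => s _; apply: hg.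
move=> x _; apply: eq_bigr => s _; congr (_ * _).
by apply: eq_bigr => a _; rewrite mxE.
Qed.

Lemma prep_laurent lam f F : prep f F -> exists l : seq (P * K),
  [/\ forall x, torus x -> wexp x lam * F x = lev l x,
      forall k, lcoef l (lam - wt' k) = f k &
      forall mu, lcoef l mu != 0 -> exists k, mu = lam - wt' k].
Proof.
move=> [l h1 h2]; exists [seq (lam - wt' p.1, p.2) | p <- l]; split.
- move=> x hx; rewrite h2 // mulr_sumr /lev big_map; apply: eq_bigr => p _ /=.
  by rewrite wexpD // mulrCA.
- move=> k; rewrite h1 ps_sumE /lcoef big_map big_mkcond; apply: eq_bigr => p _ /=.
  rewrite ps_constM /ps_mono (inj_eq (addrI lam)) (inj_eq oppr_inj) (inj_eq wt'_inj) eq_sym.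
  by case: eqP; rewrite ?mulr1 ?mulr0.
move=> mu /eqP h; apply: contrapT => h0; apply: h; rewrite lcoef_eq0 //.
by apply/negP => /mapP[_ /mapP[p _ ->] e]; apply: h0; exists p.1.
Qed.

Lemma prep_supp (s : seq (mindex n)) f : uniq s -> (forall k, k \notin s -> f k = 0) ->
  prep f (fun x => \sum_(k <- s) f k * wexp x (- wt' k)).
Proof.
move=> us hs; exists [seq (k, f k) | k <- s]; last by move=> x _; rewrite big_map.
apply/funext => k; rewrite big_map ps_sumE.
case: (boolP (k \in s)) => [ks|ks].
  rewrite (bigD1_seq k) //= ps_constM /ps_mono eqxx mulr1 big1 ?addr0 // => l /negPf lk.
  by rewrite ps_constM eq_sym lk mulr0.
rewrite hs // big_seq big1 // => l ls; rewrite ps_constM /ps_mono.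
by case: eqP => [e|]; rewrite ?mulr0 //; move: ks; rewrite e ls.
Qed.

Lemma prep_finite f F : prep f F -> exists s : seq (mindex n), forall k, f k != 0 -> k \in s.
Proof.
move=> [l -> _]; exists (map fst l) => k; rewrite ps_sumE; apply: contraNT => kl.
rewrite big_seq big1 // => p pl; rewrite ps_constM /ps_mono.
by case: eqP => [e|]; rewrite ?mulr0 //; move: kl; rewrite e map_f.
Qed.

Definition rho : P := const_mx 1.

Lemma ht_al i : 0 < ht (al i).
Proof. by rewrite al_ep raddfMn pmulrn_lgt0. Qed.

Lemma refl_rho i : refl A i rho = rho - al i.
Proof. by rewrite /refl mxE mulr1z. Qed.

(** The Weyl vector is the only regular dominant weight below itself. *)
Lemma antisym_below_rho (l : seq (P * K)) (a : P -> K) :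
  (forall mu, lcoef l mu != 0 -> exists k, mu = rho - wt' k) ->
  (forall i mu, lcoef l (refl A i mu) = - lcoef l mu) ->
  (forall i mu, a (refl A i mu) = a mu) -> a rho * lcoef l rho = 0 ->
  forall mu, a mu * lcoef l mu = 0.
Proof.
move=> hl anti sym a0; apply: (@antisym_eq0 K n A ht _ (map fst l)).
- exact: ht_al.
- by move=> mu; apply: contraNT => h; rewrite (lcoef_eq0 h) mulr0.
- by move=> i mu; rewrite sym anti mulrN.
move=> mu mu1; case: (eqVneq (lcoef l mu) 0) => [->|/hl[k e]]; first by rewrite mulr0.
suff k0 : k = 0 by rewrite e k0 wt0 subr0.
apply: wt'_dominant => i; have := mu1 i; rewrite e mxE [rho _ _]mxE [(- wt' k) _ _]mxE; move: (wt' k 0 i) => w; lia.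
Qed.

(** The factor e^rho restores the leading exponential that was removed from the Jacobian and from
    the denominator. *)
Definition antisymmetric F := forall i x, torus x ->
  wexp (refl_pt A i x) rho * F (refl_pt A i x) = - (wexp x rho * F x) :> K.

Lemma antisym_unique f g F G : prep f F -> prep g G -> antisymmetric F -> antisymmetric G ->
  f 0 = g 0 -> f = g.
Proof.
move=> pf pg aF aG fg0.
have [l [h1 h2 h3]] := prep_laurent rho (prepD pf (prepN pg)).
have anti i mu : lcoef l (refl A i mu) = - lcoef l mu.
  rewrite -mulN1r; apply: lcoef_refl => // x hx.
  have hx' := torus_refl A i hx.
  by rewrite -!h1 // !mulrBr aF // aG //; ring.
have c0 mu : 1 * lcoef l mu = 0.
  apply: (@antisym_below_rho l (fun=> 1)) => //.
  by have := h2 0; rewrite wt0 subr0 => ->; rewrite psDE psNE fg0 subrr mulr0.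
apply/funext => k; apply/eqP; rewrite -subr_eq0.
by have := h2 k; rewrite psDE psNE => <-; rewrite -(c0 (rho - wt' k)) mul1r.
Qed.

(** The functions e^(Lambda_a) u_a are invariant, so by the chain rule a reflection multiplies the
    matrix of their derivatives by its own matrix [M], of determinant -1. *)
Lemma jacobian_antisym (u : 'I_n -> S) (U : 'I_n -> ('I_n -> K) -> K) :
  (forall a, prep (u a) (U a)) ->
  (forall a i x, torus x -> wexp (refl_pt A i x) (fund_weight a) * U a (refl_pt A i x)
     = wexp x (fund_weight a) * U a x) ->
  exists2 F, prep (jacobian al' u) F & antisymmetric F.
Proof.
move=> hu hU.
have [l hl] : exists l : 'I_n -> seq (P * K), forall a,
  [/\ forall x, torus x -> wexp x (fund_weight a) * U a x = lev (l a) x,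
      forall k, lcoef (l a) (fund_weight a - wt' k) = u a k &
      forall mu, lcoef (l a) mu != 0 -> exists k, mu = fund_weight a - wt' k].
  have h a := prep_laurent (fund_weight a) (hu a).
  by exists (fun a => projT1 (cid (h a))) => a; exact: (projT2 (cid (h a))).
pose G a b x := wexp x (- fund_weight a) * lev (lder b (l a)) x.
have pG a b : prep (ps_der al' (fund_weight a) b (u a)) (G a b).
  have [_ h2 h3] := hl a; have [s hs] := prep_finite (hu a).
  apply: prep_ext (@prep_supp (undup s) _ (undup_uniq s) _) _.
    move=> k; rewrite mem_undup => ks; rewrite /ps_der [u a k](_ : _ = 0) ?mulr0 //.
    by apply/eqP; apply: contraNT ks => /hs.
  move=> x hx; pose s' := [seq fund_weight a - wt' k | k <- undup s].
  rewrite /G.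
  have -> : lev (lder b (l a)) x = \sum_(mu <- s') lcoef (lder b (l a)) mu * wexp x mu.
    pose s2 := undup (map fst (lder b (l a)) ++ s').
    have us2 : uniq s2 by exact: undup_uniq.
    have us' : uniq s'.
      by rewrite map_inj_uniq ?undup_uniq // => k k' /addrI/oppr_inj/wt'_inj.
    rewrite (@lev_lcoef _ _ _ s2) //; last by move=> p pl; rewrite mem_undup mem_cat map_f.
    rewrite (bigID (mem s')) /= [X in _ + X]big1_seq ?addr0 => [|mu /andP[ms' _]].
      rewrite -big_filter; apply: perm_big; apply: uniq_perm; rewrite ?filter_uniq //.
      move=> mu; rewrite mem_filter mem_undup mem_cat.
      by case: (mu \in s') => //=; rewrite orbT.
    rewrite [lcoef _ mu](_ : _ = 0) ?mul0r // (@lcoef_lmap _ _ id id) //.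
    apply/eqP; rewrite mulf_eq0; apply/orP; right; apply: contraNT ms' => /[dup] h0 /h3[k e].
    apply/mapP; exists k => //; rewrite mem_undup; apply: hs.
    by rewrite -h2 -e.
  rewrite mulr_sumr big_map; apply: eq_bigr => k _.
  rewrite (@lcoef_lmap _ _ id id) // h2 /ps_der mulrCA -wexpD //.
  by rewrite addrA addNr add0r.
exists (fun x => \det (\matrix_(a, b) G a b x)); first exact: prep_det.
have eG x : torus x -> wexp x rho * \det (\matrix_(a, b) G a b x)
    = \det (\matrix_(a, b) lev (lder b (l a)) x).
  move=> hx; have -> : wexp x rho = \det (diag_mx (\row_a wexp x (fund_weight a))).
    by rewrite {1}/wexp det_diag; apply: eq_bigr => a _; rewrite !mxE wexp_fund expr1z.
  rewrite -det_mulmx; congr (\det _); apply/matrixP => a b.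
  by rewrite mul_diag_mx !mxE /G mulrA -wexpD // subrr wexp0 mul1r.
move=> i x hx; have hx' := torus_refl A i hx; rewrite !eG //.
have sl a mu : lcoef (l a) (refl A i mu) = lcoef (l a) mu.
  have [h1 _ _] := hl a; rewrite -[RHS]mul1r; apply: lcoef_refl => // y hy.
  have hy' := torus_refl A i hy.
  by rewrite -!h1 // mul1r hU.
pose M : 'M[K]_n := \matrix_(c, b) ((c == b)%:R - (c == i)%:R * (A b i)%:~R).
have -> : \matrix_(a, b) lev (lder b (l a)) (refl_pt A i x)
    = (\matrix_(a, b) lev (lder b (l a)) x) *m M.
  apply/matrixP => a b; rewrite !mxE lev_lder_refl //.
  rewrite (eq_bigr (fun c => lev (lder c (l a)) x * (c == b)%:R
    - (lev (lder c (l a)) x * (c == i)%:R) * (A b i)%:~R)); last first.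
    by move=> c _; rewrite !mxE; ring.
  have d c' : \sum_c lev (lder c (l a)) x * (c == c')%:R = lev (lder c' (l a)) x.
    rewrite (bigD1 c') //= eqxx mulr1 big1 ?addr0 // => c /negPf ->.
    by rewrite mulr0.
  by rewrite sumrB -mulr_suml !d mulrC.
rewrite det_mulmx (_ : \det M = -1) ?mulrN1 //.
(* [M] differs from the identity only in row [i], so the expansion along that row uses the cofactors
   of the identity and leaves M i i = 1 - A i i = -1. *)
have cM j : cofactor M i j = cofactor (1%:M : 'M[K]_n) i j.
  rewrite /cofactor; congr (_ * \det _); apply/matrixP => a b.
  by rewrite !mxE [lift i a == i]eq_sym (negPf (neq_lift _ _)) mul0r subr0.
rewrite (expand_det_row _ i) (eq_bigr (fun j => M i j * (\adj (1%:M : 'M[K]_n)) j i)); last first.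
  by move=> j _; rewrite cM [(\adj _) _ _]mxE.
rewrite adj1 (bigD1 i) //= big1 ?addr0 => [|j /negPf ji]; last by rewrite !mxE ji mulr0.
by rewrite !mxE !eqxx A2 rmorph_nat /= !mulr1n; ring.
Qed.

Section Denominator.
Variables (N : nat) (m : P -> nat) (pos : pred 'I_N) (r : 'I_N -> mindex n).
Variables (U : 'I_N -> P -> K) (W : 'M[K]_n) (tau : 'I_n -> K) (c : K).
Hypothesis fd : freudenthal_data A m pos r U W tau c.
Local Notation rt := (wt al).

Lemma wfD mu nu kap : wf W (mu + nu) kap = wf W mu kap + wf W nu kap.
Proof. by rewrite /wf map_mxD !mulmxDl mxE. Qed.

Lemma wfC mu nu : wf W mu nu = wf W nu mu.
Proof.
transitivity ((map_mx intr mu *m W *m (map_mx intr nu)^T)^T 0 0); first by rewrite [RHS]mxE.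
by rewrite !trmx_mul trmxK (fd_sym fd) mulmxA.
Qed.

Lemma wfDr mu nu kap : wf W kap (mu + nu) = wf W kap mu + wf W kap nu.
Proof. by rewrite wfC wfD !(wfC _ kap). Qed.

Lemma wfMz mu nu z : wf W (mu *~ z) nu = z%:~R * wf W mu nu.
Proof.
rewrite /wf (_ : map_mx intr (mu *~ z) = z%:~R *: map_mx intr mu).
  by rewrite -!scalemxAl mxE.
by apply/rowP => j; rewrite -scaler_int intz !mxE rmorphM.
Qed.

Lemma wfN mu nu : wf W (- mu) nu = - wf W mu nu.
Proof. by rewrite -mulrN1z wfMz mulN1r. Qed.

Lemma wfE mu nu : wf W mu nu = \sum_b ((map_mx intr mu : 'rV[K]_n) *m W) 0 b * (nu 0 b)%:~R.
Proof. by rewrite /wf mxE; apply: eq_bigr => b _; rewrite !mxE. Qed.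

Lemma wf_refl i mu : wf W (refl A i mu) (refl A i mu) = wf W mu mu.
Proof.
rewrite /refl -mulrNz !(wfD, wfDr) !wfMz !(wfC _ (_ *~ _)) !wfMz (fd_alpha fd i mu).
rewrite (fd_alpha fd) simple_rootE A2 rmorphN /=; ring.
Qed.

(** Passage from coefficients on the alpha_b to exponents of the variables e^(- alpha_b / eps_b). *)
Definition ups k : mindex n := [ffun b => (ep b * k b)%N].

Lemma wt_ups k : wt' (ups k) = rt k.
Proof. by apply: eq_bigr => b _; rewrite ffunE al_ep mulrnA. Qed.

Definition ymono s : S := ps_mono K (ups (r s)).

Definition denom : S := \prod_(s | pos s) (1 - ymono s).

Definition denomF x : K := \prod_(s | pos s) (1 - wexp x (- rt (r s))).

Lemma prep_denom : prep denom denomF.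
Proof.
apply: prep_prod => s; apply: prepD; first exact: prep1.
by apply: prep_ext (prepN (prep_mono _)) _ => x _; rewrite wt_ups.
Qed.

Lemma ymono0 s : pos s -> ymono s 0 = 0.
Proof.
move=> ps; rewrite /ymono /ps_mono; case: eqP => // /esym/ffunP e.
have := fd_neq0 fd ps; have -> : r s = 0; last by rewrite eqxx.
apply/ffunP => b; have := e b; rewrite ffunE mindex0 => /eqP.
by rewrite muln_eq0 (gtn_eqF (ep_gt0 b)) => /eqP.
Qed.

Lemma denom0 : denom 0 = 1.
Proof.
rewrite /denom ps_prod_coef0 big1 // => s ps.
by rewrite psDE psNE ps1E eqxx ymono0 // subr0.
Qed.

(** The reflection permutes the factors of the roots other than alpha_i. The remaining factor,
    together with e^rho, which becomes e^(rho - alpha_i), changes sign. *)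
Lemma denom_antisym : antisymmetric denomF.
Proof.
move=> i x hx; have hx' := torus_refl A i hx.
rewrite wexp_refl // refl_rho wexpD //.
have split y : denomF y = (1 - wexp y (- al i)) *
    \prod_(beta <- [seq rt (r s) | s <- enum 'I_N & pos s && (r s != idelta i 1)])
      (1 - wexp y (- beta)).
  rewrite /denomF (bigID (fun s => r s == idelta i 1)) /=; congr (_ * _).
    rewrite (eq_bigr (fun=> 1 - wexp y (- al i))) => [|s /andP[_ /eqP ->]].
      by rewrite prodr_const (fd_simple fd) expr1.
    by rewrite wt_idelta mulr1n.
  by rewrite big_map big_filter big_enum_cond.
rewrite !split; set l := map _ _.
have -> : \prod_(beta <- l) (1 - wexp (refl_pt A i x) (- beta)) = \prod_(beta <- l) (1 - wexp x (- beta)).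
  transitivity (\prod_(beta <- [seq refl A i beta | beta <- l]) (1 - wexp x (- beta))).
    by rewrite big_map; apply: eq_bigr => beta _; rewrite wexp_refl // reflN.
  apply: perm_big; apply/allP => beta _ /=; apply/eqP.
  have cE (p : pred 'I_N) : count p (enum 'I_N) = #|p|.
    by rewrite -sum1_count big_enum_cond sum1_card.
  rewrite /l !count_map [LHS]count_filter [RHS]count_filter !cE;
  transitivity #|[pred s | [&& pos s, r s != idelta i 1 & rt (r s) == refl A i beta]]|.
    apply: eq_card => s; rewrite !inE /= (can2_eq (reflK A2 i) (reflK A2 i)).
    by rewrite andbC andbA.
  rewrite (fd_refl fd); apply: eq_card => s; rewrite !inE /=.
  by rewrite [RHS]andbC andbA.
rewrite wexp_refl // reflN refl_alpha // opprK wexpN //; have := wexp_neq0 (al i) hx => h.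
by field.
Qed.

(** [antisym_below_rho] is applied to the coefficients times |mu|^2 - |rho|^2, a
    reflection-invariant factor vanishing at rho. It stands in for the description of the support as
    the orbit of rho. *)
Lemma denom_norm k : denom k != 0 ->
  wf W (rho - wt' k) (rho - wt' k) = wf W rho rho.
Proof.
have [l [h1 h2 h3]] := prep_laurent rho prep_denom.
have anti i mu : lcoef l (refl A i mu) = - lcoef l mu.
  rewrite -mulN1r; apply: lcoef_refl => // x hx; have hx' := torus_refl A i hx.
  by rewrite -!h1 // denom_antisym // mulN1r.
have h := @antisym_below_rho l (fun mu => wf W mu mu - wf W rho rho) h3 anti _ _ (rho - wt' k).
move=> dk; have /eqP : (wf W (rho - wt' k) (rho - wt' k) - wf W rho rho) * denom k = 0.
  by rewrite -h2; apply: h => [i mu|]; rewrite ?wf_refl // subrr mul0r.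
by rewrite mulf_eq0 (negPf dk) orbF subr_eq0 => /eqP.
Qed.

Let v s : S := (1 - ymono s)^-1.

Let vK s : pos s -> v s * (1 - ymono s) = 1.
Proof.
by move=> ps; rewrite mulVr // ps_unitE psDE psNE ps1E eqxx ymono0 // subr0 oner_eq0.
Qed.

(** Logarithmic differentiation. As 2 rho is the sum of the positive roots, each root contributes
    beta_b (1 + 2 y/(1 - y)) = beta_b (1 + y)/(1 - y) to the doubled derivative. *)
Lemma denom_der b : ps_der al' rho b denom *+ 2 =
  denom * \sum_(s | pos s) ps_const (n := n) ((rt (r s)) 0 b)%:~R * (1 + ymono s) * v s.
Proof.
have dlog (Q : pred 'I_N) : {subset Q <= pos} ->
    ps_der al' 0 b (\prod_(s | Q s) (1 - ymono s)) = (\prod_(s | Q s) (1 - ymono s)) *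
      \sum_(s | Q s) ps_const (n := n) ((rt (r s)) 0 b)%:~R * ymono s * v s.
  move=> hQ; elim: (index_enum _) => [|s l IH]; first by rewrite !big_nil ps_der1 mulr0.
  rewrite !big_cons; case: ifP => // Qs; have ps := hQ _ Qs.
  rewrite ps_der0M IH mulrDr; congr (_ + _); last by rewrite mulrA.
  have -> : ps_der al' 0 b (1 - ymono s) = ps_const (n := n) ((rt (r s)) 0 b)%:~R * ymono s.
    rewrite ps_derD ps_der1 add0r; apply/funext => k; rewrite ps_constM /ps_der psNE /ymono /ps_mono.
    by case: eqP => [->|_]; rewrite ?oppr0 ?mulr0 // wt_ups sub0r mulrN1 !mxE rmorphN opprK mulr1.
  have gen (x y p u : S) : u * y = 1 -> x * p = y * p * (x * u).
    by move=> e; transitivity (x * p * (u * y)); [rewrite e mulr1|ring].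
  exact: gen (vK ps).
rewrite ps_der_shift mulrnDl.
rewrite -[ps_der _ _ _ _ *+ 2]mulr_natr (dlog pos) // -/denom.
have -> : ps_const (n := n) ((rho : P) 0 b)%:~R * denom *+ 2
    = denom * \sum_(s | pos s) ps_const (n := n) ((rt (r s)) 0 b)%:~R.
  have -> : \sum_(s | pos s) ps_const (n := n) ((rt (r s)) 0 b)%:~R = ps_const (n := n) 2 :> S.
    transitivity (ps_const (n := n) (\sum_(s | pos s) ((rt (r s)) 0 b)%:~R : K)).
      apply/funext => k; rewrite ps_sumE /ps_const; case: eqP => // _.
      by rewrite big1.
    congr ps_const; rewrite -rmorph_sum -(summxE (index_enum _) pos (fun s => rt (r s))).
    by rewrite (fd_sum fd) mxE.
  have -> : ps_const (n := n) (2 : K) = 1 + 1 :> S by rewrite -ps_const1 -ps_constD.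
  by rewrite mxE ps_const1 mul1r mulrDr mulr1 mulr2n.
rewrite -[X in _ + X]mulrA -mulrDr; congr (_ * _); rewrite mulr_natr -sumrMnl -big_split.
apply: eq_bigr => s ps /=.
have gen (x y u : S) : u * (1 - y) = 1 -> x * y * u *+ 2 + x = x * (1 + y) * u.
  by move=> e; rewrite -[X in _ + X]mulr1 -[X in _ + _ * X]e; ring.
by rewrite addrC; apply: gen (vK ps).
Qed.

Variable lam : P.
Hypothesis m_below : forall mu, m mu != 0%N -> exists k, mu = lam - rt k.
Hypothesis m_lam : m lam = 1%N.

Definition chi : S := fun k => (m (lam - wt' k))%:R.

Let Uh s : S := fun k => U s (lam - wt' k).
Let Dchi : S := fun k => wf W (lam - wt' k) (lam - wt' k) * chi k.
Let Xs s : S := fun k => wf W (rt (r s)) (lam - wt' k) * chi k.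

Let m_cone k l : (forall j, l + j != k) -> m (lam - wt' k + wt' l) = 0%N.
Proof.
move=> h; apply/eqP; apply: contrapT => /negP/m_below[j].
rewrite -wt_ups -addrA => /addrI/eqP.
rewrite (addrC (- _)) subr_eq (addrC (- _)) eq_sym subr_eq -wtD => /eqP/wt'_inj e1.
by have := h (ups j); rewrite -e1 eqxx.
Qed.

Let mono_Uh s k : (ymono s * Uh s) k = U s (lam - wt' k + rt (r s)).
Proof.
rewrite -wt_ups; case: (pselect (exists j, ups (r s) + j = k)) => [[j <-]|h].
  by rewrite ps_monoM_add /Uh wtD opprD addrA addrAC addrNK.
rewrite ps_monoM_eq0; last by move=> j; apply/eqP => e; apply: h; exists j.
apply/esym/(fd_U0 fd)/m_cone => j; apply/eqP => e; apply: h; exists j.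
exact: e.
Qed.

(** Freudenthal's relations as equations of series. A shift by a root is multiplication by
    [ymono s], also at the edge of the cone, where [m_cone] gives multiplicity 0; in [F2] the
    difference equation is solved by dividing by 1 - y. *)
Let F1 : ps_const (n := n) c * chi = Dchi + \sum_(s | pos s) (1 + ymono s) * Uh s.
Proof.
apply/funext => k; rewrite psDE ps_constM ps_sumE (fd_casimir fd); congr (_ + _).
by apply: eq_bigr => s _; rewrite mulrDl mul1r psDE mono_Uh.
Qed.

Let F2 s : pos s -> Uh s = v s * Xs s.
Proof.
move=> ps; suff -> : Xs s = (1 - ymono s) * Uh s by rewrite mulrA vK // mul1r.
by apply/funext => k; rewrite mulrBl mul1r psDE psNE mono_Uh /Uh (fd_diff fd).
Qed.

(** The product rule for the Laplacian on e^(lam + rho) chi denom. The gradient term is the root sum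
    of [F1], by [denom_der] and [F2], so with the Laplacian of chi it gives c; the Laplacian of the
    denominator gives |rho|^2 by [denom_norm]. *)
Lemma chi_denom_eigen k :
  wf W (lam + rho - wt' k) (lam + rho - wt' k) * (chi * denom) k
  = (c + wf W rho rho) * (chi * denom) k.
Proof.
pose G b : S := fun l => ((map_mx intr (lam - wt' l) : 'rV[K]_n) *m W) 0 b * chi l.
have cross : \sum_b G b * (ps_der al' rho b denom *+ 2)
    = denom * \sum_(s | pos s) (1 + ymono s) * Uh s.
  under eq_bigr do rewrite denom_der mulrCA mulr_sumr.
  rewrite -mulr_sumr exchange_big /=; congr (_ * _); apply: eq_bigr => s ps.
  rewrite F2 //.
  have -> : Xs s = \sum_b ps_const (n := n) ((rt (r s)) 0 b)%:~R * G b.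
    apply/funext => l; rewrite ps_sumE /Xs wfC wfE mulr_suml; apply: eq_bigr => b _.
    by rewrite ps_constM /G; ring.
  by rewrite !mulr_sumr; apply: eq_bigr => b _; ring.
have e : (fun k => wf W (lam + rho - wt' k) (lam + rho - wt' k) * (chi * denom) k)
   = Dchi * denom + \sum_b G b * (ps_der al' rho b denom *+ 2)
     + ps_const (n := n) (wf W rho rho) * chi * denom :> S.
  apply/funext => j; rewrite !psDE -mulrA ps_constM ps_sumE !psME !mulr_sumr.
  rewrite [\sum_b (G b * _) j](eq_bigr _ (fun i _ => psME _ _ _)).
  rewrite exchange_big -!big_split /= big_seq [RHS]big_seq; apply: eq_bigr => -[l l'].
  rewrite mem_splits => /eqP /= <-.
  have -> : lam + rho - wt' (l + l') = (lam - wt' l) + (rho - wt' l').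
    by rewrite wtD opprD addrACA.
  have -> : \sum_b G b l * (ps_der al' rho b denom *+ 2) l'
     = 2 * wf W (lam - wt' l) (rho - wt' l') * (chi l * denom l').
    rewrite wfE mulr_sumr mulr_suml; apply: eq_bigr => b _.
    by rewrite mulr2n psDE /ps_der /G; ring.
  have gen B C : wf W (B + C) (B + C) = wf W B B + 2 * wf W B C + wf W C C.
    by rewrite !(wfD, wfDr) (wfC C B); ring.
  rewrite gen /Dchi; case: (eqVneq (denom l') 0) => [->|/denom_norm <-]; first by ring.
  by ring.
move/(congr1 (fun f : S => f k)): e => /= ->; rewrite cross addrC.
have -> : Dchi * denom = denom * Dchi by rewrite mulrC.
rewrite -mulrDr -F1.
have -> : ps_const (n := n) (wf W rho rho) * chi * denom + denom * (ps_const (n := n) c * chi)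
  = ps_const (n := n) (c + wf W rho rho) * (chi * denom).
  by rewrite ps_constD; ring.
by rewrite ps_constM.
Qed.

Lemma wf_half b nu : wf W (al' b) nu = tau b / (ep b)%:R * (nu 0 b)%:~R.
Proof.
have e0 : (ep b)%:R != 0 :> K by rewrite pnatr_eq0 -lt0n.
have := fd_alpha fd b nu; rewrite al_ep pmulrn wfMz -pmulrn => h.
by apply: (mulfI e0); rewrite h; field.
Qed.

(** A nonzero coefficient at [k] has the eigenvalue of the leading one, so lam + rho and lam + rho -
    wt' k have equal norm and wt' k is orthogonal to their sum [nu]. All coordinates of [nu] are
    positive, whence k = 0. *)
Lemma chi_denom_dominant k : dominant lam -> dominant (lam - wt' k) ->
  (chi * denom) k = (k == 0)%:R.
Proof.
move=> dl dk; have chi0 : (chi * denom) 0 = 1.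
  by rewrite ps_mul_coef0 denom0 mulr1 /chi wt0 subr0 m_lam.
case: (eqVneq k 0) => [-> //|k0]; apply/eqP; apply: contrapT => /negP ck.
have e0 := chi_denom_eigen 0; rewrite chi0 !mulr1 wt0 subr0 in e0.
have := chi_denom_eigen k; move/(mulIf ck); rewrite -e0 => h.
pose nu := lam + rho + (lam + rho - wt' k).
have gen B C : wf W C C = wf W B B -> wf W (B - C) (B + C) = 0.
  by move=> e; rewrite wfD wfN !wfDr (wfC C B) e; ring.
have hw : wf W (wt' k) nu = 0.
  by have := gen _ _ h; rewrite opprB addrCA subrr addr0.
have nu_gt0 b : 0 < nu 0 b.
  have := dl b; have := dk b; rewrite /nu !mxE => h1 h2.
  by move: h1 h2; move: (wt' k 0 b) (lam 0 b) => y z; lia.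
have hs : wf W (wt' k) nu = \sum_b (k b)%:R * (tau b / (ep b)%:R * (nu 0 b)%:~R).
  rewrite /wt; elim/big_rec2: _ => [|b x y _ <-].
    by rewrite -(mulr0z 0) wfMz mul0r.
  by rewrite wfD pmulrn wfMz wf_half -pmulrn.
case/eqP: k0; apply/ffunP => b; rewrite mindex0; apply/eqP.
have pb b' : 0 < tau b' / (ep b')%:R * (nu 0 b')%:~R.
  by rewrite mulr_gt0 ?divr_gt0 ?ltr0n ?ltr0z // (fd_tau fd).
have ge b' : 0 <= (k b')%:R * (tau b' / (ep b')%:R * (nu 0 b')%:~R).
  by rewrite mulr_ge0 // ltW.
have := psumr_eq0P (fun b' _ => ge b') (etrans (esym hs) hw) (i := b) isT.
by move/eqP; rewrite mulf_eq0 (gt_eqF (pb b)) orbF pnatr_eq0.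
Qed.

End Denominator.

Hypothesis A_conn : forall Q : pred 'I_n,
  (forall i j, Q i -> A i j != 0 -> Q j) -> forall i j, Q i -> Q j.

(** By connectedness either all raising operators vanish or none does. In the second case [denom] is
    built from the operators of this [V], and [antisym_unique] identifies it with [J]; hence one [J]
    serves all modules. *)
Theorem weyl_character (V : chevalley_module K A) (lam : P) (J : S) F k :
  mod_irreducible V -> has_highest_weight V lam -> dominant lam ->
  prep J F -> antisymmetric F -> J 0 = 1 -> dominant (lam - wt' k) ->
  (chi (wmult V) lam * J) k = (k == 0)%:R.
Proof.
move=> Virr Vhw dl pJ aJ J0 dk.
have e0 : (forall i, mod_e V i = 0) \/ (forall i, mod_e V i != 0).
  case: (pselect (exists i, mod_e V i = 0)) => [[i ei]|h]; last first.
    by right=> i; apply/eqP => e; apply: h; exists i.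
  left=> j; apply/eqP; apply: (A_conn (Q := fun j => mod_e V j == 0) _ (i := i)); last exact/eqP.
  move=> {}i {}j /eqP {}ei Aij.
  have h0 : mod_h V i = 0.
    have := mod_ef V i i; rewrite eqxx => <-.
    by apply/lfunP => u; rewrite bracketE ei !lfunE /= linear0 subrr.
  have := mod_he V i j; rewrite h0 => h.
  have : (A i j)%:~R *: mod_e V j = 0.
    by rewrite -h; apply/lfunP => u; rewrite bracketE !lfunE /= linear0 subrr.
  by move/eqP; rewrite scaler_eq0 intr_eq0 (negPf Aij).
case: e0 => [/(wmult_trivial A2 A_pos Virr Vhw)[l0 m0]|e0].
  have -> : chi (wmult V) lam = 1.
    apply/funext => l; rewrite ps1E /chi m0 l0 sub0r oppr_eq0 -(wt0 al') (inj_eq wt'_inj).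
    by case: eqP.
  rewrite mul1r; case: (eqVneq k 0) => [-> //|k0].
  case/eqP: k0; apply: wt'_dominant => i; have := dk i.
  by rewrite l0 sub0r mxE oppr_ge0.
have [N [pos [r [U [W [tau [c fd]]]]]]] := freudenthal_dataP A2 A_pos Virr Vhw e0.
have -> : J = denom pos r.
  apply: (antisym_unique pJ (prep_denom pos r) aJ (denom_antisym fd)).
  by rewrite J0 (denom0 fd).
by apply: (chi_denom_dominant fd (wmult_below A_pos Virr Vhw) (wmult_lam A_pos Virr Vhw)).
Qed.

End WeylFormula.

(** * The real-valued modulus of a complex number *)

Section ComplexNorm.
Variable R : rcfType.
Implicit Types z : R[i].

(** The norm of [R[i]] takes values in [R[i]]; its real part lies in an ordered field, where
    estimates can be decided. *)
Definition nm z : R := complex.Re `|z|.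

Lemma nmE z : `|z| = (nm z)%:C%C.
Proof. by rewrite /nm RRe_real // normr_real. Qed.

Let inj : injective (fun r : R => r%:C%C). Proof. exact: complexI. Qed.

Lemma nm_ge0 z : 0 <= nm z. Proof. by rewrite -lecR -nmE normr_ge0. Qed.
Lemma nmD z z' : nm (z + z') <= nm z + nm z'.
Proof. by rewrite -lecR rmorphD /= -!nmE ler_normD. Qed.
Lemma nmM z z' : nm (z * z') = nm z * nm z'.
Proof. by apply: inj; rewrite rmorphM /= -!nmE normrM. Qed.
Lemma nm1 : nm 1 = 1. Proof. by apply: inj; rewrite -nmE normr1. Qed.
Lemma nm0 : nm 0 = 0. Proof. by apply: inj; rewrite -nmE normr0. Qed.
Lemma nmN z : nm (- z) = nm z. Proof. by apply: inj; rewrite -!nmE normrN. Qed.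
Lemma nm_eq0 z : (nm z == 0) = (z == 0).
Proof. by rewrite -(inj_eq inj) -nmE normr_eq0. Qed.
Lemma nmV z : nm z^-1 = (nm z)^-1.
Proof. by apply: inj; rewrite fmorphV /= -!nmE normfV. Qed.
Lemma nmX z j : nm (z ^+ j) = nm z ^+ j.
Proof. by elim: j => [|j IH]; rewrite ?nm1 // !exprS nmM IH. Qed.
Lemma nm_nat j : nm j%:R = j%:R.
Proof. by apply: inj; rewrite -nmE rmorph_nat normr_nat. Qed.
Lemma nm_prod (J : Type) (r : seq J) (Q : pred J) (F : J -> R[i]) :
  nm (\prod_(j <- r | Q j) F j) = \prod_(j <- r | Q j) nm (F j).
Proof. by elim/big_rec2: _ => [|j x y _ <-]; rewrite ?nm1 ?nmM. Qed.
Lemma nm_sum (J : Type) (r : seq J) (Q : pred J) (F : J -> R[i]) :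
  nm (\sum_(j <- r | Q j) F j) <= \sum_(j <- r | Q j) nm (F j).
Proof.
elim/big_rec2: _ => [|j x y _ h]; first by rewrite nm0.
by apply: le_trans (nmD _ _) _; rewrite lerD2l.
Qed.
Lemma nm_dist z z' : nm z - nm z' <= nm (z - z').
Proof. by rewrite lerBlDr -{1}(subrK z' z) nmD. Qed.

End ComplexNorm.

(** * Estimates for ratios of consecutive solutions *)

Section Ratios.
Variables (n : nat) (al : 'I_n -> 'rV[int]_n) (t : 'I_n -> nat).
Hypothesis t_gt0 : forall a, (0 < t a)%N.
Hypothesis t_dvd : forall a j b i,
  ((t b)%:Z %| al a ord0 b * (minn (t a * i) (t b * j))%:Z)%Z.
Variable E : 'I_n -> nat -> 'I_n -> nat -> nat.
Hypothesis E_def : forall a j b k, (0 < j)%N -> (0 < k)%N ->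
  (E a j b k)%:Z = ((a == b) && (j == k))%:Z *+ 2 - lapl (cmin al t a j b) k.

Let cK a j b i : cmin al t a j b i * (t b)%:Z = al a ord0 b * (minn (t a * i) (t b * j))%:Z.
Proof. exact: divzK. Qed.

(** Where t_a (k - 1) >= t_b j, the minimum in [cmin] is constant around k and its second difference
    vanishes. *)
Lemma E_support a j b k : (0 < j)%N -> (0 < k)%N -> E a j b k != 0%N ->
  (a == b) && (j == k) \/ (t a * k.-1 < t b * j)%N.
Proof.
move=> j0 k0 e; case: (boolP ((a == b) && (j == k))) => [|h]; [by left|right].
rewrite ltnNge; apply: contra e => h2; rewrite -eqz_nat E_def // (negPf h) mul0rn sub0r.
have hm i : (k.-1 <= i)%N -> minn (t a * i) (t b * j) = (t b * j)%N.
  by move=> ki; apply/minn_idPr; apply: leq_trans h2 _; rewrite leq_mul2l ki orbT.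
rewrite /lapl /cmin !hm //; try lia.
Qed.

Lemma sum_lapl (f : nat -> int) N : f 0%N = 0 ->
  \sum_(1 <= k < N.+1) k%:Z * lapl f k = N.+1%:Z * f N - N%:Z * f N.+1.
Proof.
move=> f0; elim: N => [|N IH]; first by rewrite big_geq // f0; ring.
by rewrite big_nat_recr //= IH /lapl /= -[N.+2]addn2 -[N.+1]addn1 !PoszD; ring.
Qed.

(** Summation by parts. This is coordinate [b] of 2 j Lambda_a - j al_a, the leading weight of the
    second term of the Q-system. *)
Lemma sum_E a j b N : (0 < j)%N -> (t b * j <= N)%N -> (j <= N)%N ->
  ((\sum_(1 <= k < N.+1) k * E a j b k)%N)%:Z = ((a == b)%:Z *+ 2 - al a ord0 b) * j%:Z.
Proof.
move=> j0 hN jN.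
have -> : ((\sum_(1 <= k < N.+1) k * E a j b k)%N)%:Z = \sum_(1 <= k < N.+1) k%:Z * (E a j b k)%:Z.
  by elim/big_rec2: _ => // k x y _ <-; rewrite PoszD PoszM.
rewrite big_nat (eq_bigr (fun k => k%:Z * (((a == b) && (j == k))%:Z *+ 2)
   - k%:Z * lapl (cmin al t a j b) k)); last first.
  by move=> k /andP[k0 _]; rewrite E_def // mulrBr.
rewrite -big_nat sumrB sum_lapl ?cmin0 // (cmin_const al t_gt0) //.
have tb : (t b)%:Z != 0 by rewrite -lt0n.
have hc : cmin al t a j b N = al a ord0 b * j%:Z.
  apply: (mulIf tb); rewrite cK (minn_idPr _) ?PoszM; first by ring.
  by apply: leq_trans hN _; rewrite leq_pmull.
rewrite -mulrBl hc (bigD1_seq j) ?iota_uniq //=; last by rewrite mem_index_iota j0 ltnS.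
rewrite (eqxx j) andbT big1 ?addr0 => [|k /negPf kj]; last first.
  by rewrite [j == k]eq_sym kj andbF mul0rn mulr0.
by rewrite -[N.+1]addn1 PoszD; ring.
Qed.

Variables (R : rcfType) (c : 'I_n -> nat -> R[i]) (Y : 'I_n -> R[i]).
Hypothesis c0 : forall a, c a 0%N = 1.
Hypothesis Qsys : forall a j N, (0 < j)%N -> (forall b, t b * j < N)%N ->
  c a j ^+ 2 = c a j.+1 * c a j.-1 + Y a ^+ j * \prod_b \prod_(1 <= k < N.+1) c b k ^+ E a j b k.
Variables (D : nat) (th : R).
Hypothesis D_ge : forall a, \sum_b ((a == b)%:Z *+ 2 - al a ord0 b) + 2 <= D%:Z.
Hypothesis th_small : th <= 1 / 16.
Hypothesis Y_small : forall a, nm (Y a) * 2 ^+ D <= th.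
Hypothesis c1_small : forall a, nm (c a 1%N - 1) <= 1 / 8.

Let ratio a j := c a j / c a j.+1.
(** The distance to 1 stays below 1/2, and the term 2^(-j)/4 makes room for the increment: th <=
    1/16 gives 2 th^j <= 2^(-j)/4, by which the bound grows from j - 1 to j. *)
Let good a j := [/\ c a j != 0, c a j.+1 != 0,
  nm (ratio a j - 1) <= 1 / 2 - 1 / 4 * (1 / 2) ^+ j &
  (0 < j)%N -> nm (ratio a j - ratio a j.-1) <= 2 * th ^+ j].

Let th0 (a : 'I_n) : 0 <= th.
Proof. by apply: le_trans (Y_small a); rewrite mulr_ge0 ?nm_ge0 ?exprn_ge0. Qed.

Let half0 j : 0 <= (1 / 2 : R) ^+ j.
Proof. by apply: exprn_ge0; lra. Qed.

Let pow_le (x : R) j : 0 <= x <= 1 -> (0 < j)%N -> x ^+ j <= x.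
Proof.
by case: j => // j /andP[x0 x1] _; rewrite exprS ler_piMr // exprn_ile1.
Qed.

Let th_exp (a : 'I_n) j : th ^+ j <= (1 / 2) ^+ j.
Proof.
by have h := th0 a; apply: lerXn2r; rewrite ?nnegrE; move: h th_small; lra.
Qed.

Let good_nm a j : good a j -> 1 / 2 <= nm (ratio a j) <= 3 / 2.
Proof.
move=> [_ _ h _]; have p := half0 j.
have := nm_dist 1 (ratio a j); have := nm_dist (ratio a j) 1.
by rewrite -(nmN (1 - _)) opprB nm1; lra.
Qed.

Let c_bound b k : (forall i, (i < k)%N -> good b i) ->
  [/\ c b k != 0, nm (c b k) <= 2 ^+ k & (1 / 2) ^+ k <= nm (c b k)].
Proof.
elim: k => [|k IH] h; first by rewrite c0 nm1 oner_eq0.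
have [ck h1 h2] := IH (fun i ik => h i (ltnW ik)).
have gk := h k (ltnSn k); have /andP[r1 r2] := good_nm gk; have [_ c1 _ _] := gk.
have r0 : 0 < nm (ratio b k) by lra.
have e : nm (c b k) = nm (ratio b k) * nm (c b k.+1).
  by rewrite -nmM /ratio divfK.
have p := nm_ge0 (c b k.+1); split=> //.
  by rewrite exprS; nra.
by rewrite exprS; nra.
Qed.

(** The second term of the Q-system divided by c_j^2, so that ratio_j (1 - w_j) = ratio_(j-1). *)
Let w a j : R[i] :=
  Y a ^+ j * \prod_b \prod_(1 <= k < (j + \sum_b t b * j).+2) c b k ^+ E a j b k / c a j ^+ 2.

(** Ratios between 1/2 and 3/2 keep the modulus of c_k between 2^(-k) and 2^k. The product is thus
    at most 2^W and the division by c_j^2 costs 2^(2j); [D] is chosen with W + 2j <= D j. *)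
Let w_bound a j : (0 < j)%N ->
  (forall b i, (t a * i < t b * j)%N -> good b i) -> nm (w a j) <= th ^+ j.
Proof.
move=> j0 h; set N := (j + \sum_b t b * j).+1.
have hN b : (t b * j <= N)%N by rewrite /N (bigD1 b) //=; lia.
have cb b k : (0 < k)%N -> E a j b k != 0%N -> nm (c b k) <= 2 ^+ k.
  move=> k0 /(E_support j0 k0) hs; case: (@c_bound b k) => // i ik; apply: h.
  case: hs => [/andP[/eqP ab /eqP jk]|]; first by rewrite -ab ltn_pmul2l ?t_gt0 // jk.
  by apply: leq_ltn_trans; rewrite leq_mul2l; lia.
have [ca _ ca2] : [/\ c a j != 0, nm (c a j) <= 2 ^+ j & (1 / 2) ^+ j <= nm (c a j)].
  by apply: c_bound => i ij; apply: h; rewrite ltn_pmul2l.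
pose W := (\sum_b \sum_(1 <= k < N.+1) k * E a j b k)%N.
have hP : nm (\prod_b \prod_(1 <= k < N.+1) c b k ^+ E a j b k) <= 2 ^+ W.
  rewrite /W nm_prod -prodrXr; apply: ler_prod => b _; rewrite nm_ge0 nm_prod -prodrXr /=.
  rewrite big_nat [X in _ <= X]big_nat; apply: ler_prod => k /andP[k0 _].
  rewrite nm_ge0 nmX exprM /=; case: (eqVneq (E a j b k) 0%N) => [->|e]; first by rewrite !expr0.
  by rewrite lerXn2r ?nnegrE ?nm_ge0 ?exprn_ge0 // cb.
have hW : (W + 2 * j <= D * j)%N.
  have : W%:Z = \sum_b ((a == b)%:Z *+ 2 - al a ord0 b) * j%:Z.
    rewrite /W (big_morph Posz PoszD (erefl _)); apply: eq_bigr => b _; rewrite sum_E //.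
    by rewrite /N; lia.
  rewrite -mulr_suml; have := D_ge a; move: (\sum_b _) => u hu hw.
  by rewrite -lez_nat PoszD !PoszM hw -mulrDl ler_wpM2r.
have ca20 : 0 < (1 / 2 : R) ^+ j by apply: exprn_gt0; lra.
rewrite /w -/N nmM nmV [nm (_ ^+ 2)]nmX nmM [nm (_ ^+ j)]nmX.
have hY := lerXn2r j (_ : nm (Y a) * 2 ^+ D \in Num.nneg) (_ : th \in Num.nneg) (Y_small a).
apply: le_trans (hY _ _); rewrite ?nnegrE ?(th0 a) ?mulr_ge0 ?nm_ge0 ?exprn_ge0 //.
rewrite exprMn -mulrA ler_wpM2l ?exprn_ge0 ?nm_ge0 // -exprM.
have c20 : 0 < nm (c a j) by lra.
rewrite ler_pdivrMr ?exprn_gt0 //; apply: le_trans hP _.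
apply: le_trans (_ : 2 ^+ (D * j) * ((1 / 2) ^+ j) ^+ 2 <= _); last first.
  by rewrite ler_wpM2l ?exprn_ge0 // lerXn2r ?nnegrE // ltW.
have -> : 2 ^+ (D * j) * ((1 / 2) ^+ j) ^+ 2 = 2 ^+ (D * j - 2 * j) :> R.
  have e : (D * j = D * j - 2 * j + 2 * j)%N by lia.
  rewrite {1}e exprD -mulrA -exprM [(j * 2)%N]mulnC -exprMn.
  by rewrite mul1r mulfV ?pnatr_eq0 // expr1n mulr1.
by rewrite ler_weXn2l ?ler1n //; lia.
Qed.

Let good0 a : good a 0.
Proof.
have h := c1_small a; have h1 := nm_dist 1 (c a 1%N).
rewrite -[nm (1 - _)]nmN opprB nm1 in h1.
have p : 0 < nm (c a 1%N) by lra.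
have c10 : c a 1%N != 0 by rewrite -nm_eq0 gt_eqF.
split=> //; first by rewrite c0 oner_eq0.
rewrite /ratio c0 expr0 mul1r.
have -> : (c a 1%N)^-1 - 1 = - (c a 1%N - 1) / c a 1%N by field.
by rewrite nmM nmN nmV ler_pdivrMr //; lra.
Qed.

(** The hypothesis covers all pairs of smaller level i / t_b < j / t_a. By [E_support] this controls
    every c_k occurring in [w a j], although k itself may exceed j. *)
Let good_step a j : (0 < j)%N -> (forall b i, (t a * i < t b * j)%N -> good b i) -> good a j.
Proof.
move=> j0 h; have hw := w_bound j0 h; set N := (j + \sum_b t b * j).+1.
have hN b : (t b * j < N)%N by rewrite /N (bigD1 b) //=; lia.
have gj : good a j.-1 by apply: h; rewrite ltn_pmul2l ?t_gt0 // prednK.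
have /andP[r1 r2] := good_nm gj; have [cj1 cj rj _] := gj; rewrite prednK // in cj.
have thj : th ^+ j <= (1 / 2) ^+ j * (1 / 8).
  have : th ^+ j <= (1 / 16) ^+ j.
    by have h0 := th0 a; apply: lerXn2r; rewrite ?nnegrE //; lra.
  move/le_trans; apply; have -> : 1 / 16 = 1 / 2 * (1 / 8) :> R by field.
  by rewrite exprMn ler_wpM2l ?half0 // pow_le //; lra.
have p2 : (1 / 2 : R) ^+ j <= 1 / 2 by apply: pow_le => //; lra.
have q := @Qsys a j N j0 hN; rewrite -/N in q.
have q2 : c a j ^+ 2 * (1 - w a j) = c a j.+1 * c a j.-1.
  rewrite mulrBr mulr1 /w -/N [X in _ - X]mulrC divfK ?expf_neq0 // {1}q.
  by rewrite addrK.
have h1 := nm_dist 1 (w a j); rewrite nm1 in h1.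
have w1 : 15 / 16 <= nm (1 - w a j) by lra.
have w0 : 1 - w a j != 0 by rewrite -nm_eq0 gt_eqF //; lra.
have cj2 : c a j.+1 != 0.
  apply/eqP => e; have /eqP := q2; rewrite e mul0r mulf_eq0 expf_eq0 (negPf cj) (negPf w0).
  by rewrite andbF.
have er : ratio a j * (1 - w a j) = ratio a j.-1.
  rewrite /ratio prednK //; apply: (mulfI cj2); apply: (mulfI cj).
  have -> : c a j * (c a j.+1 * (c a j / c a j.+1 * (1 - w a j)))
    = c a j ^+ 2 * (1 - w a j) by field.
  by rewrite q2; field.
have nr : nm (ratio a j) <= 2.
  have := congr1 (@nm R) er; rewrite nmM => e; have := nm_ge0 (ratio a j); nra.
have ed : nm (ratio a j - ratio a j.-1) <= 2 * th ^+ j.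
  have -> : ratio a j - ratio a j.-1 = ratio a j * w a j by rewrite -er; ring.
  by rewrite nmM ler_pM ?nm_ge0.
split=> //; have -> : ratio a j - 1 = (ratio a j - ratio a j.-1) + (ratio a j.-1 - 1) by ring.
apply: le_trans (nmD _ _) _; move: ed rj thj.
have -> : (1 / 2 : R) ^+ j.-1 = 2 * (1 / 2) ^+ j by rewrite -[in RHS](prednK j0) exprS; field.
by lra.
Qed.

Lemma ratio_good a j : good a j.
Proof.
pose T := (\prod_b t b)%N; pose lev a j := (j * (T %/ t a))%N.
have tT b : (t b * (T %/ t b) = T)%N.
  by rewrite mulnC divnK // /T (bigD1 b) //= dvdn_mulr.
have T0 : (0 < T)%N by rewrite prodn_gt0.
have [N] := ubnP (lev a j); elim: N a j => // N IH a j hN.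
case: (posnP j) => [->|j0]; first exact: good0.
apply: good_step => // b i hi; apply: IH; apply: leq_trans (_ : lev a j <= N)%N; last by [].
have h : (t a * t b * lev b i < t a * t b * lev a j)%N.
  have -> : (t a * t b * lev b i = t a * i * T)%N.
    by have := tT b; rewrite /lev; move: (T %/ _)%N => q <-; ring.
  have -> : (t a * t b * lev a j = t b * j * T)%N.
    by have := tT a; rewrite /lev; move: (T %/ _)%N => q <-; ring.
  by rewrite ltn_pmul2r.
by move: h; rewrite ltn_pmul2l // muln_gt0 !t_gt0.
Qed.

(** Summing the increments from j up to the limit 1 bounds the distance of ratio_j from 1 by 4
    th^(j+1). The factor 2^(j+1) comes from the bound on c_(j+1). *)
Theorem ratio_limit a j :
  (forall e, 0 < e -> exists m, forall i, (m <= i)%N -> nm (ratio a i - 1) < e) ->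
  nm (c a j - c a j.+1) <= 4 * (2 * th) ^+ j.+1.
Proof.
move=> hl; have thp m : 0 <= th ^+ m by rewrite exprn_ge0 ?(th0 a).
have tail m : nm (ratio a (j + m) - ratio a j) <= 4 * th ^+ j.+1 * (1 - (1 / 2) ^+ m).
  elim: m => [|m IH]; first by rewrite addn0 subrr nm0 expr0 subrr mulr0.
  rewrite addnS; have [_ _ _ /(_ isT) h] := ratio_good a (j + m).+1; rewrite /= in h.
  have -> : ratio a (j + m).+1 - ratio a j
    = (ratio a (j + m).+1 - ratio a (j + m)) + (ratio a (j + m) - ratio a j) by ring.
  apply: le_trans (nmD _ _) _; move: h IH; rewrite -addSn exprD.
  have e1 : (1 / 2 : R) ^+ m.+1 = 1 / 2 * (1 / 2) ^+ m by rewrite exprS.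
  have := ler_wpM2l (thp j.+1) (th_exp a m); rewrite e1.
  move: (th ^+ j.+1) (th ^+ m) ((1 / 2) ^+ m) (nm _) (nm _) => x y z u v.
  by lra.
have h : nm (ratio a j - 1) <= 4 * th ^+ j.+1.
  apply/ler_addgt0Pr => e e0; have [m hm] := hl e e0.
  have := hm (j + m)%N (leq_addl _ _); have := tail m.
  have -> : ratio a j - 1 = - (ratio a (j + m) - ratio a j) + (ratio a (j + m) - 1) by ring.
  move=> h1 h2; apply: le_trans (nmD _ _) _; rewrite nmN.
  have p := half0 m.
  by have := thp j.+1; nra.
have [_ c1 _ _] := ratio_good a j.
have [_ c2 _] := @c_bound a j.+1 (fun i _ => ratio_good a i).
have -> : c a j - c a j.+1 = c a j.+1 * (ratio a j - 1).
  by rewrite /ratio mulrBr mulr1 mulrC divfK.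
rewrite nmM exprMn mulrCA; apply: ler_pM => //; exact: nm_ge0.
Qed.

End Ratios.

(** * Polynomials that are small at the points 1/N *)

Section SmallPolynomial.
Variable R : realType.
Local Notation C := R[i].

Definition coef_bound (p : {poly C}) : R := \sum_(i < size p) nm p`_i.

Lemma coef_bound_ge0 p : 0 <= coef_bound p.
Proof. by apply: sumr_ge0 => i _; apply: nm_ge0. Qed.

Lemma horner_bound (p : {poly C}) z : nm z <= 1 -> nm p.[z] <= coef_bound p.
Proof.
move=> hz; rewrite horner_coef; apply: le_trans (nm_sum _ _ _) _.
apply: ler_sum => i _; rewrite nmM nmX ler_piMr ?nm_ge0 //.
by rewrite exprn_ile1 ?nm_ge0.
Qed.

Lemma nm_inv_nat N : nm (N%:R^-1 : C) = N%:R^-1.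
Proof. by rewrite nmV nm_nat. Qed.

Lemma inv_nat_le1 N : (0 < N)%N -> (N%:R : R)^-1 <= 1.
Proof. by move=> N0; rewrite invf_le1 ?ltr0n // ler1n. Qed.

Lemma small_eq0 (x B : R) N0 : 0 <= x ->
  (forall N, (N0 < N)%N -> x <= B * N%:R^-1) -> x = 0.
Proof.
move=> x0 h; apply/eqP; rewrite eq_le x0 andbT leNgt; apply/negP => xp.
have B0 : 0 <= `|B| / x by rewrite divr_ge0.
have := archi_boundP B0; set m := Num.bound _ => hm.
have := h (N0 + m).+1 (leq_addr _ _); rewrite leNgt => /negP; apply.
rewrite ltr_pdivrMr ?ltr0n // mulrC -ltr_pdivrMr //.
apply: le_lt_trans (_ : `|B| / x < _); first by rewrite ler_wpM2r ?invr_ge0 ?ler_norm // ltW.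
by apply: lt_le_trans hm _; rewrite ler_nat; lia.
Qed.

Lemma poly_small0 (q : {poly C}) c (B : R) N0 j :
  (forall N, (N0 < N)%N -> nm (q * 'X + c%:P).[N%:R^-1] <= B * N%:R^-1 ^+ j.+1) -> c = 0.
Proof.
move=> h; apply/eqP; rewrite -nm_eq0; apply/eqP.
apply: (@small_eq0 _ (`|B| + coef_bound q) N0); first exact: nm_ge0.
move=> N hN; have N1 : (0 < N)%N by apply: leq_ltn_trans hN.
have := h N hN; rewrite hornerMXaddC => h1.
have := nmD (q.[N%:R^-1] * N%:R^-1 + c) (- (q.[N%:R^-1] * N%:R^-1)).
rewrite [X in nm X <= _]addrAC subrr add0r nmN nmM nm_inv_nat => h2; apply: le_trans h2 _.
have iN : 0 <= (N%:R : R)^-1 by rewrite invr_ge0.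
have i1 := inv_nat_le1 N1.
rewrite mulrDl lerD //; last by rewrite ler_wpM2r // horner_bound // nm_inv_nat.
apply: le_trans h1 _; apply: le_trans (_ : `|B| * N%:R^-1 ^+ j.+1 <= _).
  by rewrite ler_wpM2r ?exprn_ge0 // ler_norm.
by rewrite ler_wpM2l // exprS ler_piMr // exprn_ile1.
Qed.

(** The constant term is the limit of the values, hence 0; dividing by the variable lowers the order
    of the estimate by one. *)
Lemma poly_small (p : {poly C}) (B : R) N0 j :
  (forall N, (N0 < N)%N -> nm p.[N%:R^-1] <= B * N%:R^-1 ^+ j.+1) ->
  forall i, (i <= j)%N -> p`_i = 0.
Proof.
elim: j p => [|j IH] p; elim/poly_ind: p => [|q c _] h i ij; rewrite ?coef0 //.
  by move: ij h; rewrite leqn0 => /eqP -> /poly_small0 ->; rewrite addr0 coefMX.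
have c0 := poly_small0 h; rewrite c0 addr0 in h *; rewrite coefMX.
case: i ij => //= i ij; apply: IH ij => N hN; have := h N hN.
have N1 : (0 < N)%N by apply: leq_ltn_trans hN.
rewrite hornerMX nmM nm_inv_nat exprSr mulrA ler_pM2r //.
by rewrite invr_gt0 ltr0n.
Qed.

End SmallPolynomial.

(** * From the pointwise limit to stability of coefficients *)

Section Stability.
Variables (R : realType) (n : nat) (A : 'M[int]_n).
Local Notation C := R[i].
Local Notation P := 'rV[int]_n.
Local Notation al := (simple_root A).
Hypothesis A_pos : forall k : 'I_n -> rat, (exists b, k b != 0) ->
  exists i, 0 < k i * \sum_j (A i j)%:~R * k j.
Variables (al' : 'I_n -> P) (ep : 'I_n -> nat).
Hypothesis ep_gt0 : forall b, (0 < ep b)%N.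
Hypothesis al_ep : forall b, al b = al' b *+ ep b.
Variables (ht : {additive P -> int}) (M : 'I_n -> nat).
Hypothesis M_gt0 : forall b, (0 < M b)%N.
Hypothesis ht_al : forall b, ht (al' b) = (M b)%:Z.
Local Notation wt' := (wt al').
Local Notation S := (pseries n C).

(** Moving a point to infinity inside the domain of convergence. *)
Definition scale (xi : 'I_n -> C) (N : nat) : 'I_n -> C :=
  fun a => xi a * N%:R ^ ht (fund_weight a).

Lemma torus_scale xi N : torus xi -> (0 < N)%N -> torus (scale xi N).
Proof. by move=> hx N0 a; rewrite mulf_neq0 ?expfz_neq0 // pnatr_eq0 -lt0n. Qed.

Lemma wexp_scale xi N mu : torus xi -> (0 < N)%N -> wexp (scale xi N) mu = wexp xi mu * N%:R ^ ht mu.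
Proof.
move=> hx N0; have N1 : (N%:R : C) != 0 by rewrite pnatr_eq0 -lt0n.
have -> : ht mu = \sum_a ht (fund_weight a) * mu 0 a.
  have {1}-> : mu = \sum_a fund_weight a *~ mu 0 a.
    by rewrite sum_fund_weight; apply/rowP => a; rewrite mxE.
  by rewrite raddf_sum; apply: eq_bigr => a _; rewrite raddfMz -mulrzr intz.
have -> : (N%:R : C) ^ (\sum_a ht (fund_weight a) * mu 0 a)
    = \prod_a N%:R ^ (ht (fund_weight a) * mu 0 a).
  by elim/big_rec2: _ => [|a y z _ <-]; rewrite ?expr0z // expfzDr.
rewrite /wexp -big_split; apply: eq_bigr => a _ /=.
by rewrite /scale exprzMl ?unitfE ?expfz_neq0 // exprz_exp.
Qed.

Lemma ht_wt k : ht (wt' k) = (wdeg M k)%:Z.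
Proof.
rewrite /wt raddf_sum /wdeg (big_morph Posz PoszD (erefl _)); apply: eq_bigr => b _.
by rewrite raddfMn ht_al -mulr_natr natz PoszM.
Qed.

(** The value at the point [scale xi N], as a polynomial in 1/N. Its coefficient of degree d is a
    Laurent polynomial in xi made of the terms of weighted degree d. *)
Definition lpoly (l : seq (mindex n * C)) xi : {poly C} :=
  \sum_(p <- l) (p.2 * wexp xi (- wt' p.1)) *: 'X^(wdeg M p.1).

Lemma lpolyE l xi N : torus xi -> (0 < N)%N ->
  \sum_(p <- l) p.2 * wexp (scale xi N) (- wt' p.1) = (lpoly l xi).[N%:R^-1].
Proof.
move=> hx N0; rewrite /lpoly horner_sum; apply: eq_bigr => p _.
rewrite hornerZ hornerXn wexp_scale // mulrA; congr (_ * _).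
by rewrite raddfN ht_wt -exprnN exprVn.
Qed.

Lemma lpoly_coef l xi d : (lpoly l xi)`_d
  = lev [seq (- wt' p.1, p.2) | p <- l & wdeg M p.1 == d] xi.
Proof.
rewrite /lpoly /lev coef_sum big_map big_filter [RHS]big_mkcond; apply: eq_bigr => p _ /=.
by rewrite coefZ coefXn eq_sym; case: eqP => _; rewrite ?mulr1 ?mulr0.
Qed.

Lemma lpoly_small f l d :
  f = \sum_(p <- l) ps_const (n := n) p.2 * ps_mono C p.1 ->
  (forall xi i, torus xi -> (i < d)%N -> (lpoly l xi)`_i = 0) -> eqtr M d f 0.
Proof.
move=> fE h k kd; rewrite ps0E.
pose l' := [seq (- wt' p.1, p.2) | p <- l & wdeg M p.1 == wdeg M k].
have l0 xi : torus xi -> lev l' xi = 0 by move=> hx; rewrite -lpoly_coef h.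
have := lev_inj l0 (- wt' k); rewrite /lcoef big_map big_filter_cond /= => e.
apply: etrans _ e; rewrite fE ps_sumE [RHS]big_mkcond; apply: eq_bigr => p _ /=.
rewrite ps_constM /ps_mono (inj_eq oppr_inj) (inj_eq (wt'_inj A_pos ep_gt0 al_ep)).
case: (eqVneq p.1 k) => [->|/negPf pk]; first by rewrite !eqxx mulr1.
by rewrite andbF mulr0.
Qed.

Lemma prep_near1 f F xi : prep al' f F -> torus xi -> exists2 B : R, 0 <= B &
  forall N, (0 < N)%N -> nm (F (scale xi N) - f 0) <= B * N%:R^-1.
Proof.
move=> [l fE FE] hx.
have p0 : (lpoly l xi)`_0 = f 0.
  rewrite lpoly_coef /lev big_map big_filter fE ps_sumE [LHS]big_mkcond; apply: eq_bigr => p _ /=.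
  rewrite ps_constM /ps_mono (eq_sym 0 p.1); case: (eqVneq p.1 0) => [->|p1].
    by rewrite wdeg0 wt0 oppr0 wexp0.
  by rewrite mulr0; case: eqP => // /(wdeg_eq0 M_gt0)/eqP; rewrite (negPf p1).
have gen (p : {poly C}) : exists2 B : R, 0 <= B &
    forall N, (0 < N)%N -> nm (p.[N%:R^-1] - p`_0) <= B * N%:R^-1.
  elim/poly_ind: p => [|q c _].
    by exists 0 => // N _; rewrite horner0 coef0 subrr nm0 mul0r.
  exists (coef_bound q) => [|N N0]; first exact: coef_bound_ge0.
  rewrite hornerMXaddC coefD coefMX coefC !eqxx add0r addrK nmM nm_inv_nat.
  by rewrite ler_wpM2r ?invr_ge0 // horner_bound // nm_inv_nat inv_nat_le1.
have [B B0 hB] := gen (lpoly l xi); exists B => // N N0.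
by rewrite -p0 FE ?lpolyE ?hB //; apply: torus_scale.
Qed.

Variable t : 'I_n -> nat.
Hypothesis t_gt0 : forall a, (0 < t a)%N.
Hypothesis t_dvd : forall a j b i,
  ((t b)%:Z %| al' a ord0 b * (minn (t a * i) (t b * j))%:Z)%Z.
Variable E : 'I_n -> nat -> 'I_n -> nat -> nat.
Hypothesis E_def : forall a j b k, (0 < j)%N -> (0 < k)%N ->
  (E a j b k)%:Z = ((a == b) && (j == k))%:Z *+ 2 - lapl (cmin al' t a j b) k.
Variables (c : 'I_n -> nat -> S) (F : 'I_n -> nat -> ('I_n -> C) -> C).
Hypothesis cF : forall a j, prep al' (c a j) (F a j).
Hypothesis c10 : forall a j, c a j 0 = 1.
Hypothesis F0 : forall a x, torus x -> F a 0%N x = 1.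
Hypothesis Fsys : forall a j N x, (0 < j)%N -> (forall b, t b * j < N)%N -> torus x ->
  F a j x ^+ 2 = F a j.+1 x * F a j.-1 x
    + wexp x (- al' a) ^+ j * \prod_b \prod_(1 <= k < N.+1) F b k x ^+ E a j b k.
Hypothesis Flim : forall a x, torus x -> (forall b, 1 < nm (wexp x (al b))) ->
  forall e : R, 0 < e -> exists m, forall i, (m <= i)%N -> nm (F a i x / F a i.+1 x - 1) < e.

(** Along the moving point the parameters of [ratio_limit] are of order 1/N, so c_j - c_(j+1) is of
    order N^(-(j+1)). By [poly_small] its parts of degree at most j vanish at every xi, hence as
    series. *)
Theorem Q_stable a j : eqtr M j.+1 (c a j) (c a j.+1).
Proof.
apply/eqtr_sub0; have [l fE FE] := prepD (cF a j) (prepN (cF a j.+1)).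
apply: (lpoly_small fE) => xi i hx ij.
pose D := (\sum_a absz (\sum_b ((a == b)%:Z *+ 2 - al' a ord0 b) + 2)%R)%N.
have D_ge a' : \sum_b ((a' == b)%:Z *+ 2 - al' a' ord0 b) + 2 <= D%:Z.
  apply: le_trans (ler_norm _) _; rewrite -abszE lez_nat /D.
  by rewrite [X in (_ <= X)%N](bigD1 a') //= leq_addr.
have [B1 hB1] : exists B1 : 'I_n -> R, forall a', 0 <= B1 a' /\ forall N, (0 < N)%N ->
    nm (F a' 1%N (scale xi N) - 1) <= B1 a' * N%:R^-1.
  have h a' : exists B : R, 0 <= B /\ forall N, (0 < N)%N ->
      nm (F a' 1%N (scale xi N) - 1) <= B * N%:R^-1.
    by have [B B0 hB] := prep_near1 (cF a' 1%N) hx; exists B; split=> // N N0; rewrite -(c10 a' 1%N) hB.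
  by exists (fun a' => projT1 (cid (h a'))) => a'; exact: (projT2 (cid (h a'))).
pose B := 2 ^+ D * \sum_a nm (wexp xi (- al' a)).
have B0 : 0 <= B by rewrite mulr_ge0 ?exprn_ge0 // sumr_ge0 // => a' _; apply: nm_ge0.
(* For N > Z one has B/N <= 1/16 and B1/N <= 1/8, as [ratio_limit] requires, and all e^(alpha_b)
   exceed 1 in modulus, so that the moved point lies in the domain of the limit. *)
pose Z := 16 * B + 8 * \sum_a B1 a + \sum_b (nm (wexp xi (al b)))^-1.
have sB1 : 0 <= \sum_a B1 a by rewrite sumr_ge0 // => a' _; case: (hB1 a').
have sal : 0 <= \sum_b (nm (wexp xi (al b)))^-1.
  by rewrite sumr_ge0 // => b _; rewrite invr_ge0 nm_ge0.
have Z0 : 0 <= Z by rewrite /Z; lra.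
have hN0 := archi_boundP Z0; set N0 := Num.bound Z in hN0.
apply: (@poly_small R _ (4 * (2 * B) ^+ j.+1) N0 j) ij => N hN.
have N1 : (0 < N)%N by apply: leq_ltn_trans hN.
have NZ : Z < N%:R by apply: lt_trans hN0 _; rewrite ltr_nat.
have hx' := torus_scale hx N1; set x := scale xi N in hx'.
have iN : 0 < (N%:R : R)^-1 by rewrite invr_gt0 ltr0n.
have NN : (N%:R : R) * N%:R^-1 = 1 by rewrite mulfV // pnatr_eq0 -lt0n.
have le_N y : 0 <= y -> y <= Z -> y * N%:R^-1 <= 1.
  move=> y0 yZ; have : y * N%:R^-1 <= N%:R * N%:R^-1.
    by apply: ler_wpM2r; [exact: ltW|exact: le_trans yZ (ltW NZ)].
  by rewrite NN.
rewrite -lpolyE // -FE //.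
have -> : 4 * (2 * B) ^+ j.+1 * N%:R^-1 ^+ j.+1 = 4 * (2 * (B * N%:R^-1)) ^+ j.+1.
  by rewrite -[LHS]mulrA -exprMn -[2 * B / _]mulrA.
have F0' a' : F a' 0%N x = 1 by exact: F0.
have Fsys' a' j' N' (j0 : (0 < j')%N) (h : forall b, (t b * j' < N')%N) :=
  @Fsys a' j' N' _ j0 h hx'.
apply: (@ratio_limit _ al' t t_gt0 t_dvd E E_def R (fun a j => F a j x)
  (fun a => wexp x (- al' a)) F0' Fsys' D _ D_ge).
- have := le_N (16 * B); rewrite -mulrA; have : 16 * B <= Z by rewrite /Z; lra.
  by move=> h1 /(_ _ h1); rewrite mulr_ge0 // => /(_ isT); lra.
- move=> a'; rewrite wexp_scale // raddfN ht_al nmM -exprnN nmV nmX nm_nat.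
  rewrite mulrAC; apply: ler_pM; rewrite ?mulr_ge0 ?nm_ge0 ?invr_ge0 ?exprn_ge0 //.
    rewrite mulrC /B ler_wpM2l ?exprn_ge0 // (bigD1 a') //= lerDl sumr_ge0 // => b _.
    exact: nm_ge0.
  rewrite -exprVn -(prednK (M_gt0 a')) exprS ler_piMr ?(ltW iN) // exprn_ile1 ?(ltW iN) //.
  exact: inv_nat_le1.
- move=> a'; have [b0 hb] := hB1 a'; apply: le_trans (hb N N1) _.
  have h8 : 8 * B1 a' <= Z.
    rewrite /Z (bigD1 a') //=; have : 0 <= \sum_(i < n | i != a') B1 i.
      by rewrite sumr_ge0 // => b _; case: (hB1 b).
    by lra.
  by have := le_N (8 * B1 a') (mulr_ge0 _ b0) h8; rewrite -mulrA; lra.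
apply: Flim => // b; rewrite wexp_scale // nmM.
have w0 : 0 < nm (wexp xi (al b)) by rewrite lt_neqAle nm_ge0 andbT eq_sym nm_eq0 wexp_neq0.
have -> : ht (al b) = (ep b * M b)%:Z.
  by rewrite al_ep raddfMn ht_al -mulr_natr natz PoszM mulrC.
rewrite -exprnP nmX nm_nat.
have e0 : (0 < ep b * M b)%N by rewrite muln_gt0 ep_gt0 M_gt0.
apply: lt_le_trans (_ : nm (wexp xi (al b)) * N%:R <= _); last first.
  by rewrite ler_wpM2l ?nm_ge0 // -(prednK e0) exprS ler_peMr // exprn_ege1 // ler1n.
rewrite -ltr_pdivrMl // mulr1; apply: le_lt_trans NZ.
rewrite /Z [X in _ <= _ + X](bigD1 b) //=.
have : 0 <= \sum_(i < n | i != b) (nm (wexp xi (al i)))^-1.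
  by rewrite sumr_ge0 // => b' _; rewrite invr_ge0 nm_ge0.
by lra.
Qed.

End Stability.

(** * Cartan matrices of finite type *)

Definition centry (F : Defs.fin_type) (i j : nat) : int :=
  if i == j then 2
  else if fin_edge F i j || fin_edge F j i then - (maxn 1 (fin_len F j %/ fin_len F i))%:Z
  else 0.

Lemma cartanE F n (a b : 'I_n) : cartan F n a b = centry F a.+1 b.+1.
Proof. by rewrite mxE /centry eqSS. Qed.

Definition fin_wf (F : Defs.fin_type) (n : nat) : bool :=
  match F with
  | FinA m | FinB m | FinC m => (m == n) && (0 < n)
  | FinD m => (m == n) && (3 < n)
  | FinE6 => n == 6
  | FinE7 => n == 7
  | FinE8 => n == 8
  | FinF4 _ => n == 4
  | FinG2 _ => n == 2
  end%N.

Lemma ind_sum n k (Q : bool) (g : nat -> int) :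
  \sum_(b < n) ((b.+1 == k) && Q)%:Z * g b.+1 = if (0 < k <= n)%N && Q then g k else 0.
Proof.
case: ifP => [/andP[/andP[k0 kn] ->]|h].
  have kn' : (k.-1 < n)%N by lia.
  rewrite (bigD1 (Ordinal kn')) //= prednK // eqxx mul1r big1 ?addr0 // => b bk.
  case: eqP => [e|_]; last by rewrite mul0r.
  by case/eqP: bk; apply/val_inj; rewrite /= -e.
rewrite big1 // => b _; case: eqP => [e|_]; last by rewrite mul0r.
have kn : (0 < k <= n)%N by rewrite -e /= ltn_ord.
by move: h; rewrite kn /= => ->; rewrite mul0r.
Qed.

(** A certificate of finite type: a positive vector whose image under the Cartan matrix is
    positive. *)
Definition posvec F n (u : nat -> int) :=
  (forall i, (0 < i <= n)%N -> 0 < u i) /\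
  forall i, (0 < i <= n)%N -> 0 < \sum_(b < n) centry F i b.+1 * u b.+1.

Lemma chain_sum n i (x y : int) (f g : nat -> int) : (0 < i <= n)%N ->
  (forall j, (0 < j <= n)%N -> f j = (if i == j then 2 else
     if j == i.+1 then - x else if i == j.+1 then - y else 0)) ->
  \sum_(b < n) f b.+1 * g b.+1
  = 2 * g i - (if (i < n)%N then x * g i.+1 else 0) - (if (1 < i)%N then y * g i.-1 else 0).
Proof.
move=> hi hf.
have e : \sum_(b < n) f b.+1 * g b.+1 = 2 * (\sum_(b < n) ((b.+1 == i) && true)%:Z * g b.+1)
   - x * (\sum_(b < n) ((b.+1 == i.+1) && true)%:Z * g b.+1)
   - y * (\sum_(b < n) ((b.+1 == i.-1) && (0 < i)%N)%:Z * g b.+1).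
  rewrite !mulr_sumr -!sumrB; apply: eq_bigr => b _; rewrite hf ?ltn_ord //.
  move: (g b.+1) => z; have -> : (b.+1 == i.-1) && (0 < i)%N = (i == b.+2) by lia.
  rewrite !andbT [i == b.+1]eq_sym.
  case: (eqVneq b.+1 i) => [<-|h1].
    have -> : (b.+1 == b.+2) = false by lia.
    by rewrite /= !mul0r !mulr0 !subr0 mul1r.
  case: (eqVneq b.+1 i.+1) => [e|h2].
    have -> : (i == b.+2) = false by lia.
    by rewrite /= !mul0r !mulr0 subr0 mul1r mulNr sub0r.
  by case: eqP => _ /=; rewrite ?mul0r ?mulr0 ?mul1r ?subr0 ?sub0r ?mulNr.
rewrite e !ind_sum.
have -> : ((0 < i <= n)%N && true) by rewrite hi.
have -> : ((0 < i.+1 <= n)%N && true) = (i < n)%N by rewrite andbT.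
have -> : (0 < i.-1 <= n)%N && (0 < i)%N = (1 < i)%N by lia.
by case: ifP; case: ifP; rewrite ?mulr0.
Qed.

Lemma chain_pos F n i (x y : int) (g : nat -> int) : (0 < i <= n)%N -> g 0%N = 0 ->
  (forall j, (0 < j <= n)%N -> centry F i j = (if i == j then 2 else
     if j == i.+1 then - x else if i == j.+1 then - y else 0)) ->
  ((i < n)%N -> 0 < 2 * g i - x * g i.+1 - y * g i.-1) ->
  (i = n -> 0 < 2 * g i - y * g i.-1) ->
  0 < \sum_(b < n) centry F i b.+1 * g b.+1.
Proof.
move=> hi g0 hf h1 h2; rewrite (chain_sum _ hi hf).
have -> : (if (1 < i)%N then y * g i.-1 else 0) = y * g i.-1.
  case: ifP => // h. have -> : i.-1 = 0%N by lia. by rewrite g0 mulr0.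
case: ltnP => h; first exact: h1.
by rewrite subr0; apply: h2; lia.
Qed.

Lemma posvecA n : posvec (FinA n) n (fun i => i%:Z * (n%:Z + 1 - i%:Z)).
Proof.
split=> [i hi|i hi]; first by rewrite mulr_gt0; lia.
apply: (@chain_pos _ n i 1 1 (fun i => i%:Z * (n%:Z + 1 - i%:Z))) => //.
- move=> j hj; rewrite /centry /=; case: eqP => // _.
  by case: eqP => //=; case: eqP.
- by nia.
- by nia.
Qed.

Lemma posvecB n : posvec (FinB n) n (fun i => i%:Z * (2 * n%:Z + 1 - i%:Z)).
Proof.
split=> [i hi|i hi]; first by rewrite mulr_gt0; lia.
apply: (@chain_pos _ n i 1 (if i == n then 2 else 1) (fun i => i%:Z * (2 * n%:Z + 1 - i%:Z))) => //.
- move=> j hj; rewrite /centry /=; case: (eqVneq i j) => // ij.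
  case: (eqVneq j i.+1) => [e|h1] /=.
    have -> : (i < n)%N by lia. by case: ifP.
  case: (eqVneq i j.+1) => [e|h2] //=.
  have -> : (j < n)%N by lia.
  by case: (eqVneq i n) => h; [have -> : (i < n)%N = false by lia|have -> : (i < n)%N by lia].
- move=> h; have -> : (i == n) = false by lia.
  by nia.
- by move=> ->; rewrite eqxx; nia.
Qed.

Lemma posvecC n : posvec (FinC n) n
  (fun i => if (i < n)%N then 2 * i%:Z * (2 * n%:Z + 1 - i%:Z) else n%:Z * (n%:Z + 1)).
Proof.
split=> [i hi|i hi]; first by case: ifP => _; rewrite !mulr_gt0; lia.
apply: (@chain_pos _ n i (if i.+1 == n then 2 else 1) 1
  (fun i => if (i < n)%N then 2 * i%:Z * (2 * n%:Z + 1 - i%:Z) else n%:Z * (n%:Z + 1))) => //.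
- by have -> : (0 < n)%N by lia.
- move=> j hj; rewrite /centry /=; case: (eqVneq i j) => // ij.
  case: (eqVneq j i.+1) => [e|h1] /=.
    have -> : (i < n)%N by lia.
    rewrite -e; case: (eqVneq j n) => h; [have -> : (j < n)%N = false by lia|have -> : (j < n)%N by lia] => //.
  case: (eqVneq i j.+1) => [e|h2] //=.
  have -> : (j < n)%N by lia.
  by case: (ltnP i n).
- move=> h; rewrite h; have -> : (i.-1 < n)%N by lia.
  case: (eqVneq i.+1 n) => h1.
    have -> : (i.+1 < n)%N = false by lia. by nia.
  have -> : (i.+1 < n)%N by lia. by nia.
- move=> e; have -> : (i < n)%N = false by lia.
  have -> : (i.-1 < n)%N by lia. by nia.
Qed.

Lemma posvecD n : (3 < n)%N -> posvec (FinD n) n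
  (fun i => if (i.+1 < n)%N then 2 * i%:Z * (2 * n%:Z - 1 - i%:Z) else n%:Z * (n%:Z - 1)).
Proof.
set g := (X in posvec _ _ X).
move=> n3; split=> [i hi|i hi]; first by rewrite /g; case: ifP => _; rewrite !mulr_gt0; lia.
have e : \sum_(b < n) centry (FinD n) i b.+1 * g b.+1
   = 2 * (\sum_(b < n) ((b.+1 == i) && true)%:Z * g b.+1)
   - \sum_(b < n) ((b.+1 == i.+1) && (i.+1 < n)%N)%:Z * g b.+1
   - \sum_(b < n) ((b.+1 == i.-1) && (1 < i < n)%N)%:Z * g b.+1
   - \sum_(b < n) ((b.+1 == n) && (i.+2 == n))%:Z * g b.+1
   - \sum_(b < n) ((b.+1 == n.-2) && (i == n))%:Z * g b.+1.
  rewrite !mulr_sumr -!sumrB; apply: eq_bigr => b _; have hb := ltn_ord b.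
  move: (g b.+1) => z; rewrite mulrA -!mulrBl; congr (_ * z).
  rewrite /centry /=; case: (eqVneq i b.+1) => h0; first by lia.
  by case: ifP => h; rewrite ?div1n ?divn1 //=; lia.
rewrite e !ind_sum.
have -> : (0 < i <= n)%N && true by rewrite hi.
have -> : (0 < i.+1 <= n)%N && (i.+1 < n)%N = (i.+1 < n)%N by lia.
have -> : (0 < i.-1 <= n)%N && (1 < i < n)%N = (1 < i < n)%N by lia.
have -> : (0 < n <= n)%N && (i.+2 == n) = (i.+2 == n) by lia.
have -> : (0 < n.-2 <= n)%N && (i == n) = (i == n) by lia.
rewrite /g; case: (ltngtP i.+2 n) => h.
- have -> : (i == n) = false by lia.
  have h1 : (i.+1 < n)%N by lia.
  have h2 : (i.-1.+1 < n)%N by lia.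
  by rewrite ?h1 ?h2; case: ifP => h3; nia.
- have [e1|e1] : i.+1 = n \/ i = n by lia.
    have h1 : (i.+1 < n)%N = false by lia.
    have h2 : (1 < i < n)%N by lia.
    have h3 : (i == n) = false by lia.
    have h4 : (i.-1.+1 < n)%N by lia.
    by rewrite ?h1 ?h2 ?h3 ?h4; nia.
  have h1 : (i.+1 < n)%N = false by lia.
  have h2 : (1 < i < n)%N = false by lia.
  have h3 : i == n by lia.
  have h4 : (n.-2.+1 < n)%N by lia.
  by rewrite ?h1 ?h2 ?h3 ?h4; nia.
have h1 : (i == n) = false by lia.
have h2 : (i.+1 < n)%N by lia.
have h3 : (n.+1 < n)%N = false by lia.
have h4 : (1 < i < n)%N by lia.
have h5 : (i.-1.+1 < n)%N by lia.
by rewrite ?h1 ?h2 ?h3 ?h4 ?h5; nia.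
Qed.

Definition posvec_check F n (u : seq nat) : bool :=
  all (fun i => (0 < nth 0 u i)%N &&
    (0 < foldr +%R 0 [seq centry F i.+1 b.+1 * (nth 0%N u b)%:Z | b <- iota 0 n])) (iota 0 n).

Lemma posvec_checkP F n u : posvec_check F n u -> posvec F n (fun i => (nth 0%N u i.-1)%:Z).
Proof.
move/allP => h; split=> i hi; have hm : i.-1 \in iota 0 n by rewrite mem_iota; lia.
  by have /andP[] := h _ hm.
have /andP[_] := h _ hm; rewrite prednK; last by lia.
by rewrite foldrE big_map -val_enum_ord big_map big_enum.
Qed.

(** The vectors are positive multiples of rho in the basis of simple roots: rho for E6, E8, F4 and
    G2, 2 rho for A and E7, 4 rho for C and D. In type B the vector is 2 rho plus the sum of the i
    alpha_i. *)
Lemma posvec_ex F n : fin_wf F n -> exists u, posvec F n u.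
Proof.
case: F => [m|m|m|m||||b|b] //=.
- by move=> /andP[/eqP -> _]; exists (fun i => i%:Z * (n%:Z + 1 - i%:Z)); apply: posvecA.
- by move=> /andP[/eqP -> _]; exists (fun i => i%:Z * (2 * n%:Z + 1 - i%:Z)); apply: posvecB.
- by move=> /andP[/eqP -> _]; eexists; apply: posvecC.
- by move=> /andP[/eqP -> h]; eexists; apply: posvecD.
- move=> /eqP ->; eexists; apply: (@posvec_checkP _ _ [:: 8; 15; 21; 15; 8; 11]%N); vm_compute; reflexivity.
- move=> /eqP ->; eexists; apply: (@posvec_checkP _ _ [:: 34; 66; 96; 75; 52; 27; 49]%N); vm_compute; reflexivity.
- move=> /eqP ->; eexists; apply: (@posvec_checkP _ _ [:: 29; 57; 84; 110; 135; 91; 46; 68]%N); vm_compute; reflexivity.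
- move=> /eqP ->; case: b; eexists.
    by apply: (@posvec_checkP _ _ [:: 8; 15; 21; 11]%N); vm_compute.
  by apply: (@posvec_checkP _ _ [:: 11; 21; 15; 8]%N); vm_compute.
- move=> /eqP ->; case: b; eexists.
    by apply: (@posvec_checkP _ _ [:: 3; 5]%N); vm_compute.
  by apply: (@posvec_checkP _ _ [:: 5; 3]%N); vm_compute.
Qed.

Definition fin_parent F n i : nat :=
  match F with
  | FinD m => if i == n then i.-2 else i.-1
  | FinE6 => if i == 6 then 3 else i.-1
  | FinE7 => if i == 7 then 3 else i.-1
  | FinE8 => if i == 8 then 5 else i.-1
  | _ => i.-1
  end%N.

Lemma fin_parentP F n i : fin_wf F n -> (1 < i <= n)%N ->
  (0 < fin_parent F n i < i)%N && fin_edge F (fin_parent F n i) i.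
Proof.
case: F => [m|m|m|m||||b|b] //= h hi; try lia.
- by case: ifP => e; lia.
- by move/eqP: h => h; case: ifP => e; lia.
- by move/eqP: h => h; case: ifP => e; lia.
- by move/eqP: h => h; case: ifP => e; lia.
Qed.

Lemma centry_edge F i j : i != j -> fin_edge F i j || fin_edge F j i -> centry F i j != 0.
Proof.
move=> /negPf ij e; rewrite /centry ij e oppr_eq0 -lt0n.
by apply: leq_trans (leq_maxl _ _).
Qed.

Lemma centry_le0 F i j : i != j -> centry F i j <= 0.
Proof. by move=> /negPf ij; rewrite /centry ij; case: ifP => // _; rewrite oppr_le0. Qed.

(** Every node other than the first is joined to one with a smaller label, its parent in a rooted
    tree. Truth of [Q] passes along edges in both directions, hence to and from the root. *)
Lemma fin_conn F n (Q : pred 'I_n) : fin_wf F n ->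
  (forall i j, Q i -> cartan F n i j != 0 -> Q j) -> forall i j, Q i -> Q j.
Proof.
move=> wf hQ.
have n0 : (0 < n)%N by move: wf; case: F {hQ} => [m|m|m|m||||b|b] /=; lia.
have ind (D : pred 'I_n) : D (Ordinal n0) ->
    (forall i j : 'I_n, cartan F n i j != 0 -> cartan F n j i != 0 -> (j < i)%N -> D j -> D i) ->
    forall i, D i.
  move=> D0 hD i; have [N] := ubnP (i : nat); elim: N i => // N IH i hN.
  case: (posnP i) => i0; first by rewrite (_ : i = Ordinal n0) //; apply: val_inj.
  have hi : (1 < i.+1 <= n)%N by rewrite ltnS i0 ltn_ord.
  have /andP[/andP[p0 pi] he] := fin_parentP wf hi; set p := fin_parent F n i.+1 in p0 pi he.
  have hp : (p.-1 < n)%N by have := ltn_ord i; lia.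
  have ne : p != i.+1 by rewrite ltn_eqF.
  apply: (hD i (Ordinal hp)); last by apply: IH; rewrite /=; lia.
  - by rewrite cartanE /= prednK //; apply: centry_edge; rewrite 1?eq_sym // he orbT.
  - by rewrite cartanE /= prednK //; apply: centry_edge; rewrite // he.
  - by rewrite /=; lia.
pose D i := (Q i ==> Q (Ordinal n0)) && (Q (Ordinal n0) ==> Q i).
have hD : forall i, D i.
  apply: ind => [|i j ij ji _]; first by rewrite /D implybb.
  rewrite /D => /andP[/implyP h1 /implyP h2]; apply/andP; split; apply/implyP => h.
    exact: h1 (hQ _ _ h ij).
  exact: hQ _ _ (h2 h) ji.
move=> i j Qi; have /andP[/implyP h1 _] := hD i; have /andP[_ /implyP h2] := hD j.
exact: h2 (h1 Qi).
Qed.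

Lemma fin_lenP F i j : fin_edge F i j || fin_edge F j i ->
  (fin_len F i * maxn 1 (fin_len F j %/ fin_len F i) = maxn (fin_len F i) (fin_len F j))%N.
Proof.
by case: F => [m|m|m|m||||b|b] _ //=; do ?case: ifP.
Qed.

Lemma centry_sym F i j : (fin_len F i)%:Z * centry F i j = (fin_len F j)%:Z * centry F j i.
Proof.
rewrite /centry [j == i]eq_sym [fin_edge F j i || _]orbC.
case: eqP => [->//|_]; case: ifP => e; last by rewrite !mulr0.
by rewrite !mulrN -!PoszM (fin_lenP e) (@fin_lenP F j i) 1?orbC // maxnC.
Qed.

(** For [i] maximizing |k_i| / u_i the off-diagonal entries, being nonpositive, give k_i (A k)_i >=
    (k_i^2 / u_i) (A u)_i > 0. *)
Lemma centry_pos F n (k : 'I_n -> rat) : fin_wf F n -> (exists b, k b != 0) ->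
  exists i, 0 < k i * \sum_j (cartan F n i j)%:~R * k j.
Proof.
move=> wf [b0 kb0]; have [u [u0 hu]] := posvec_ex wf.
pose U (i : 'I_n) : rat := (u i.+1)%:~R.
have U0 i : 0 < U i by rewrite ltr0z u0 // ltn_ord.
have [i hi] : exists i, forall j, `|k j| / U j <= `|k i| / U i.
  by case: (@arg_maxP _ _ _ b0 xpredT (fun j => `|k j| / U j)) => // i _ h; exists i => j; apply: h.
exists i; have ki : 0 < `|k i|.
  rewrite normr_gt0; apply/eqP => e; have := hi b0; rewrite e normr0 mul0r.
  by rewrite leNgt divr_gt0 // normr_gt0.
have cE j : (cartan F n i j)%:~R = (centry F i.+1 j.+1)%:~R :> rat by rewrite cartanE.
have bound j : k i * ((cartan F n i j)%:~R * k j) >= (cartan F n i j)%:~R * `|k i| ^+ 2 / U i * U j.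
  case: (eqVneq i j) => [<-|ij].
    rewrite divfK ?gt_eqF // real_normK ?num_real // expr2; nra.
  have c0 : (cartan F n i j)%:~R <= 0 :> rat by rewrite cE lerz0 centry_le0.
  have h : k i * k j <= `|k i| ^+ 2 / U i * U j.
    apply: le_trans (ler_norm _) _; rewrite normrM expr2 -!mulrA ler_wpM2l //.
    by have := hi j; rewrite ler_pdivrMr // mulrA.
  have -> : k i * ((cartan F n i j)%:~R * k j) = (cartan F n i j)%:~R * (k i * k j) by ring.
  have -> : (cartan F n i j)%:~R * `|k i| ^+ 2 / U i * U j
    = (cartan F n i j)%:~R * (`|k i| ^+ 2 / U i * U j) by ring.
  exact: ler_wnM2l.
rewrite mulr_sumr; apply: lt_le_trans (ler_sum _ (fun j _ => bound j)).
have -> : \sum_j (cartan F n i j)%:~R * `|k i| ^+ 2 / U i * U j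
    = `|k i| ^+ 2 / U i * (\sum_(b < n) centry F i.+1 b.+1 * u b.+1)%:~R.
  rewrite rmorph_sum mulr_sumr; apply: eq_bigr => j _.
  by rewrite rmorphM /= cE /U; ring.
by rewrite mulr_gt0 ?divr_gt0 ?exprn_gt0 // ltr0z hu // ltn_ord.
Qed.

(** * Normalizations and integrality for the affine types *)

Section AffineType.
Variables (X : affine_type) (hX : affine_wf X).
Local Notation n := (rank X).
Local Notation A := (circ_cartan X).

Lemma circ_wf : fin_wf (circ_type X) n.
Proof. by case: X hX => //= *; rewrite ?eqxx //=; lia. Qed.

Lemma zero_wf : fin_wf (zero_type X) n.
Proof. by case: X hX => //= *; rewrite ?eqxx //=; lia. Qed.

(** alpha_b / eps_b, the division being exact by [eps_dvd] below. *)
Definition half_root (b : 'I_n) : 'rV[int]_n := \row_a (A a b %/ (eps b)%:Z)%Z.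

Lemma eps_gt0 (b : 'I_n) : (0 < eps b)%N.
Proof. by rewrite /eps; case: X b => // m b; case: ifP. Qed.

Lemma A2n_entry m i j : (0 < i <= m)%N -> (0 < j <= m)%N ->
  centry (FinB m) i j * (if j == m then 2 else 1)
  = (if i == m then 2 else 1) * centry (FinC m) i j.
Proof.
move=> hi hj; rewrite /centry /=; case: (eqVneq i j) => [->|ij]; first by ring.
case: (eqVneq j i.+1) => [e|h1] /=.
  have -> : (i < m)%N by lia.
  have -> : (i == m) = false by lia.
  have -> : (j < m)%N = (j != m) by lia.
  by case: (j == m); vm_compute.
case: (eqVneq i j.+1) => [e|h2] /=; last by rewrite mulr0 mul0r.
have -> : (j < m)%N by lia.
have -> : (j == m) = false by lia.
have -> : (i < m)%N = (i != m) by lia.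
by case: (i == m); vm_compute.
Qed.

(** The identity iota(alpha_b) = eps_b ~alpha_b in coordinates. *)
Lemma zero_circ a b : zero_cartan X a b * (eps b)%:Z = (eps a)%:Z * A a b.
Proof.
rewrite /zero_cartan /circ_cartan !cartanE /eps /zero_type.
case: X a b => /= [m|m|m|m||||||m|m|m||] a b; rewrite ?mulr1 ?mul1r //.
by have := @A2n_entry m a.+1 b.+1 (ltn_ord a) (ltn_ord b); case: ifP; case: ifP.
Qed.

(** The only case with eps_b = 2 is alpha_n in A^(2)_2n, a long root of C_n, which is twice a
    weight. *)
Lemma eps_dvd a b : ((eps b)%:Z %| A a b)%Z.
Proof.
case: (boolP (eps b == 1%N)) => [/eqP ->|]; first exact: dvd1z.
rewrite /circ_cartan cartanE /eps.
case: X a b => //= m a b; case: ifP => // /eqP bm _.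
rewrite bm /centry /=; case: eqP => // _; case: ifP => // e.
have am : (a.+1 < m)%N by move: e; have := ltn_ord a; lia.
by rewrite am ltnn.
Qed.

Lemma circ_half a b : A a b = half_root b 0 a * (eps b)%:Z.
Proof. by rewrite [half_root _ _ _]mxE divzK ?eps_dvd. Qed.

Lemma zero_half a b : zero_cartan X a b = (eps a)%:Z * half_root b 0 a.
Proof.
have e0 : (eps b)%:Z != 0 by rewrite -lt0n eps_gt0.
by apply: (mulIf e0); rewrite zero_circ circ_half mulrA.
Qed.

Lemma simple_half b : simple_root A b = half_root b *+ eps b.
Proof.
by apply/rowP => a; rewrite simple_rootE circ_half pmulrn -scaler_int intz [RHS]mxE mulrC.
Qed.

Lemma circ_diag i : A i i = 2.
Proof. by rewrite /circ_cartan cartanE /centry eqxx. Qed.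

(** The normalization (~alpha_a|~alpha_a) = 2 t^vee_a / (eps_a t_a), cleared of denominators. *)
Lemma len_scale (a : 'I_n) : (twist X * fin_len (zero_type X) a.+1 * eps a * tnode a
  = tvee a * fin_long (zero_type X))%N.
Proof.
rewrite /eps /tvee /tnode; case: X a => [m|m|m|m||||||m|m|m||] /= a; have := ltn_ord a => /= ha.
all: rewrite ?muln1 ?mul1n //.
all: try by case: (ltngtP a.+1 m) => //; lia.
all: by case: a ha => -[|[|[|[|a]]]] //=.
Qed.

Lemma tnode_gt0 (a : 'I_n) : (0 < tnode a)%N.
Proof. by rewrite /tnode; case: X a => // *; case: ifP. Qed.

Lemma tvee_gt0 (a : 'I_n) : (0 < tvee a)%N.
Proof. by rewrite /tvee; case: X a => // *; case: ifP. Qed.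

Lemma fin_long_gt0 F : (0 < fin_long F)%N. Proof. by case: F. Qed.

Lemma root_formE (a b : 'I_n) :
  root_form a b = (tvee a)%:R * (half_root b 0 a)%:~R / (tnode a)%:R.
Proof.
have l0 : (fin_long (zero_type X))%:R != 0 :> rat by rewrite pnatr_eq0 -lt0n fin_long_gt0.
have t0 : (tnode a)%:R != 0 :> rat by rewrite pnatr_eq0 -lt0n tnode_gt0.
have := congr1 (fun m : nat => m%:R : rat) (len_scale a); rewrite !natrM => e.
have e1 : ((eps a)%:Z)%:~R = (eps a)%:R :> rat by [].
rewrite /root_form /sqlen zero_half intrM e1 !natrM.
apply: (mulIf t0); rewrite divfK //; apply: (mulIf l0).
rewrite [RHS]mulrAC -e; field.
exact: l0.
Qed.

Lemma root_form_sym (a b : 'I_n) : root_form a b = root_form b a.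
Proof.
rewrite /root_form /sqlen /zero_cartan !cartanE.
have := congr1 (fun z : int => z%:~R : rat) (centry_sym (zero_type X) a.+1 b.+1).
have e1 z : (z%:Z)%:~R = z%:R :> rat by [].
by rewrite !rmorphM /= !e1 !natrM => e; ring: e.
Qed.

Lemma root_formE' (a b : 'I_n) :
  root_form a b = (tvee b)%:R * (half_root a 0 b)%:~R / (tnode b)%:R.
Proof. by rewrite root_form_sym root_formE. Qed.

(** Either t_b divides t_a, hence both arguments of the minimum, or it divides the root coordinate.
    This makes the division in [cmin] exact. *)
Lemma tnode_dvd a j b i :
  ((tnode b)%:Z %| half_root a 0%R b * (minn (tnode a * i) (tnode b * j))%:Z)%Z.
Proof.
suff : (tnode b %| tnode a)%N || ((tnode b)%:Z %| half_root a 0%R b)%Z.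
  case/orP => h; last by rewrite dvdz_mulr.
  apply: dvdz_mull; rewrite dvdzE /= /minn; case: ifP => _; first by rewrite dvdn_mulr.
  by rewrite dvdn_mulr.
rewrite mxE /circ_cartan cartanE /eps /tnode.
case: X a b => [m|m|m|m||||||m|m|m||] /= a b; rewrite ?dvd1n //.
- case: (eqVneq b.+1 m) => bm; last by rewrite dvd1n.
  apply/orP; right; rewrite divz1 bm /centry /=; case: eqP => // _; case: ifP => // e.
  have am : (a.+1 < m)%N by move: e; have := ltn_ord a; lia.
  by rewrite am ltnn.
- case: (ltnP b.+1 m) => bm; last by rewrite dvd1n.
  case: (ltnP a.+1 m) => am //=; have -> : a.+1 = m by have := ltn_ord a; lia.
  rewrite divz1 /centry /=; case: eqP => // _; case: ifP => // e.
  by rewrite bm ltnn.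
- by case: a b => -[|[|[|[|a]]]] // ha [[|[|[|[|b]]]]].
by case: a b => -[|[|a]] // ha [[|[|b]]].
Qed.

Lemma circ_pos (k : 'I_n -> rat) : (exists b, k b != 0) ->
  exists i, 0 < k i * \sum_j (A i j)%:~R * k j.
Proof. exact: centry_pos circ_wf. Qed.

Lemma circ_conn (Q : pred 'I_n) : (forall i j, Q i -> A i j != 0 -> Q j) ->
  forall i j, Q i -> Q j.
Proof. exact: fin_conn circ_wf. Qed.

Lemma tnode6 (a : 'I_n) : (tnode a * (6 %/ tnode a) = 6)%N.
Proof.
have h (c : bool) (p : nat) : p = 2 \/ p = 3 ->
    let m := if c then p else 1%N in m = 1%N \/ m = 2 \/ m = 3 by case: c; auto.
have : tnode a = 1%N \/ tnode a = 2 \/ tnode a = 3.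
  by rewrite /tnode; case: X a => /= *; do ?[by left|apply: h; auto].
by case=> [->|[->|->]].
Qed.

(** The symmetry of [root_form] transposes the pairing with the vector [u] of [posvec_ex] for g_0,
    which is positive. The factors 6 / t_a clear denominators, 6 being a common multiple of the
    possible values 1, 2, 3 of t_a. *)
Lemma height_ex : exists (G M : 'I_n -> nat), (forall a, 0 < G a)%N /\ (forall b, 0 < M b)%N /\
  forall b, \sum_a half_root b 0 a * (G a)%:Z = (M b)%:Z.
Proof.
have [u [u0 hu]] := posvec_ex zero_wf.
pose G (a : 'I_n) := (6 %/ tnode a * tvee a * absz (u a.+1))%N.
have Gpos a : (0 < G a)%N.
  rewrite !muln_gt0 tvee_gt0 absz_gt0 gt_eqF ?u0 ?ltn_ord // !andbT.
  by have := tnode6 a; case: (_ %/ _)%N => //; rewrite muln0.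
have main b : 0 < \sum_a half_root b 0 a * (G a)%:Z.
  have -> : \sum_a half_root b 0 a * (G a)%:Z
      = (6 %/ tnode b * tvee b)%N%:Z * \sum_a half_root a 0 b * u a.+1.
    rewrite mulr_sumr; apply: eq_bigr => a _.
    have := root_formE a b; rewrite root_formE' => e.
    have t0 (c : 'I_n) : (tnode c)%:R != 0 :> rat by rewrite pnatr_eq0 -lt0n tnode_gt0.
    have t6' (c : 'I_n) : (6 %/ tnode c)%:R = 6 / (tnode c)%:R :> rat.
      by apply: (mulfI (t0 c)); rewrite -natrM tnode6; field; apply: t0.
    have uE : (u a.+1)%:~R = (absz (u a.+1))%:R :> rat.
      by rewrite natr_absz gtr0_norm // u0 // ltn_ord.
    have e1 z : (z%:Z)%:~R = z%:R :> rat by [].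
    apply: (intr_inj (R := rat)); rewrite !intrM !e1 !natrM !t6' uE.
    have -> : 6 / (tnode b)%:R * (tvee b)%:R * ((half_root a 0 b)%:~R * (absz (u a.+1))%:R)
      = 6 * ((tvee b)%:R * (half_root a 0 b)%:~R / (tnode b)%:R) * (absz (u a.+1))%:R :> rat by ring.
    by rewrite e; ring.
  rewrite mulr_gt0 //.
    rewrite ltz_nat muln_gt0 tvee_gt0 andbT.
    by have := tnode6 b; case: (_ %/ _)%N => //; rewrite muln0.
  have : 0 < \sum_(a < n) centry (zero_type X) b.+1 a.+1 * u a.+1 by rewrite hu // ltn_ord.
  have -> : \sum_(a < n) centry (zero_type X) b.+1 a.+1 * u a.+1
    = (eps b)%:Z * \sum_a half_root a 0 b * u a.+1.
    by rewrite mulr_sumr; apply: eq_bigr => a _; rewrite -cartanE -/(zero_cartan X b a) zero_half mulrA.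
  by rewrite pmulr_rgt0 // ltz_nat eps_gt0.
exists G, (fun b => absz (\sum_a half_root b 0%R a * (G a)%:Z)%R); split=> //; split=> b.
  by rewrite absz_gt0 gt_eqF.
by rewrite gtz0_abs.
Qed.

End AffineType.

(** * Comparison with the sum over finitely supported families *)

Lemma pos_nat_bigE (R : Type) (idx : R) (op : Monoid.com_law idx) (F : nat -> R) L :
  (forall j, (L < j)%N -> F j = idx) ->
  \big[op/idx]_(j \in pos_nat) F j = \big[op/idx]_(1 <= j < L.+1) F j.
Proof.
move=> h; rewrite (@fsbigE _ _ _ _ _ (iota 1 L)) ?iota_uniq //.
- rewrite big_seq_cond [RHS]big_seq_cond /index_iota subSS subn0; apply: eq_bigl => j.
  rewrite mem_iota andbC andbT; case: (ltnP 0 j) => //= j0.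
    by rewrite mem_set.
  by rewrite andbF.
- by move=> j /=; rewrite mem_iota => /andP[].
by move=> j /= j0; rewrite mem_iota /= j0 add1n ltnS -ltnNge => /h.
Qed.

Lemma mult_family_bound n (m : mult_family n) : exists L, forall a j, (L < j)%N -> m (a, j) = 0%N.
Proof.
exists (\max_(p <- finsupp m) p.2) => a j h; apply/eqP; apply: contraTT h => mj.
have hp : (a, j) \in finsupp m by rewrite mem_finsupp.
by rewrite -leqNgt (big_rem _ hp) /= leq_maxl.
Qed.

Section Spread.
Variables (n L : nat).
Local Notation I := ('I_n * 'I_L)%type.
Implicit Type m : {ffun I -> nat}.

(** Position i of ['I_L] stands for the level i + 1; all other levels receive 0. *)
Definition spread m : mult_family n :=
  [fsfun p in [fset p in [seq (l.1, l.2.+1) | l : I]]%fset =>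
    (\sum_(l : I | (l.1, l.2.+1) == p) m l)%N].

Lemma spreadE m a (i : 'I_L) : spread m (a, i.+1) = m (a, i).
Proof.
rewrite fsfunE ifT; last by rewrite !inE; apply/mapP; exists (a, i); rewrite ?mem_enum.
apply: (big_pred1 (a, i)) => -[b j] /=; rewrite !xpair_eqE eqSS.
by congr (_ && _).
Qed.

Lemma spread_out m a i : (i == 0)%N || (L < i)%N -> spread m (a, i) = 0%N.
Proof.
move=> h; rewrite fsfunE; case: ifP => // _; rewrite big1 // => -[b j] /= /eqP[_ e].
by move: h; rewrite -e /=; have := ltn_ord j; lia.
Qed.

Lemma spread_inj : injective spread.
Proof. by move=> m m' e; apply/ffunP => -[a i]; rewrite -!spreadE e. Qed.

Lemma spread_restrict (m : mult_family n) :
  (forall a i, (i == 0)%N || (L < i)%N -> m (a, i) = 0%N) ->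
  spread [ffun l : I => m (l.1, l.2.+1)] = m.
Proof.
move=> h; apply/fsfunP => -[a [|i]]; first by rewrite spread_out // h.
case: (ltnP i L) => iL; last by rewrite spread_out ?h.
by rewrite (spreadE _ a (Ordinal iL)) ffunE.
Qed.

End Spread.

Section Multiplicity.
Variables (K : numFieldType) (X : affine_type) (hX : affine_wf X).
Local Notation n := (rank X).
Local Notation al' := (@half_root X).
Local Notation t := (@tnode X).
Local Notation wt' := (wt al').
Local Notation S := (pseries n K).
Variables (nu : mult_family n) (L : nat).
Hypothesis nu_bound : forall a j, (L < j)%N -> nu (a, j) = 0%N.
Local Notation I := ('I_n * 'I_L)%type.

Let e (i : I) : mindex n := idelta i.1 i.2.+1.
Let C (i l : I) : int := cmin al' t i.1 i.2.+1 l.1 l.2.+1.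

Let e0 i : e i != 0. Proof. exact: idelta_neq0. Qed.

Lemma fam_deg_spread (m : {ffun I -> nat}) a :
  fam_deg e m a = (\sum_(1 <= i < L.+1) i * spread m (a, i))%N.
Proof.
rewrite /fam_deg mindex_sum big_add1 /= big_mkord.
transitivity (\sum_b \sum_i (e (b, i) *+ m (b, i)) a)%N.
  by rewrite pair_bigA; apply: eq_bigr => -[].
rewrite (bigD1 a) //= [X in (_ + X)%N]big1 ?addn0.
  by apply: eq_bigr => i _; rewrite mindexMn ffunE eqxx spreadE.
move=> b /negPf ba; rewrite big1 // => i _.
by rewrite mindexMn ffunE eq_sym ba.
Qed.

(** By [zero_half] both sides of the weight constraint carry the factor [eps b]. Once it is
    cancelled, independence of the half roots compares the indices node by node. *)
Lemma admissibleE k (m : mult_family n) :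
  admissible nu (total_weight nu - wt' k) m <->
  (forall a, m (a, 0%N) = 0%N) /\
  forall a, (\sum_(i \in pos_nat) (i * m (a, i)))%N = k a.
Proof.
have [L' hL'] := mult_family_bound m.
have eN a : (\sum_(i \in pos_nat) i * m (a, i))%N = (\sum_(1 <= i < L'.+1) i * m (a, i))%N.
  by rewrite (@pos_nat_bigE _ _ _ _ L') // => j /hL' ->; rewrite muln0.
pose N : mindex n := [ffun a => (\sum_(1 <= i < L'.+1) i * m (a, i))%N].
have eC b : \sum_a \sum_(i \in pos_nat) simple_root (zero_cartan X) a 0 b *+ (i * m (a, i))
    = wt' N 0 b *+ eps b.
  rewrite summxE -sumrMnl; apply: eq_bigr => a _.
  rewrite (@pos_nat_bigE _ _ _ _ L') => [|j /hL' ->]; last by rewrite muln0.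
  rewrite sumrMnr simple_rootE (zero_half hX) ffunE.
  by rewrite mulmxnE [RHS]mulrnAC -[al' a 0 b *+ eps b]mulr_natl natz.
have ep0 (b : 'I_n) : (eps b)%:Z != 0 by rewrite -lt0n eps_gt0.
rewrite /admissible /= subKr; split=> -[m0 h]; split=> // a.
  have -> : k = N; last by rewrite eN ffunE.
  apply: (wt'_inj (circ_pos hX) (@eps_gt0 X) (simple_half hX)).
  apply/rowP => b; have := h b; rewrite eC -[LHS]mulr_natr -[RHS]mulr_natr !natz.
  by move/(mulIf (ep0 b))/esym.
rewrite eC; congr (wt' _ 0 a *+ _); apply/ffunP => b.
by rewrite ffunE -eN h.
Qed.

Lemma admissible_spread k : (mdeg k <= L)%N ->
  admissible nu (total_weight nu - wt' k) = [set` [seq spread m | m <- fams e k]].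
Proof.
move=> kL; apply/seteqP; split=> m.
  move/admissibleE => [m0 hm] /=.
  have [L' hL'] := mult_family_bound m.
  have mL a i : (i == 0)%N || (L < i)%N -> m (a, i) = 0%N.
    case: (posnP i) => [-> _|i0 /=]; first exact: m0.
    move=> iL; apply/eqP; apply: contraTT iL => mi.
    have iL' : (i < L'.+1)%N by rewrite ltnNge; apply: contra mi => h; rewrite hL'.
    rewrite -leqNgt; apply: leq_trans kL; apply: leq_trans (@leq_wdeg _ (fun=> 1%N) k a _) => //.
    rewrite -hm (@pos_nat_bigE _ _ _ _ L') => [|j /hL' ->]; last by rewrite muln0.
    rewrite (bigD1_seq i) ?iota_uniq ?mem_index_iota ?i0 //=.
    by apply: leq_trans (leq_addr _ _); rewrite leq_pmulr // lt0n.
  apply/mapP; exists [ffun l : I => m (l.1, l.2.+1)]; last by rewrite spread_restrict.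
  rewrite mem_fams //; apply/eqP/ffunP => a; rewrite fam_deg_spread spread_restrict // -hm.
  by rewrite (@pos_nat_bigE _ _ _ _ L) // => j jL; rewrite mL ?jL ?orbT ?muln0.
move=> /mapP[m']; rewrite mem_fams // => /eqP hm ->; apply/admissibleE; split=> a.
  by rewrite spread_out.
rewrite -hm fam_deg_spread (@pos_nat_bigE _ _ _ _ L) // => j jL.
by rewrite spread_out ?jL ?orbT ?muln0.
Qed.

Definition vac_init : {ffun I -> int} :=
  [ffun l : I => \sum_(1 <= j < L.+1) (minn l.2.+1 j * nu (l.1, j))%:Z].

Lemma vacancy_spread (m : {ffun I -> nat}) a (i : 'I_L) :
  vacancy nu (spread m) a i.+1 = (vac_shift C vac_init m (a, i))%:~R.
Proof.
have e1 z : (z%:Z)%:~R = z%:R :> rat by [].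
rewrite /vacancy ffunE rmorphB /=; congr (_ - _).
  rewrite ffunE rmorph_sum (@pos_nat_bigE _ _ _ _ L) => [|j /nu_bound ->] //.
  by apply: eq_bigr => j _; rewrite mulnC.
transitivity (\sum_b \sum_k (C (b, k) (a, i) *+ m (b, k))%:~R : rat); last first.
  by rewrite pair_bigA rmorph_sum; apply: eq_bigr => -[].
rewrite mulr_sumr.
apply: eq_bigr => b _; rewrite (@pos_nat_bigE _ _ _ _ L) => [|j jL]; last first.
  by rewrite spread_out ?jL ?orbT // muln0 mulr0.
rewrite big_add1 /= big_mkord mulr_sumr; apply: eq_bigr => k _.
rewrite spreadE -[X in X%:~R]mulr_natr natz intrM e1 natrM (root_formE hX).
have t0 : (t a)%:R != 0 :> rat by rewrite pnatr_eq0 -lt0n tnode_gt0.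
have v0 : (tvee a)%:R != 0 :> rat by rewrite pnatr_eq0 -lt0n tvee_gt0.
have -> : (C (b, k) (a, i))%:~R = (half_root b 0 a)%:~R * (minn (t b * i.+1) (t a * k.+1))%:R / (t a)%:R :> rat.
  apply: (mulIf t0); rewrite divfK // -!e1 -!intrM /C /cmin /= divzK //.
  exact: tnode_dvd.
by field; rewrite t0 v0.
Qed.

(** A family of degree [k] occupies no level above [mdeg k], so levels up to L include all
    admissible families. At q = 1 the power of q is 1 and only the binomials remain. *)
Lemma Mtilde_lagF k : (mdeg k <= L)%N ->
  Mtilde nu (total_weight nu - wt' k) 1 = lagF K e C vac_init k.
Proof.
move=> kL; rewrite /Mtilde admissible_spread // -fsbig_seq; last first.
  by rewrite map_inj_uniq ?fams_uniq //; apply: spread_inj.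
rewrite big_map; apply: eq_bigr => m _; rewrite exp1rz mul1r /lag_weight.
transitivity (\prod_a \prod_i gbin K (vac_shift C vac_init m (a, i)) (m (a, i))); last first.
  by rewrite pair_bigA; apply: eq_bigr => -[].
apply: eq_bigr => a _; rewrite (@pos_nat_bigE _ _ _ _ L) => [|j jL]; last first.
  by rewrite spread_out ?jL ?orbT // /qbinomial expr1n eqxx big_geq // fact0 divr1.
rewrite big_add1 /= big_mkord; apply: eq_bigr => i _.
by rewrite /qbinomial expr1n eqxx spreadE vacancy_spread intrKfloor.
Qed.

End Multiplicity.

(** * Characters and antisymmetry *)

Definition wheight n (G : 'I_n -> nat) (mu : 'rV[int]_n) : int := \sum_a mu 0 a * (G a)%:Z.

Fact wheight_additive n (G : 'I_n -> nat) : zmod_morphism (wheight G).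
Proof. by move=> mu nu; rewrite -sumrB; apply: eq_bigr => a _; rewrite !mxE mulrBl. Qed.

HB.instance Definition _ n (G : 'I_n -> nat) :=
  GRing.isZmodMorphism.Build _ _ (wheight G) (wheight_additive G).

Section Characters.
Variables (K : numFieldType) (X : affine_type) (hX : affine_wf X).
Local Notation n := (rank X).
Local Notation A := (circ_cartan X).
Local Notation P := 'rV[int]_n.
Local Notation S := (pseries n K).
Local Notation al' := (@half_root X).
Local Notation wt' := (wt al').
Implicit Types (lam mu : P) (k : mindex n) (x : 'I_n -> K).

Let A2 : forall i, A i i = 2 := @circ_diag X.
Let A_pos := circ_pos hX.
Let ep_gt0 := @eps_gt0 X.
Let al_ep := simple_half hX.

Lemma wt_half_inj : injective (fun k => wt' k).
Proof. exact: (wt'_inj A_pos ep_gt0 al_ep). Qed.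

Lemma prep_zero f F x : prep al' f F -> f = 0 :> S -> torus x -> F x = 0.
Proof.
move=> pf f0 hx; have [l [h1 h2 h3]] := prep_laurent A_pos ep_gt0 al_ep 0 pf.
have := h1 x hx; rewrite wexp0 mul1r => ->.
rewrite (@lev_eq _ _ l [::]) => [|mu]; first by rewrite /lev big_nil.
rewrite /lcoef [RHS]big_nil -/(lcoef l mu); apply/eqP; apply: contrapT => /negP h.
by case/eqP: (h); have [k ->] := h3 _ h; rewrite h2 f0.
Qed.

Lemma prep_inj f g F G : prep al' f F -> prep al' g G ->
  (forall x, torus x -> F x = G x) -> f = g :> S.
Proof.
move=> pf pg e; have [l [h1 h2 _]] := prep_laurent A_pos ep_gt0 al_ep 0 (prepD pf (prepN pg)).
apply/funext => k; apply/eqP; rewrite -subr_eq0; have := h2 k; rewrite psDE psNE => <-.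
by apply/eqP/lev_inj => x hx; rewrite -h1 // e // subrr mulr0.
Qed.

Lemma laurent_prep (l : seq (P * K)) lam :
  (forall mu, lcoef l mu != 0 -> exists k, mu = lam - wt' k) ->
  prep al' (fun k => lcoef l (lam - wt' k)) (fun x => wexp x (- lam) * lev l x).
Proof.
move=> h; pose t := [seq mu <- undup (map fst l) | lcoef l mu != 0].
have [kf hk] : exists kf : P -> mindex n, forall mu, lcoef l mu != 0 -> mu = lam - wt' (kf mu).
  have h' mu : exists k, lcoef l mu != 0 -> mu = lam - wt' k.
    case: (boolP (lcoef l mu != 0)) => [/h[k e]|_]; first by exists k.
    by exists 0.
  by exists (fun mu => projT1 (cid (h' mu))) => mu; exact: (projT2 (cid (h' mu))).
have ut : uniq t by rewrite filter_uniq ?undup_uniq.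
exists [seq (kf mu, lcoef l mu) | mu <- t]; last first.
  move=> x hx; rewrite (@lev_lcoef _ _ _ (undup (map fst l))) ?undup_uniq //; last first.
    by move=> p pl; rewrite mem_undup map_f.
  rewrite mulr_sumr big_map big_filter [RHS]big_mkcond; apply: eq_bigr => mu _ /=.
  case: eqP => [->|/eqP c0]; first by rewrite mul0r mulr0.
  by rewrite mulrCA -wexpD // {2}(hk _ c0) addrA addNr add0r.
apply/funext => k; rewrite big_map ps_sumE.
under eq_bigr do rewrite ps_constM /ps_mono /=.
case: (eqVneq (lcoef l (lam - wt' k)) 0) => [ck|ck].
  rewrite ck big_seq big1 // => mu; rewrite mem_filter => /andP[c0 _].
  case: eqP => [e|_]; last by rewrite mulr0.
  by have em := hk mu c0; move: c0; rewrite em -e ck eqxx.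
have kt : lam - wt' k \in t.
  by rewrite mem_filter ck mem_undup; apply: contraNT ck => /lcoef_eq0 ->.
have ek mu : mu \in t -> k = kf mu -> mu = lam - wt' k.
  by rewrite mem_filter => /andP[c0 _] ->; apply: hk.
rewrite (bigD1_seq _ kt ut) /= big_seq_cond big1 ?addr0 => [|mu /andP[mt mk]].
  have /addrI/oppr_inj/wt_half_inj <- := hk _ ck.
  by rewrite eqxx mulr1.
by case: eqP => [/(ek _ mt) e|_]; [case/eqP: mk|rewrite mulr0].
Qed.

Lemma belowE mu lam : below mu lam <-> exists k, lam = mu - wt' k.
Proof.
have e (k : 'I_n -> nat) c : \sum_b (k b)%:R * (simple_root A b 0 c)%:~R / (eps b)%:R
    = (wt' (finfun k) 0 c)%:~R :> rat.
  rewrite summxE rmorph_sum; apply: eq_bigr => b _ /=.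
  have e2 (z : int) m : (z *+ m)%:~R = z%:~R * m%:R :> rat by rewrite rmorphMn mulr_natr.
  have ? : (eps b)%:R != 0 :> rat by rewrite pnatr_eq0 -lt0n ep_gt0.
  by rewrite al_ep ffunE !mulmxnE !e2; field.
split=> [[k hk]|[k ->]]; [exists (finfun k)|exists k => c].
  apply/rowP => c; apply: (intr_inj (R := rat)); rewrite hk e.
  by rewrite !mxE rmorphB.
rewrite e (_ : finfun k = k); last by apply/ffunP => b; rewrite ffunE.
by rewrite !mxE rmorphB.
Qed.

Lemma lev_refl i (l : seq (P * K)) x : torus x ->
  (forall mu, lcoef l (refl A i mu) = lcoef l mu) -> lev l (refl_pt A i x) = lev l x.
Proof.
move=> hx hl; transitivity (lev (lmap (refl A i) (fun=> 1) l) x).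
  by rewrite /lev !big_map; apply: eq_bigr => p _ /=; rewrite wexp_refl // mul1r.
by apply: lev_eq => mu; rewrite (lcoef_lmap _ _ _ (reflK A2 i) (reflK A2 i)) hl mul1r.
Qed.

Section Module.
Variables (V : chevalley_module K A) (lam : P).
Hypotheses (Virr : mod_irreducible V) (Vhw : has_highest_weight V lam).

Lemma character_laurent : exists l : seq (P * K),
  (forall mu, lcoef l mu = (wmult V mu)%:R) /\ forall x, character V x = lev l x.
Proof.
have [s hs] := wmult_finite A_pos Virr Vhw.
exists [seq (mu, (wmult V mu)%:R) | mu <- undup s]; split=> [mu|x].
  rewrite /lcoef big_map /=; case: (boolP (mu \in undup s)) => ms.
    rewrite -big_filter (_ : [seq j <- undup s | j == mu] = [:: mu]) ?big_seq1 //.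
    by rewrite filter_pred1_uniq ?undup_uniq.
  rewrite big_seq_cond big1 => [|nu /andP[ns /eqP e]]; last by move: ms; rewrite -e ns.
  by case: (wmult V mu =P 0%N) => [->//|/eqP/hs]; rewrite -mem_undup (negPf ms).
rewrite /lev big_map /= /character (@fsbigE _ _ _ _ _ (undup s)) ?undup_uniq //.
  by apply: eq_bigl => mu; rewrite in_setT.
move=> mu _; rewrite mem_undup => ms.
case: (wmult V mu =P 0%N) => [e|/eqP/hs]; last by rewrite (negPf ms).
by rewrite -/(wmult V mu) e mul0r.
Qed.

Lemma character_prep : prep al' (chi K al' (wmult V) lam) (fun x => wexp x (- lam) * character V x).
Proof.
have [l [h1 h2]] := character_laurent.
have h mu : lcoef l mu != 0 -> exists k, mu = lam - wt' k.
  rewrite h1 pnatr_eq0 => /(wmult_below A_pos Virr Vhw)[k ->].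
  by exists (ups (@eps X) k); rewrite (wt_ups al_ep).
rewrite (_ : chi _ _ _ _ = (fun k => lcoef l (lam - wt' k))); last first.
  by apply/funext => k; rewrite h1.
by apply: prep_ext (laurent_prep h) _ => x _; rewrite h2.
Qed.

Lemma character_refl i x : torus x -> character V (refl_pt A i x) = character V x.
Proof.
move=> hx; have [l [h1 h2]] := character_laurent; rewrite !h2 lev_refl // => mu.
by rewrite !h1 (wmult_refl A2 A_pos Virr Vhw).
Qed.

End Module.

Variables (ht : {additive P -> int}) (M : 'I_n -> nat).
Hypothesis M_gt0 : forall b, (0 < M b)%N.
Hypothesis ht_al : forall b, ht (al' b) = (M b)%:Z.
Hypothesis ht_dom : forall mu, dominant mu -> 0 <= ht mu.

(** Heights of dominant weights are nonnegative, so the dominant weights below [lam] are found in a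
    finite box. *)
Definition dom_below lam : seq (mindex n) :=
  [seq k <- mindex_box 'I_n (absz (ht lam)) | `[<dominant (lam - wt' k)>]].

Lemma mem_dom_below lam k : (k \in dom_below lam) = `[<dominant (lam - wt' k)>].
Proof.
rewrite mem_filter andb_idr // => /asboolP/ht_dom.
rewrite raddfB /= (ht_wt ht_al) => h.
by apply: (mem_box_wdeg M_gt0); move: h; move: (ht lam) => z; lia.
Qed.

Lemma dom_below_uniq lam : uniq (dom_below lam).
Proof. by rewrite filter_uniq ?mindex_box_uniq. Qed.

Lemma below_sum (g : P -> K) lam :
  \sum_(mu \in below lam `&` @dominant n) g mu = \sum_(k <- dom_below lam) g (lam - wt' k).
Proof.
transitivity (\sum_(mu <- [seq lam - wt' k | k <- dom_below lam]) g mu); last by rewrite big_map.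
rewrite [RHS]fsbig_seq; last first.
  by rewrite map_inj_uniq ?dom_below_uniq // => k k' /addrI/oppr_inj/wt_half_inj.
apply: eq_fsbigl; apply/seteqP; split=> mu /=.
  move=> [/belowE[k ->] dk]; apply/mapP; exists k => //.
  by rewrite mem_dom_below; apply/asboolP.
move=> /mapP[k]; rewrite mem_dom_below => /asboolP dk ->; split=> //.
by apply/belowE; exists k.
Qed.

Variable V : P -> chevalley_module K A.
Hypothesis hV : forall lam, dominant lam ->
  mod_irreducible (V lam) /\ has_highest_weight (V lam) lam.

Definition char_comb (d : P -> K) lam x : K :=
  \sum_(k <- dom_below lam) d (lam - wt' k) * character (V (lam - wt' k)) x.

(** The formal counterpart of [char_comb]; the monomial of index [k] accounts for the difference
    between the leading exponentials of lam and lam - wt' k. *)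
Definition chi_comb (d : P -> K) lam : S :=
  \sum_(k <- dom_below lam) ps_const (n := n) (d (lam - wt' k)) * ps_mono K k
    * chi K al' (wmult (V (lam - wt' k))) (lam - wt' k).

Lemma chi_comb_prep d lam : prep al' (chi_comb d lam) (fun x => wexp x (- lam) * char_comb d lam x).
Proof.
pose G k x := d (lam - wt' k) * wexp x (- wt' k)
  * (wexp x (- (lam - wt' k)) * character (V (lam - wt' k)) x).
pose g k : S := ps_const (n := n) (d (lam - wt' k)) * ps_mono K k
    * chi K al' (wmult (V (lam - wt' k))) (lam - wt' k).
rewrite /chi_comb /dom_below big_filter.
have hg k : `[<dominant (lam - wt' k)>] -> prep al' (g k) (G k).
  move=> /asboolP/hV[Virr Vhw]; apply: prepM; last exact: character_prep.
  by apply: prepM; [exact: prep_const|exact: prep_mono].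
apply: prep_ext (prep_sum _ hg) _ => x hx.
rewrite /char_comb /dom_below big_filter mulr_sumr; apply: eq_bigr => k _.
have -> : wexp x (- lam) = wexp x (- wt' k) * wexp x (- (lam - wt' k)).
  by rewrite -wexpD // opprB addrA addNr add0r.
by rewrite /G; ring.
Qed.

Lemma char_comb_refl d lam i x : torus x -> char_comb d lam (refl_pt A i x) = char_comb d lam x.
Proof.
move=> hx; apply: eq_big_seq => k; rewrite mem_dom_below => /asboolP/hV[Virr Vhw].
by rewrite (character_refl Virr Vhw).
Qed.

Lemma chi_comb0 d lam : dominant lam -> chi_comb d lam 0 = d lam.
Proof.
move=> dl; have [Virr Vhw] := hV dl.
rewrite /chi_comb ps_sumE (bigD1_seq 0) ?dom_below_uniq //=; last first.
  by rewrite mem_dom_below wt0 subr0; apply/asboolP.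
rewrite big1 ?addr0 => [|k /negPf k0].
  by rewrite -mulrA ps_constM ps_mono0 mul1r /chi wt0 !subr0 (wmult_lam A_pos Virr Vhw) mulr1.
rewrite !ps_mul_coef0 [ps_mono _ _ _](_ : _ = 0) ?mulr0 ?mul0r // /ps_mono.
by rewrite eq_sym k0.
Qed.

Variables (J : S) (F : ('I_n -> K) -> K).
Hypotheses (pJ : prep al' J F) (aJ : antisymmetric A F) (J0 : J 0 = 1).

(** By Weyl's formula a character times [J] has, among the regular dominant weights, a nonzero
    coefficient only at its own highest weight plus rho, so a single summand contributes. *)
Lemma chi_comb_coef d lam k : dominant (lam - wt' k) -> (chi_comb d lam * J) k = d (lam - wt' k).
Proof.
move=> dk; have ht0 b : 0 < ht (al' b) by rewrite ht_al ltz_nat.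
rewrite mulr_suml ps_sumE (bigD1_seq k) ?dom_below_uniq //=; last first.
  by rewrite mem_dom_below; apply/asboolP.
have e l : ((ps_const (n := n) (d (lam - wt' l)) * ps_mono K l
    * chi K al' (wmult (V (lam - wt' l))) (lam - wt' l)) * J) k
  = d (lam - wt' l) * (ps_mono K l * (chi K al' (wmult (V (lam - wt' l))) (lam - wt' l) * J)) k.
  by rewrite -!mulrA ps_constM.
rewrite e big_seq_cond big1 ?addr0 => [|l /andP[ll /negPf lk]].
  have em f : (ps_mono K k * f) k = f 0 by have := ps_monoM_add k f 0; rewrite addr0.
  rewrite em; have [Virr Vhw] := hV dk.
  by rewrite (weyl_character A2 A_pos ep_gt0 al_ep ht0 (circ_conn hX) Virr Vhw dk pJ aJ J0) ?wt0 ?subr0 // eqxx mulr1.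
rewrite e; apply/eqP; rewrite mulf_eq0; apply/orP; right; apply/eqP.
move: ll; rewrite mem_dom_below => /asboolP dl; have [Virr Vhw] := hV dl.
case: (pselect (exists m, l + m = k)) => [[m em]|h]; last first.
  by apply: ps_monoM_eq0 => m; apply/eqP => em; apply: h; exists m.
rewrite -em ps_monoM_add.
rewrite (weyl_character A2 A_pos ep_gt0 al_ep ht0 (circ_conn hX) Virr Vhw dl pJ aJ J0) ?wt0 ?subr0 //.
  by case: eqP => // m0; move: lk; rewrite -em m0 addr0 eqxx.
by rewrite -addrA -opprD -wtD em.
Qed.

(** The difference times the Jacobian is antisymmetric, hence determined by its
    coefficients at the regular dominant weights. *)
Lemma char_expansion (g : S) (G : ('I_n -> K) -> K) d lam x :
  prep al' g (fun x => wexp x (- lam) * G x) ->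
  (forall i x, torus x -> G (refl_pt A i x) = G x) ->
  (forall k, dominant (lam - wt' k) -> (g * J) k = d (lam - wt' k)) ->
  torus x -> G x = char_comb d lam x.
Proof.
move=> pg sG hg hx.
pose f := g - chi_comb d lam.
have pf : prep al' f (fun x => wexp x (- lam) * (G x - char_comb d lam x)).
  by apply: prep_ext (prepD pg (prepN (chi_comb_prep d lam))) _ => y hy; rewrite mulrBr.
have [l [h1 h2 h3]] := prep_laurent A_pos ep_gt0 al_ep (lam + rho n) (prepM pf pJ).
have anti i mu : lcoef l (refl A i mu) = - lcoef l mu.
  rewrite -mulN1r; apply: (lcoef_refl A2) => y hy.
  have hy' := torus_refl A i hy.
  have e z : torus z -> lev l z = (G z - char_comb d lam z) * (wexp z (rho n) * F z).
    move=> hz; rewrite -h1 // wexpD // wexpN //; have := wexp_neq0 lam hz.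
    by move: (wexp z lam) (wexp z (rho n)) (G z - _) (F z) => w r D f0 w0; field.
  by rewrite !e // sG // char_comb_refl // aJ //; ring.
have l0 mu : lcoef l mu = 0.
  apply: (@antisym_eq0 K n A ht (lcoef l) (map fst l)) => // [i|nu|nu dnu].
  - by rewrite al_ep raddfMn pmulrn_lgt0 ?ht_al ?ltz_nat.
  - by apply: contraNT => /lcoef_eq0 ->.
  case: (eqVneq (lcoef l nu) 0) => // /h3[k e].
  have dk : dominant (lam - wt' k).
    move=> b; have := dnu b; rewrite e !mxE; move: (lam 0 b) (wt' k 0 b) => u v; lia.
  by rewrite e h2 mulrBl psDE psNE hg // chi_comb_coef // subrr.
have f0 : f = 0.
  have uJ : J \is a GRing.unit by rewrite ps_unitE J0 oner_eq0.
  apply: (mulIr uJ); rewrite mul0r; apply/funext => k.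
  by rewrite -h2 l0.
have /eqP := prep_zero pf f0 hx; rewrite mulf_eq0 (negPf (wexp_neq0 _ hx)) /= subr_eq0.
by move/eqP.
Qed.

End Characters.

(** * Exponents of the Q-system *)

Section Exponent.
Variables (X : affine_type) (hX : affine_wf X).
Local Notation n := (rank X).
Local Notation al' := (@half_root X).
Local Notation t := (@tnode X).

Lemma lapl_minr (x s k : nat) : (0 < k)%N -> 0 <= lapl (fun i => (minn (s * i) x)%:Z) k.
Proof. by case: k => // k _; rewrite /lapl /= !mulnS; move: (s * k)%N => y; lia. Qed.

(** For a different from b the root coordinate is nonpositive and the concave function min has
    nonnegative [lapl]. For a = b the term is at most 2 and sits at k = j, where the prefactor
    supplies 2. *)
Lemma lapl_cmin a j b k : (0 < j)%N -> (0 < k)%N ->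
  0 <= ((a == b) && (j == k))%:Z *+ 2 - lapl (cmin al' t a j b) k.
Proof.
move=> j0 k0; have tb : (t b)%:Z != 0 by rewrite -lt0n tnode_gt0.
have cK i : cmin al' t a j b i * (t b)%:Z = al' a 0 b * (minn (t a * i) (t b * j))%:Z.
  by rewrite /cmin divzK // tnode_dvd.
have lK : lapl (cmin al' t a j b) k * (t b)%:Z
    = al' a 0 b * lapl (fun i => (minn (t a * i) (t b * j))%:Z) k.
  by rewrite /lapl !mulrBl mulrnAl !cK !mulrBr mulrnAr.
have tb0 : 0 < (t b)%:Z by rewrite ltz_nat tnode_gt0.
have e0 : 0 < (eps a)%:Z by rewrite ltz_nat eps_gt0.
have half := circ_half hX b a.
rewrite -(pmulr_lge0 _ tb0) mulrBl lK; case: (eqVneq a b) => [ab|ab] /=.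
  have al2 : al' a 0 b <= 2 by move: half; rewrite -ab circ_diag; nia.
  have -> : lapl (fun i => (minn (t a * i) (t b * j))%:Z) k = (t b)%:Z * (k == j)%:Z.
    rewrite -(lapl_min j0 k0) -ab /lapl mulrBr mulrBr mulrnAr -!PoszM.
    by rewrite !minnMr.
  by rewrite [j == k]eq_sym; case: (k == j); rewrite /= ?mulr0 ?mul0rn ?mul0r //; nia.
have al0 : al' a 0 b <= 0.
  have h : circ_cartan X b a <= 0 by rewrite /circ_cartan cartanE centry_le0 // eqSS; move: ab; rewrite eq_sym.
  by move: h; rewrite half; nia.
rewrite mul0rn mul0r sub0r oppr_ge0 mulr_le0_ge0 //.
exact: lapl_minr.
Qed.

Lemma QexponentE a j b k : (0 < j)%N -> (0 < k)%N ->
  (Qexponent a j b k)%:Z = ((a == b) && (j == k))%:Z *+ 2 - lapl (cmin al' t a j b) k.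
Proof.
move=> j0 k0; have := lapl_cmin a b j0 k0; set z := (X in 0 <= X) => z0.
have tb : (t b)%:R != 0 :> rat by rewrite pnatr_eq0 -lt0n tnode_gt0.
have vb : (tvee b)%:R != 0 :> rat by rewrite pnatr_eq0 -lt0n tvee_gt0.
have e1 y : (y%:Z)%:~R = y%:R :> rat by [].
rewrite /Qexponent (_ : _ - _ = z%:~R); last first.
  rewrite /z [RHS]intrB; congr (_ - _); first by case: (_ && _).
  apply: (mulIf tb); rewrite (root_formE' hX).
  have cK i : (cmin al' t a j b i)%:~R * (t b)%:R = (al' a 0 b)%:~R * (minn (t a * i) (t b * j))%:R :> rat.
    by rewrite -!e1 -!intrM /cmin divzK // tnode_dvd.
  have -> : (lapl (cmin al' t a j b) k)%:~R * (t b)%:R = (al' a 0 b)%:~R * (Bmat a j b k)%:~R :> rat.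
    rewrite /lapl /Bmat mulr2n !intrB intrD !mulrBl mulrDl !cK intrM !e1.
    by rewrite ![minn (t b * j) _]minnC; ring.
  by field; rewrite tb vb.
have -> : z%:~R = (absz z)%:R :> rat by rewrite -{1}(gez0_abs z0).
by rewrite natrK gez0_abs.
Qed.

End Exponent.

Lemma wexpMn (K : numFieldType) n (x : 'I_n -> K) mu m : torus x -> wexp x (mu *+ m) = wexp x mu ^+ m.
Proof. by move=> hx; rewrite pmulrn wexpMz // -exprnP. Qed.

(** * Normalized solutions and the final comparison *)

Section Solution.
Variables (R : realType) (X : affine_type) (hX : affine_wf X).
Local Notation n := (rank X).
Local Notation K := (R[i] : numFieldType).
Local Notation A := (circ_cartan X).
Local Notation al' := (@half_root X).
Local Notation wt' := (wt al').
Local Notation t := (@tnode X).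
Local Notation S := (pseries n R[i]).
Variable V : 'rV[int]_n -> chevalley_module R[i] A.
Hypothesis hV : forall lam, dominant lam ->
  mod_irreducible (V lam) /\ has_highest_weight (V lam) lam.
Variable d : 'I_n -> nat -> 'rV[int]_n -> R[i].
Variable Q : 'I_n -> nat -> ('I_n -> R[i]) -> R[i].
Hypothesis hQ : forall a j x,
  Q a j x = \sum_(lam \in @dominant n) d a j lam * character (V lam) x.
Hypothesis hQ0 : forall a x, (forall b, x b != 0) -> Q a 0%N x = 1.
Hypothesis hA1 : forall a j, d a j (fund_weight a *+ j) = 1.
Hypothesis hA2 : forall a j lam, dominant lam -> ~ below (fund_weight a *+ j) lam -> d a j lam = 0.
Hypothesis hB : forall a j x, (0 < j)%N -> (forall b, x b != 0) ->
  Q a j x ^+ 2 = Q a j.+1 x * Q a j.-1 x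
    + \prod_b \big[*%R/1]_(k \in pos_nat) Q b k x ^+ Qexponent a j b k.
Hypothesis hC : forall a x, (forall b, x b != 0) ->
  (forall b, 1 < `|wexp x (simple_root A b)|) ->
  (fun j => Q a j x / Q a j.+1 x : (R[i] : numFieldType)) @ \oo
    --> (wexp x (- fund_weight a) : (R[i] : numFieldType)).
Variables G M : 'I_n -> nat.
Hypothesis M_gt0 : forall b, (0 < M b)%N.
Hypothesis GM : forall b, \sum_a half_root b 0 a * (G a)%:Z = (M b)%:Z.

Let ht : {additive 'rV[int]_n -> int} := wheight G.

Let ht_al b : ht (al' b) = (M b)%:Z. Proof. exact: GM. Qed.

Let ht_dom mu : dominant mu -> 0 <= ht mu.
Proof. by move=> h; apply: sumr_ge0 => a _; rewrite mulr_ge0 //; apply: h. Qed.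

Lemma dominant_fund a j : dominant (fund_weight a *+ j : 'rV[int]_n).
Proof. by move=> b; rewrite mulmxnE mxE; case: (_ && _); rewrite /= ?mul0rn // mulrn_wge0. Qed.

(** [Qlead] and [Qnorm] are the same object, Q without its leading exponential, as a formal series
    and as a function; [Qlead_prep] links them. *)
Definition Qlead a j : S := chi_comb ht V (d a j) (fund_weight a *+ j).

Definition Qnorm a j x : R[i] := wexp x (- (fund_weight a *+ j)) * Q a j x.

Lemma Q_comb a j x : Q a j x = char_comb ht V (d a j) (fund_weight a *+ j) x.
Proof.
rewrite hQ -(@fsbig_widen _ _ _ _ (below (fund_weight a *+ j) `&` @dominant n)).
- by rewrite (below_sum hX M_gt0 ht_al ht_dom (fun lam => d a j lam * character (V lam) x)).
- by move=> lam [].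
move=> lam [dl nb] /=; rewrite hA2 ?mul0r // => b.
by apply: nb; split.
Qed.

Lemma Qlead_prep a j : prep al' (Qlead a j) (Qnorm a j).
Proof.
apply: prep_ext (chi_comb_prep hX ht hV (d a j) (fund_weight a *+ j)) _ => x _.
by rewrite /Qnorm Q_comb.
Qed.

Lemma Qlead0 a j : Qlead a j 0 = 1.
Proof. by rewrite /Qlead (chi_comb0 hX M_gt0 ht_al ht_dom hV) ?hA1 //; apply: dominant_fund. Qed.

Lemma QE a j x : torus x -> Q a j x = wexp x (fund_weight a) ^+ j * Qnorm a j x.
Proof. by move=> hx; rewrite /Qnorm -wexpMn // mulrA -wexpD // subrr wexp0 mul1r. Qed.

Lemma Qnorm0 a x : torus x -> Qnorm a 0 x = 1.
Proof. by move=> hx; rewrite /Qnorm mulr0n oppr0 wexp0 mul1r hQ0. Qed.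

(** By [sum_E] the leading exponentials of the second term multiply to e^(2 j Lambda_a - j alpha_a /
    eps_a), so dividing the system by e^(2 j Lambda_a) leaves the factor e^(- j alpha_a / eps_a). *)
Lemma Qnorm_sys a j N x : (0 < j)%N -> (forall b, t b * j < N)%N -> torus x ->
  Qnorm a j x ^+ 2 = Qnorm a j.+1 x * Qnorm a j.-1 x
    + wexp x (- al' a) ^+ j * \prod_b \prod_(1 <= k < N.+1) Qnorm b k x ^+ Qexponent a j b k.
Proof.
move=> j0 hN hx; pose w b := wexp x (fund_weight b).
have w0 b : w b != 0 by exact: wexp_neq0.
have jN (b : 'I_n) : (j <= N)%N.
  by apply: leq_trans _ (ltnW (hN b)); rewrite leq_pmull // tnode_gt0.
have prodE b : \big[*%R/1]_(k \in pos_nat) Q b k x ^+ Qexponent a j b k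
    = \prod_(1 <= k < N.+1) Q b k x ^+ Qexponent a j b k.
  apply: pos_nat_bigE => k kN; have k0 : (0 < k)%N by apply: leq_ltn_trans kN.
  case: (eqVneq (Qexponent a j b k) 0%N) => [->//|e].
  case: (E_support (QexponentE hX) j0 k0 e) => [/andP[_ /eqP jk]|h].
    by have := jN b; rewrite jk leqNgt kN.
  have h1 := hN b; have h2 : (k.-1 <= t a * k.-1)%N by rewrite leq_pmull // tnode_gt0.
  by exfalso; lia.
have sumE b : \prod_(1 <= k < N.+1) Q b k x ^+ Qexponent a j b k
    = w b ^ ((((a == b)%:Z *+ 2) - al' a 0 b) * j%:Z)
      * \prod_(1 <= k < N.+1) Qnorm b k x ^+ Qexponent a j b k.
  rewrite -(sum_E (@tnode_gt0 X) (tnode_dvd hX) (QexponentE hX) a j0 (ltnW (hN b)) (jN b)).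
  rewrite -exprnP -prodrXr -big_split; apply: eq_bigr => k _ /=.
  by rewrite QE // exprMn exprM.
have := hB a j0 hx; under eq_bigr do rewrite prodE sumE.
rewrite big_split /=.
have -> : \prod_b w b ^ ((((a == b)%:Z *+ 2) - al' a 0 b) * j%:Z)
    = w a ^+ j ^+ 2 * wexp x (- al' a) ^+ j.
  have -> : wexp x (- al' a) ^+ j = \prod_b w b ^ (- al' a 0 b * j%:Z).
    rewrite {1}/wexp -prodrXl; apply: eq_bigr => b _.
    by rewrite /w wexp_fund mxE exprnP exprz_exp.
  rewrite (bigD1 a) //= [in RHS](bigD1 a) //= mulrA eqxx; congr (_ * _).
    by rewrite -exprM exprnP -expfzDr //; congr (_ ^ _); rewrite [Posz true](_ : _ = 1) // PoszM; ring.
  by apply: eq_bigr => b /negPf ba; rewrite eq_sym ba mul0rn sub0r.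
rewrite (QE a j hx) (QE a j.+1 hx) (QE a j.-1 hx) -/(w a) => e.
have wj : w a ^+ j ^+ 2 != 0 by rewrite !expf_neq0.
have wS : w a ^+ j.+1 * w a ^+ j.-1 = w a ^+ j ^+ 2.
  by rewrite -exprD -exprM; congr (_ ^+ _); lia.
apply: (mulfI wj); rewrite -exprMn e -wS.
by move: (w a ^+ j.+1) (w a ^+ j.-1) => u v; ring.
Qed.

Lemma Qnorm_lim a x : torus x -> (forall b, 1 < nm (wexp x (simple_root A b))) ->
  forall e : R, 0 < e ->
  exists m, forall i, (m <= i)%N -> nm (Qnorm a i x / Qnorm a i.+1 x - 1) < e.
Proof.
move=> hx hn e e0; pose w := wexp x (fund_weight a).
have w0 : w != 0 by exact: wexp_neq0.
have nw : 0 < nm w by rewrite lt_neqAle nm_ge0 eq_sym nm_eq0 w0.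
have h : forall b, 1 < `|wexp x (simple_root A b)| by move=> b; rewrite nmE ltcR.
have /cvgrPdist_lt/(_ (e / nm w)%:C%C) := hC (a := a) hx h.
have e1 : 0 < (e / nm w)%:C%C by rewrite ltcR divr_gt0.
case/(_ e1) => m _ hm; exists m => i mi.
have := hm i mi; rewrite /= nmE ltcR ltr_pdivlMr //.
rewrite -nmM -nmN => hi; apply: le_lt_trans hi; rewrite le_eqVlt; apply/orP; left.
apply/eqP; congr nm.
rewrite wexpN // -/w !QE // -/w exprS.
move: (Qnorm a i x) (Qnorm a i.+1 x) => u v.
have wi : w ^+ i != 0 by rewrite expf_neq0.
(* If the next value vanishes, both quotients are 0 by convention and both sides are -1. *)
case: (eqVneq v 0) => [->|v0]; last by field; rewrite v0 w0 wi.
by rewrite !mulr0 !invr0 !mulr0 subr0 mulVf // sub0r.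
Qed.

Lemma Qlead_stable a j : eqtr M j.+1 (Qlead a j) (Qlead a j.+1).
Proof.
exact: (Q_stable (circ_pos hX) (@eps_gt0 X) (simple_half hX) M_gt0 ht_al (@tnode_gt0 X)
  (tnode_dvd hX) (QexponentE hX) Qlead_prep Qlead0 Qnorm0 Qnorm_sys Qnorm_lim).
Qed.

Lemma Qlead_zero a : Qlead a 0 = 1.
Proof. by apply: (prep_inj hX (Qlead_prep a 0) (prep1 _ _)) => x hx; apply: Qnorm0. Qed.

Lemma Qlead_sys a j N : (0 < j)%N -> (forall b, t b * j < N)%N ->
  Qlead a j ^+ 2 = Qlead a j.+1 * Qlead a j.-1
    + ps_mono _ (idelta a j) * \prod_b \prod_(1 <= k < N.+1) Qlead b k ^+ Qexponent a j b k.
Proof.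
move=> j0 hN; apply: (prep_inj hX (prep_exp 2 (Qlead_prep a j))
  (prepD (prepM (Qlead_prep a j.+1) (Qlead_prep a j.-1)) (prepM (prep_mono _ al' (idelta a j))
    (prep_prod _ _ (fun b => prep_prod _ _ (fun k => prep_exp (Qexponent a j b k) (Qlead_prep b k))))))).
by move=> x hx; rewrite (Qnorm_sys a j0 hN hx) wt_idelta -mulNrn wexpMn.
Qed.

Lemma Qlead_refl a j i x : torus x -> Q a j (refl_pt A i x) = Q a j x.
Proof. by move=> hx; rewrite !Q_comb (char_comb_refl hX M_gt0 ht_al ht_dom hV). Qed.

Variables (nu : mult_family n) (L : nat).
Hypothesis nu_bound : forall a j, (L < j)%N -> nu (a, j) = 0%N.

Lemma Q_prodE x : \prod_a \big[*%R/1]_(j \in pos_nat) Q a j x ^+ nu (a, j)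
  = \prod_a \prod_(1 <= j < L.+1) Q a j x ^+ nu (a, j).
Proof.
by apply: eq_bigr => a _; rewrite (@pos_nat_bigE _ _ _ _ L) // => j /nu_bound ->.
Qed.

Lemma total_weightE : total_weight nu
  = \sum_a \sum_(1 <= j < L.+1) fund_weight a *+ j *+ nu (a, j).
Proof.
apply: eq_bigr => a _; rewrite (@pos_nat_bigE _ _ _ _ L) => [|j /nu_bound ->].
  by apply: eq_bigr => j _; rewrite mulrnA.
by rewrite muln0.
Qed.

Lemma Q_prod_prep : prep al' (\prod_a \prod_(1 <= j < L.+1) Qlead a j ^+ nu (a, j))
  (fun x => wexp x (- total_weight nu) * \prod_a \prod_(1 <= j < L.+1) Q a j x ^+ nu (a, j)).
Proof.
apply: prep_ext (prep_prod _ _ (fun a => prep_prod _ _ (fun j => prep_exp (nu (a, j)) (Qlead_prep a j)))) _.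
move=> x hx; rewrite total_weightE -sumrN wexp_sum // -big_split; apply: eq_bigr => a _ /=.
rewrite -sumrN wexp_sum // -big_split; apply: eq_bigr => j _ /=.
by rewrite /Qnorm exprMn -mulNrn wexpMn.
Qed.

Lemma Q_expansion x : torus x ->
  \prod_a \big[*%R/1]_(j \in pos_nat) Q a j x ^+ nu (a, j)
  = \sum_(lam \in below (total_weight nu) `&` @dominant n) Mtilde nu lam 1 * character (V lam) x.
Proof.
move=> hx; rewrite (below_sum hX M_gt0 ht_al ht_dom (fun lam => Mtilde nu lam 1 * character (V lam) x)) Q_prodE.
pose J := jacobian al' (fun a => Qlead a 1%N).
have c1 a j : Qlead a j 0 = 1 := Qlead0 a j.
have al_free k : wt' k = 0 -> k = 0.
  by move=> h; apply: (wt_half_inj hX); rewrite h wt0.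
have [F pJ aJ] : exists2 F, prep al' J F & antisymmetric A F.
  apply: (jacobian_antisym (@circ_diag X) (circ_pos hX) (@eps_gt0 X) (simple_half hX)
    (U := fun a => Qnorm a 1%N)) => [a|a i y hy]; first exact: Qlead_prep.
  have hy' := torus_refl A i hy.
  by rewrite /Qnorm mulr1n !mulrA -!wexpD // subrr !wexp0 !mul1r Qlead_refl.
have J0 : J 0 = 1.
  have := jacobian_residue (u := fun a => Qlead a 1%N) (fun a => c1 a 1%N) al_free 0.
  rewrite ps_mul_coef0 ps_prod_coef0 eqxx big1 ?mulr1 // => a _.
  rewrite wt0 mxE sub0r exprN1.
  have ua : Qlead a 1%N \is a GRing.unit by rewrite ps_unitE c1 oner_eq0.
  have := congr1 (fun f : S => f 0) (mulrV ua).
  by rewrite ps_mul_coef0 c1 mul1r ps1E eqxx.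
rewrite -[RHS]/(char_comb ht V (fun lam => Mtilde nu lam 1) (total_weight nu) x).
pose G0 (y : 'I_n -> R[i]) : R[i] := \prod_a \prod_(1 <= j < L.+1) Q a j y ^+ nu (a, j).
rewrite -[LHS]/(G0 x).
apply: (char_expansion hX M_gt0 ht_al ht_dom hV pJ aJ J0 (G := G0) Q_prod_prep) => //.
  move=> i y hy; apply: eq_bigr => a _; apply: eq_bigr => j _.
  by rewrite Qlead_refl.
(* A cutoff that covers the levels of nu, the levels of all families of degree [k], and the weighted
   degree of [k], so that truncation does not affect this coefficient. *)
move=> k _; set L' := maxn L (maxn (mdeg k) (wdeg M k)).
have LL' : (L <= L')%N by rewrite leq_maxl.
have nuL' a j : (L' < j)%N -> nu (a, j) = 0%N by move=> h; apply/nu_bound/leq_ltn_trans/h.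
have kL' : (mdeg k <= L')%N by rewrite /L' !leq_max leqnn orbT.
have kM : (wdeg M k < L'.+1)%N by rewrite ltnS /L' !leq_max leqnn !orbT.
rewrite (Mtilde_lagF _ hX nuL' kL').
have stable1 a j : eqtr M 1 (Qlead a j) 1.
  by move=> l; rewrite ltnS leqn0 => /eqP/(wdeg_eq0 M_gt0) ->; rewrite c1 ps1E eqxx.
have := lagF_canonical (@tnode_gt0 X) M_gt0 al_free (tnode_dvd hX) Qlead_zero stable1
  Qlead_stable (QexponentE hX) Qlead_sys (fun a j => nu (a, j)) kM.
rewrite mulrC => ->; congr ((_ * _ : S) k); apply: eq_bigr => a _.
rewrite -(@pos_nat_bigE _ _ _ (fun j => Qlead a j ^+ nu (a, j)) L) => [|j /nu_bound -> //].
by apply: pos_nat_bigE => j /nuL' ->.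
Qed.

End Solution.

Theorem theorem6p3 (R : realType) (X : affine_type) (hX : affine_wf X)
  (V : 'rV[int]_(rank X) -> chevalley_module R[i] (circ_cartan X))
  (hV : forall lam, dominant lam ->
     mod_irreducible (V lam) /\ has_highest_weight (V lam) lam)
  (d : 'I_(rank X) -> nat -> 'rV[int]_(rank X) -> R[i])
  (Q : 'I_(rank X) -> nat -> ('I_(rank X) -> R[i]) -> R[i])
  (hQ : forall a j x, Q a j x =
     \sum_(lam \in @dominant (rank X)) d a j lam * character (V lam) x)
  (hQ0 : forall a x, (forall b, x b != 0) -> Q a 0%N x = 1)
  (hA1 : forall a j, d a j (fund_weight a *+ j) = 1)
  (hA2 : forall a j lam, dominant lam -> ~ below (fund_weight a *+ j) lam ->
     d a j lam = 0)
  (hB : forall a j x, (0 < j)%N -> (forall b, x b != 0) ->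
     Q a j x ^+ 2 = Q a j.+1 x * Q a j.-1 x
       + \prod_b \big[*%R/1]_(k \in pos_nat) Q b k x ^+ Qexponent a j b k)
  (hC : forall a x, (forall b, x b != 0) ->
     (forall b, 1 < `|wexp x (simple_root (circ_cartan X) b)|) ->
     (fun j => Q a j x / Q a j.+1 x : (R[i] : numFieldType)) @ \oo
       --> (wexp x (- fund_weight a) : (R[i] : numFieldType)))
  (nu : mult_family (rank X))
  (x : 'I_(rank X) -> R[i]) (hx : forall b, x b != 0) :
  \prod_a \big[*%R/1]_(j \in pos_nat) Q a j x ^+ nu (a, j)
  = \sum_(lam \in below (total_weight nu) `&` @dominant (rank X))
      Mtilde nu lam 1 * character (V lam) x.
Proof.
have [G [M [_ [M_gt0 GM]]]] := height_ex hX.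
have [L nu_bound] := mult_family_bound nu.
exact: (Q_expansion hX hV hQ hQ0 hA1 hA2 hB hC M_gt0 GM nu_bound hx).
Qed.
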